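(* Let $(B_{i,1},\ldots,B_{i,r})'$, $i=1,2,\ldots$, be i.i.d. random vectors in $\mathbb{R}^r$ with mean $b=(b_1,\ldots,b_r)'$ and finite covariance matrix $T$, and let $\bar B_n=(\bar B_{n,1},\ldots,\bar B_{n,r})'$ be the vector of averages of the first $n$ of these. Let $h_1,\ldots,h_p$ be real functions on $\mathbb{R}^r$ whose partial derivatives $\partial h_j(x)/\partial x_l$ exist and are continuous in a neighbourhood of $b$, and let $J(x)$ be the $p\times r$ Jacobi matrix of these partial derivatives. Let $\hat\theta_n$ be the $p$-dimensional estimator with components $\hat\theta_{n,j}=h_j(\bar B_{n,1},\ldots,\bar B_{n,r})$ and let $\theta_0$ have components $\theta_{0,j}=h_j(b)$, $j=1,\ldots,p$. Put $R_n=\hat\theta_n-\theta_0-J(b)(\bar B_n-b)$ and $\Sigma_0=J(b)\,T\,J(b)'$, and for $\varepsilon>0$ let $N_\varepsilon=\sup\{n\ge1:\|\hat\theta_n-\theta_0\|\ge\varepsilon\}$. Then $$\sqrt m\,\sup_{n\ge m}\|R_n\|\to0\ \text{ in probability as } m\to\infty,$$ and consequently, as $\varepsilon\to0$, $$\varepsilon^2N_\varepsilon\to_d\sup_{0\le s\le1}\|\Sigma_0^{1/2}W(s)\|^2,$$ where $W(s)=(W_1(s),\ldots,W_p(s))'$ is a vector of $p$ independent standard Brownian motions.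
   Context: $\to_d$ denotes convergence in distribution. The distance function $\|\cdot\|$ is a given function on $\mathbb{R}^p$ with the properties: $\|x+y\|\le\|x\|+\|y\|$; $\|x\|=0$ if and only if $x=0$; $\|x_n\|\to\|x\|$ when $x_n\to x$; $\|ax\|=|a|\,\|x\|$ for scalars $a$; and $\|(x_1,\ldots,x_p)'\|\le c\sum_{i=1}^p|x_i|$ for some constant $c$. $\Sigma_0^{1/2}$ is the symmetric nonnegative definite square root of $\Sigma_0$. The functions $h_j$ are measurable. The supremum of the empty set in the definition of $N_\varepsilon$ is taken to be $0$. *)

(* Defs.v *)
From HB Require Import structures.
From mathcomp Require Export all_boot all_order all_algebra.
From mathcomp Require Export all_classical all_reals all_analysis measurable_realfun.
Export numFieldNormedType.Exports.
Export Order.TTheory GRing.Theory Num.Theory.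

Set Implicit Arguments.
Unset Strict Implicit.
Unset Printing Implicit Defensive.

Local Open Scope classical_set_scope.
Local Open Scope ring_scope.

(** The column space R^n with its Borel sigma-algebra; as a type it is
    convertible to ['cV[R]_n]. *)
Notation borel_cV R n := (g_sigma_algebraType (@open 'cV[R]_n)).

(** Mutual independence; [uniq s] lists a finite set of indices. *)
Definition independent_systems d (T : measurableType d) (R : realType)
    (P : probability T R) (I : eqType) (F : I -> set (set T)) : Prop :=
  forall (s : seq I) (A : I -> set T), uniq s ->
    (forall i, i \in s -> F i (A i)) ->
    P (\bigcap_(i in [set` s]) A i) = (\prod_(i <- s) P (A i))%E.

Definition independent_RVs d (T : measurableType d) (R : realType)
    (P : probability T R) (I : eqType) d' (T' : measurableType d')
    (X : I -> T -> T') : Prop :=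
  independent_systems P
    (fun i => preimage_set_system [set: T] (X i) measurable).

Definition process_sigma_algebra d (T : measurableType d) (R : realType)
    (X : R -> T -> R) : set (set T) :=
  <<s \bigcup_(t in [set t : R | 0 <= t])
        preimage_set_system [set: T] (X t) measurable >>.

Definition independent_processes d (T : measurableType d) (R : realType)
    (P : probability T R) (I : eqType) (X : I -> R -> T -> R) : Prop :=
  independent_systems P (fun i => process_sigma_algebra (X i)).

Definition iid_vectors d (T : measurableType d) (R : realType)
    (P : probability T R) (r : nat) (B : nat -> T -> 'cV[R]_r) : Prop :=
  [/\ forall i, measurable_fun [set: T] (B i : T -> borel_cV R r),
      independent_RVs P (B : nat -> T -> borel_cV R r) &
      forall i (A : set (borel_cV R r)), measurable A ->
        P (B i @^-1` A) = P (B 0%N @^-1` A)].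

Definition has_mean_cov d (T : measurableType d) (R : realType)
    (P : probability T R) (r : nat) (X : T -> 'cV[R]_r)
    (b : 'cV[R]_r) (S : 'M[R]_r) : Prop :=
  [/\ forall k, (fun w => X w k 0) \in Lfun P 2%:E,
      forall k, 'E_P[fun w => (X w k 0)%R]%E = (b k 0)%:E &
      forall k l,
        covariance P (fun w => X w k 0) (fun w => X w l 0) = (S k l)%:E].

(** The variables are extended-real because a supremum over infinitely many
    indices may be infinite on a null set. Their measurability is part of both
    notions of convergence, without it [P] of the events below means nothing. *)
Definition cvg_in_probability d (T : measurableType d) (R : realType)
    (P : probability T R) (X : nat -> T -> \bar R) (l : R) : Prop :=
  (forall n, measurable_fun [set: T] (X n)) /\
  forall delta : R, 0 < delta ->
    P [set w | (delta%:E <= `|X n w - l%:E|)%E] @[n --> \oo] --> 0%E.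

(** Convergence of the distribution functions at the continuity points of the
    limit one. On the compact line [-oo, +oo] this is weak convergence, so that
    nothing is lost by letting only real points occur. *)
Definition cvg_in_distribution d (T : measurableType d)
    d' (T' : measurableType d') (R : realType)
    (P : probability T R) (P' : probability T' R)
    (I : Type) (F : set_system I) (X : I -> T -> \bar R) (Y : T' -> \bar R)
    : Prop :=
  [/\ \forall i \near F, measurable_fun [set: T] (X i),
      measurable_fun [set: T'] Y &
      forall x : R,
        {for x, continuous (fun y : R => P' [set w | (Y w <= y%:E)%E])} ->
        P [set w | (X i w <= x%:E)%E] @[i --> F]
          --> P' [set w | (Y w <= x%:E)%E]].

(** Only the times [t >= 0] matter. [normal_prob m s] is the normal law with
    mean [m] and standard deviation [s]. The paths are continuous everywhere,
    not merely almost everywhere, so that a supremum over uncountably many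
    times is measurable. *)
Definition standard_Brownian_motion d (T : measurableType d) (R : realType)
    (P : probability T R) (W : R -> T -> R) : Prop :=
  [/\ forall t, 0 <= t -> measurable_fun [set: T] (W t),
      {ae P, forall w, W 0 w = 0},
      forall t : nat -> R, 0 <= t 0%N -> nondecreasing_seq t ->
        independent_RVs P (fun (i : nat) w => W (t i.+1) w - W (t i) w),
      forall (s t : R) (A : set R), 0 <= s -> s < t -> measurable A ->
        P [set w | A (W t w - W s w)] = normal_prob 0 (Num.sqrt (t - s)) A &
      forall w, {within `[0, +oo[, continuous (fun t => W t w)}].

Definition independent_Brownian_motions d (T : measurableType d)
    (R : realType) (P : probability T R) (p : nat)
    (W : 'I_p -> R -> T -> R) : Prop :=
  (forall j, standard_Brownian_motion P (W j)) /\ independent_processes P W.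

Definition distance_function (R : realType) (p : nat) (N : 'cV[R]_p -> R)
    : Prop :=
  [/\ forall x y, N (x + y) <= N x + N y,
      forall x, N x = 0 <-> x = 0,
      forall (u : nat -> 'cV[R]_p) x,
        u n @[n --> \oo] --> x -> N (u n) @[n --> \oo] --> N x,
      forall (a : R) x, N (a *: x) = `|a| * N x &
      exists c : R, forall x, N x <= c * \sum_(i < p) `|x i 0|].

Definition is_psd_sqrt (R : realType) (p : nat) (Q S : 'M[R]_p) : Prop :=
  [/\ Q^T = Q,
      forall x : 'cV[R]_p, 0 <= (x^T *m Q *m x) 0 0 &
      Q *m Q = S].

Definition partial (R : realType) (r : nat) (f : 'cV[R]_r -> R) (l : 'I_r)
    (x : 'cV[R]_r) : R :=
  'D_(delta_mx l 0) f x.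

Definition C1_near (R : realType) (r : nat) (f : 'cV[R]_r -> R)
    (b : 'cV[R]_r) : Prop :=
  \forall x \near b, forall l : 'I_r,
    derivable f x (delta_mx l 0) /\ {for x, continuous (partial f l)}.

Definition Jacobi (R : realType) (p r : nat) (h : 'I_p -> 'cV[R]_r -> R)
    (x : 'cV[R]_r) : 'M[R]_(p, r) :=
  \matrix_(j < p, l < r) partial (h j) l x.

(** The vectors are numbered from 0, and [average B n] is the average of the
    first [n] of them. *)
Definition average (T : Type) (R : realType) (r : nat)
    (B : nat -> T -> 'cV[R]_r) (n : nat) (w : T) : 'cV[R]_r :=
  n%:R^-1 *: \sum_(i < n) B i w.

Definition apply_cV (R : realType) (p r : nat) (h : 'I_p -> 'cV[R]_r -> R)
    (x : 'cV[R]_r) : 'cV[R]_p :=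
  \col_(j < p) h j x.

Definition estimator (T : Type) (R : realType) (p r : nat)
    (B : nat -> T -> 'cV[R]_r) (h : 'I_p -> 'cV[R]_r -> R) (n : nat) (w : T)
    : 'cV[R]_p :=
  apply_cV h (average B n w).

Definition remainder (T : Type) (R : realType) (p r : nat)
    (B : nat -> T -> 'cV[R]_r) (h : 'I_p -> 'cV[R]_r -> R) (b : 'cV[R]_r)
    (n : nat) (w : T) : 'cV[R]_p :=
  estimator B h n w - apply_cV h b - Jacobi h b *m (average B n w - b).

(** The supremum is that of a set of positive numbers, and taking the maximum
    with 0 makes it 0 when this set is empty. *)
Definition last_exit (T : Type) (R : realType) (p : nat) (N : 'cV[R]_p -> R)
    (thetahat : nat -> T -> 'cV[R]_p) (theta0 : 'cV[R]_p) (eps : R) (w : T)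
    : \bar R :=
  maxe 0%E (ereal_sup
    [set n%:R%:E |
       n in [set n | (1 <= n)%N /\ eps <= N (thetahat n w - theta0)]]).

(* Main.v *)
From HB Require Import structures.
Require Import Defs.
From mathcomp Require Import ring lra.

Set Implicit Arguments.
Unset Strict Implicit.
Unset Printing Implicit Defensive.

Local Open Scope classical_set_scope.
Local Open Scope ring_scope.

(** The delta method writes the error of the estimator at time [n] as
    [J (avg_n - b) + R_n] with [J] the Jacobi matrix, and everything reduces
    to the averages of the sample.

    The remainder. Since the partial derivatives are continuous, [h] is totally
    differentiable at [b], so that [R_n] is at most [eta] times the deviation of
    the average once this deviation is small ([remainder_le]). By a maximal
    inequality on dyadic blocks, the deviation stays of order [m ^ (- 1 / 2)] at
    all times [n >= m], up to a small probability ([pr_deviation]). As [eta] is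
    arbitrary, the first conclusion follows ([remainder_small]).

    The last exit. With [M = y / eps ^ 2], the event that [eps ^ 2] times the
    last exit exceeds [y] says that [sqrt M * N (error at time n) >= sqrt y] for
    some [n > M] ([scaled_exit_le]). For [n] close to [M / u], [u] in
    [`]0, 1]], the vector [sqrt M *: (J (avg_n - b))] behaves like
    [Q W(u)], [Q] the square root of [J T J^T]: the covariance of the values at
    [M / u] and [M / v] tends to [min u v] times [J T J^T], which is the
    covariance of [Q W] itself. Looking backwards in time, Brownian motion thus
    appears on [`[0, 1]] directly. Convergence in law at finitely many times is
    obtained from the real characteristic functions
    [E cos (linear form + phase)]: those of the averages converge by a
    Lindeberg argument uniform in the weights ([linform_clt],
    [expect_cos_Uvec_cvg]), those of Brownian motion are computed from the
    normal law of the increments ([expect_cos_Vvec]), and a continuity theorem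
    of Levy for Lipschitz functions ([levy_lipschitz]) transfers this to the
    maximum of [N] over the chosen times ([cvg_exists_error]).

    Two bounds remain. An exceedance is more likely than one at finitely many
    times, and by continuity of the paths finitely many dyadic times exhaust
    the supremum of [N (Q W)] ([exceedance_liminf], [exists_dyadic_bound]). In
    the other direction, an exceedance at any time [n > M] is, up to events of
    small probability, an almost exceedance at a time of a fine grid
    ([exceedance_cover]): beyond [M * (1 + L)] the averages are too small
    ([pr_deviation]), and between two grid points they oscillate little
    ([oscillation_small]). This gives [exceedance_limsup]. The convergence of
    the distribution functions at the continuity points of the limit follows
    ([scaled_exit_cvg]). *)

(** * Taylor estimates *)

Section taylor.
Context {R : realType}.
Implicit Types x y v : R.

(** The mean value theorem, used to integrate Taylor bounds one order at a time. *)
Lemma growth_le (f df : R -> R) (K : R) (n : nat) :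
  (forall x, is_derive x 1 f (df x)) -> f 0 = 0 ->
  (forall x, `|df x| <= K * `|x| ^+ n) ->
  forall x, `|f x| <= K * `|x| ^+ n.+1.
Proof.
move=> fdf f0 hdf x.
have K0 : 0 <= K.
  by have := hdf 1; rewrite normr1 expr1n mulr1; apply: le_trans.
have cf : continuous f.
  move=> z; apply: differentiable_continuous; apply/derivable1_diffP.
  by have [] := fdf z.
have key c : `|c| <= `|x| -> `|df c * x| <= K * `|x| ^+ n.+1.
  move=> cx; rewrite normrM exprSr mulrA ler_wpM2r//.
  rewrite (le_trans (hdf c))// ler_wpM2l// lerXn2r// nnegrE//.
have [x0|x0] := leP 0 x.
- have [c] := @MVT_segment R f df 0 x x0 (fun z _ => fdf z)
    (continuous_subspaceT cf).
  rewrite in_itv/= f0 !subr0 => /andP[c0 cx] ->; apply: key.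
  by rewrite !ger0_norm.
- have [c] := @MVT_segment R f df x 0 (ltW x0) (fun z _ => fdf z)
    (continuous_subspaceT cf).
  rewrite in_itv/= f0 !sub0r => /andP[xc c0] fE.
  rewrite -normrN fE mulrN normrN; apply: key.
  by rewrite !ler0_norm// ?(ltW x0)// lerN2.
Qed.

Lemma norm_sin_le x : `|sin x| <= `|x|.
Proof.
have := @growth_le sin cos 1 0 (fun z => is_derive_sin z) (@sin0 R).
by move/(_ _ x); rewrite mul1r expr1; apply => z; rewrite expr0 mulr1 cos_max.
Qed.

Lemma norm_cosB1 x : `|1 - cos x| <= `|x| ^+ 2.
Proof.
have := @growth_le (fun z => 1 - cos z) sin 1 1.
move/(_ _ _ _ x); rewrite mul1r; apply.
- move=> z; apply: is_derive_eq; rewrite /GRing.scale/=; ring.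
- by rewrite cos0 subrr.
- by move=> z; rewrite mul1r expr1 norm_sin_le.
Qed.

Lemma norm_sinB x : `|x - sin x| <= `|x| ^+ 3.
Proof.
have := @growth_le (fun z => z - sin z) (fun z => 1 - cos z) 1 2.
move/(_ _ _ _ x); rewrite mul1r; apply.
- by rewrite sin0 subrr.
- by move=> z; rewrite mul1r norm_cosB1.
Qed.

Lemma norm_cos_taylor4 x : `|cos x - (1 - x ^+ 2 / 2)| <= `|x| ^+ 4.
Proof.
have := @growth_le (fun z => cos z - (1 - z ^+ 2 / 2)) (fun z => z - sin z) 1 3.
move/(_ _ _ _ x); rewrite mul1r; apply.
- move=> z; apply: is_derive_eq; rewrite /GRing.scale/=; by field.
- by rewrite cos0 expr0n/= mul0r subr0 subrr.
- by move=> z; rewrite mul1r norm_sinB.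
Qed.

(** The two orders serve two ends: the third makes the error of a small variable
    negligible, the second keeps it integrable when only second moments exist. *)
Lemma sin_error x : `|sin x - x| <= 2 * (x ^+ 2 * Num.min 1 `|x|).
Proof.
rewrite distrC -(real_normK (num_real x)).
have [x1|x1] := leP 1 `|x|.
  rewrite mulr1; have := ler_normB x (sin x); have := norm_sin_le x.
  have : `|x| <= `|x| ^+ 2 by rewrite expr2 ler_peMl.
  lra.
rewrite -exprSr (le_trans (norm_sinB x))// ler_peMl ?exprn_ge0//; lra.
Qed.

Lemma cos_error x :
  `|cos x - (1 - x ^+ 2 / 2)| <= 2 * (x ^+ 2 * Num.min 1 `|x|).
Proof.
have [x1|x1] := leP 1 `|x|.
  rewrite mulr1; have := norm_cosB1 x; rewrite (real_normK (num_real x)).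
  have -> : cos x - (1 - x ^+ 2 / 2) = x ^+ 2 / 2 - (1 - cos x) by ring.
  move=> h; apply: (le_trans (ler_normB _ _)).
  have x0 := sqr_ge0 x.
  have -> : `|x ^+ 2 / 2| = x ^+ 2 / 2 by rewrite ger0_norm// divr_ge0.
  lra.
have := norm_cos_taylor4 x; move=> /le_trans; apply.
rewrite -(real_normK (num_real x)).
rewrite -exprSr; have x0 := exprn_ge0 3 (normr_ge0 x).
have : `|x| ^+ 4 <= `|x| ^+ 3 by rewrite (exprSr _ 3) ler_piMr// ltW.
lra.
Qed.

Lemma expRN_error v : 0 <= v -> `|expR (- v) - (1 - v)| <= v ^+ 2.
Proof.
move=> v0; have h1 := expR_ge1Dx (- v).
have h2 := expR_ge1Dx v; rewrite ger0_norm; last by lra.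
have -> : expR (- v) = (expR v)^-1 by rewrite expRN.
rewrite lerBlDr.
have p1 : 0 < 1 + v by lra.
apply: (@le_trans _ _ (1 + v)^-1); first by rewrite lef_pV2// posrE expR_gt0.
rewrite -(@ler_pM2r _ (1 + v))// mulVf ?gt_eqF//.
have : 0 <= v ^+ 3 by rewrite exprn_ge0.
nra.
Qed.

(** [L * sin (x / L)] is a bounded substitute for the coordinate [x]. *)
Lemma sin_scale_error (L x : R) : 0 < L ->
  `|L * sin (x / L) - x| <= `|x| ^+ 3 / L ^+ 2.
Proof.
move=> L0; have h := norm_sinB (x / L).
have Ln : L != 0 by rewrite gt_eqF.
have -> : L * sin (x / L) - x = L * (sin (x / L) - x / L).
  by rewrite mulrBr (mulrC L (x / L)) divfK.
rewrite normrM (gtr0_norm L0) distrC.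
rewrite (le_trans (ler_wpM2l (ltW L0) h))//.
rewrite normrM normfV (gtr0_norm L0) le_eqVlt; apply/orP; left; apply/eqP.
by field.
Qed.

End taylor.

(** * Real-valued probabilities and expectations *)

Section real_probability.
Context d (T : measurableType d) (R : realType) (P : probability T R).
Implicit Types (A B : set T) (X Y f g : T -> R).

Definition pr A : R := fine (P A).

Definition expect f : R := \int[P]_w f w.

Definition rint f : Prop := P.-integrable [set: T] (EFin \o f).

Lemma prE A : measurable A -> P A = (pr A)%:E.
Proof. by move=> mA; rewrite /pr fineK// fin_num_measure. Qed.

Lemma pr_ge0 A : 0 <= pr A.
Proof. by rewrite /pr fine_ge0. Qed.

Lemma pr_le1 A : measurable A -> pr A <= 1.
Proof. by move=> mA; rewrite -lee_fin -prE// probability_le1. Qed.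

Lemma prT : pr setT = 1. Proof. by rewrite /pr probability_setT. Qed.

Lemma pr0 : pr set0 = 0. Proof. by rewrite /pr measure0. Qed.

Lemma le_pr A B : measurable A -> measurable B -> A `<=` B -> pr A <= pr B.
Proof. by move=> mA mB AB; rewrite -lee_fin -!prE// le_measure// inE. Qed.

Lemma prC A : measurable A -> pr (~` A) = 1 - pr A.
Proof.
move=> mA; apply: EFin_inj; rewrite -prE ?probability_setC ?EFinB -?prE//.
exact: measurableC.
Qed.

Lemma prU A B : measurable A -> measurable B -> pr (A `|` B) <= pr A + pr B.
Proof.
move=> mA mB; rewrite -lee_fin EFinD -!prE//; last exact: measurableU.
exact: measureU2.
Qed.

Lemma le_prU A B C : measurable A -> measurable B -> measurable C ->
  A `<=` B `|` C -> pr A <= pr B + pr C.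
Proof.
move=> mA mB mC AB; apply: (le_trans _ (prU mB mC)).
by apply: le_pr => //; exact: measurableU.
Qed.

Lemma pr_bigsetU (n : nat) (F : nat -> set T) :
  (forall i, (i < n)%N -> measurable (F i)) ->
  pr (\big[setU/set0]_(i < n) F i) <= \sum_(i < n) pr (F i).
Proof.
elim: n => [|n IH] mF; first by rewrite !big_ord0 pr0.
rewrite !big_ord_recr/=; apply: le_trans (prU _ (mF _ _)) _ => //.
  by apply: bigsetU_measurable => i _; apply: mF; exact: leqW (ltn_ord i).
by rewrite lerD2r; apply: IH => i ilt; apply: mF; exact: leqW.
Qed.

Lemma pr_trivIset (n : nat) (F : nat -> set T) :
  (forall i, measurable (F i)) -> trivIset setT F ->
  pr (\big[setU/set0]_(i < n) F i) = \sum_(i < n) pr (F i).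
Proof.
move=> mF tF; apply: EFin_inj; rewrite -prE; last exact: bigsetU_measurable.
rewrite measure_bigsetU// -sumEFin; apply: eq_bigr => i _.
exact: prE.
Qed.

Lemma pr_bigcup_le (F : nat -> set T) (c : R) :
  (forall i, measurable (F i)) -> nondecreasing_seq F ->
  (forall n, pr (F n) <= c) -> pr (\bigcup_n F n) <= c.
Proof.
move=> mF ndF Fc; have mU := bigcupT_measurable F mF.
have := nondecreasing_cvg_mu (mu := P) mF mU ndF.
rewrite -lee_fin -prE// => /cvg_lim <-//.
apply: lime_le; first by apply/cvg_ex; eexists; exact: nondecreasing_cvg_mu.
by apply: nearW => n /=; rewrite prE// lee_fin.
Qed.

(** Continuity from above, in the form of one index that is good enough. *)
Lemma pr_bigcap_cvg (F : nat -> set T) (e : R) :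
  (forall i, measurable (F i)) -> nonincreasing_seq F -> 0 < e ->
  exists n, pr (F n) <= pr (\bigcap_n F n) + e.
Proof.
move=> mF niF e0; have mI := bigcapT_measurable mF.
have h := nonincreasing_cvg_mu (mu := P) (le_lt_trans
  (probability_le1 P (mF 0%N)) (ltry _)) mF mI niF.
have /cvgrPdist_le : pr (F n) @[n --> \oo] --> pr (\bigcap_n F n).
  by apply: fine_cvg; rewrite -prE.
move=> /(_ e e0)[n _ /(_ n (leqnn _))] /= h'.
exists n; move: h'; rewrite ler_distlC => /andP[_]; lra.
Qed.

Lemma rint_bounded f (c : R) : measurable_fun setT f ->
  (forall w, `|f w| <= c) -> rint f.
Proof.
move=> mf fc; apply: measurable_bounded_integrable => //.
  by rewrite (le_lt_trans (probability_le1 P _)) ?ltry.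
exists c; split; first exact: num_real.
by move=> x cx w _ /=; rewrite (le_trans (fc w))// ltW.
Qed.

Lemma rint_measurable f : rint f -> measurable_fun setT f.
Proof. by move=> /measurable_int /measurable_EFinP. Qed.

Lemma rint_cst (c : R) : rint (fun=> c).
Proof. exact: (@rint_bounded _ `|c|). Qed.

Lemma rint_le f g : measurable_fun setT f -> (forall w, `|f w| <= g w) ->
  rint g -> rint f.
Proof.
move=> mf fg ig; apply: le_integrable ig => //; first exact/measurable_EFinP.
by move=> w _ /=; rewrite lee_fin (le_trans (fg w))// ler_norm.
Qed.

Lemma rintD f g : rint f -> rint g -> rint (fun w => f w + g w).
Proof. by move=> hf hg; exact: (integrableD _ hf hg). Qed.

Lemma rintB f g : rint f -> rint g -> rint (fun w => f w - g w).
Proof. by move=> hf hg; exact: (integrableB _ hf hg). Qed.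

Lemma rintZ (c : R) f : rint f -> rint (fun w => c * f w).
Proof. by move=> hf; exact: (integrableZl _ _ hf). Qed.

Lemma rint_norm f : rint f -> rint (fun w => `|f w|).
Proof. by move=> hf; exact: (integrable_norm hf). Qed.

Lemma rint_sum (I : Type) (s : seq I) (F : I -> T -> R) :
  (forall i, rint (F i)) -> rint (fun w => \sum_(i <- s) F i w).
Proof.
move=> hF; elim: s => [|i s IH].
  by under [X in rint X]eq_fun do rewrite big_nil; exact: rint_cst.
under [X in rint X]eq_fun do rewrite big_cons.
exact: rintD.
Qed.

Lemma rint_indic A : measurable A -> rint \1_A.
Proof. by move=> mA; apply: integrable_indic. Qed.

Lemma expectD f g : rint f -> rint g ->
  expect (fun w => f w + g w) = expect f + expect g.
Proof. by move=> *; exact: RintegralD. Qed.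

Lemma expectB f g : rint f -> rint g ->
  expect (fun w => f w - g w) = expect f - expect g.
Proof. by move=> *; exact: RintegralB. Qed.

Lemma expectZ (c : R) f : rint f -> expect (fun w => c * f w) = c * expect f.
Proof. by move=> *; exact: RintegralZl. Qed.

Lemma expect_cst (c : R) : expect (fun=> c) = c.
Proof. by rewrite /expect Rintegral_cst// -/(pr setT) prT mulr1. Qed.

Lemma le_expect f g : rint f -> rint g -> (forall w, f w <= g w) ->
  expect f <= expect g.
Proof. by move=> hf hg fg; apply: le_Rintegral. Qed.

Lemma norm_expect f : rint f -> `|expect f| <= expect (fun w => `|f w|).
Proof. by move=> hf; apply: le_normr_Rintegral. Qed.

Lemma norm_expect_le f (c : R) : measurable_fun setT f ->
  (forall w, `|f w| <= c) -> `|expect f| <= c.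
Proof.
move=> mf fc; have hf := rint_bounded mf fc.
rewrite (le_trans (norm_expect hf))// -(expect_cst c).
by apply: le_expect => //; [exact: rint_norm|exact: rint_cst].
Qed.

Lemma expect_sum (I : Type) (s : seq I) (F : I -> T -> R) :
  (forall i, rint (F i)) ->
  expect (fun w => \sum_(i <- s) F i w) = \sum_(i <- s) expect (F i).
Proof.
move=> hF; elim: s => [|i s IH].
  rewrite big_nil; under [X in expect X]eq_fun do rewrite big_nil.
  exact: expect_cst.
under [X in expect X]eq_fun do rewrite big_cons.
by rewrite big_cons expectD ?IH//; exact: rint_sum.
Qed.

Lemma expect_ge0 f : (forall w, 0 <= f w) -> 0 <= expect f.
Proof. by move=> f0; apply: Rintegral_ge0. Qed.

Lemma expect_indic A : measurable A -> expect \1_A = pr A.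
Proof.
by move=> mA; rewrite /expect /Rintegral integral_indic// setIT.
Qed.

Lemma expect_ae f g : measurable_fun setT f -> measurable_fun setT g ->
  {ae P, forall w, f w = g w} -> expect f = expect g.
Proof.
move=> mf mg fg; congr fine; apply: ae_eq_integral => //.
- exact/measurable_EFinP.
- exact/measurable_EFinP.
- by apply: filterS fg => w h _; rewrite h.
Qed.

Lemma markov_pr f (c : R) A : measurable A -> rint f -> (forall w, 0 <= f w) ->
  0 < c -> (forall w, A w -> c <= f w) -> pr A <= expect f / c.
Proof.
move=> mA hf f0 c0 Af; rewrite ler_pdivlMr// mulrC -expect_indic//.
rewrite -expectZ; last exact: rint_indic.
apply: le_expect => //; first by apply: rintZ; exact: rint_indic.
move=> w; rewrite indicE; have [|_] := boolP (w \in A); last by rewrite mulr0.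
by rewrite inE mulr1 => /Af.
Qed.

End real_probability.
Arguments pr {d T R} P A.
Arguments expect {d T R} P f.
Arguments rint {d T R} P f.

(** * Independence *)

Definition as_mfun d1 d2 (T1 : measurableType d1) (T2 : measurableType d2)
    (X : T1 -> T2) (mX : measurable_fun setT X) : {mfun T1 >-> T2} :=
  mfun_Sub (mem_set mX).

Section independence.
Context d (T : measurableType d) (R : realType) (P : probability T R).
Implicit Types (A B : set T) (G : set (set T)).

Lemma indep_generated_left G B :
  G `<=` measurable -> setI_closed G -> G setT -> measurable B ->
  (forall A, G A -> P (A `&` B) = (P A * P B)%E) ->
  forall A, <<s G >> A -> P (A `&` B) = (P A * P B)%E.
Proof.
move=> Gm GI GT mB GB A sA.
have pB0 := pr_ge0 P B; have eB := prE P mB.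
have -> : (P A * P B)%E = mscale (NngNum pB0) P A.
  by rewrite /mscale/= muleC eB.
apply: (g_sigma_algebra_measure_unique G Gm (fun=> setT) _ _ (mrestr P mB)
  (mscale (NngNum pB0) P) GI) => //.
- by rewrite bigcup_const//; exists 0%N.
- by move=> C GC; rewrite /mscale/= /mrestr GB// eB muleC.
- move=> _; apply: (le_lt_trans (probability_le1 P _) (ltry _)); exact: measurableI.
Qed.

(** The two systems are closed under intersection, so that a finite measure is
    determined by its values on them. *)
Lemma indep_generated G1 G2 :
  G1 `<=` measurable -> setI_closed G1 -> G1 setT ->
  G2 `<=` measurable -> setI_closed G2 -> G2 setT ->
  (forall A B, G1 A -> G2 B -> P (A `&` B) = (P A * P B)%E) ->
  forall A B, <<s G1 >> A -> <<s G2 >> B -> P (A `&` B) = (P A * P B)%E.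
Proof.
move=> m1 I1 T1 m2 I2 T2 H A B sA sB.
have mB : measurable B.
  by apply: sB; split => //; exact: sigma_algebra_measurable.
apply: (indep_generated_left m1) => // C GC.
rewrite setIC muleC; apply: (indep_generated_left m2) => //; first exact: m1.
by move=> D GD; rewrite setIC muleC; exact: H.
Qed.

Section blocks.
Context (I : eqType) (F : I -> set (set T)).
Hypothesis Fm : forall i, F i `<=` measurable.
Hypothesis FI : forall i, setI_closed (F i).
Hypothesis FT : forall i, F i setT.
Hypothesis indF : independent_systems P F.

Definition block (s : seq I) : set (set T) := \bigcup_(i in [set` s]) F i.

(** The sigma-algebra generated by a block of coordinates is reached through this
    system of rectangles, which is closed under intersection. *)
Definition block_pi (s : seq I) : set (set T) :=
  [set \bigcap_(i in [set` s]) A i | A in [set A | forall i, i \in s -> F i (A i)]].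

Lemma block_piP s : block_pi s `<=` measurable.
Proof.
move=> _ [A FA <-]; apply: fin_bigcap_measurable => //.
by move=> i si; apply: Fm; exact: FA.
Qed.

Lemma block_pi_setI s : setI_closed (block_pi s).
Proof.
move=> _ _ [A FA <-] [B FB <-]; exists (fun i => A i `&` B i).
  by move=> i si; apply: FI; [exact: FA|exact: FB].
by rewrite bigcapI.
Qed.

Lemma block_piT s : block_pi s setT.
Proof. by exists (fun=> setT) => //; rewrite bigcapT. Qed.

Lemma sub_block_pi s : block s `<=` block_pi s.
Proof.
move=> A [i/= si FA]; exists (fun j => if j == i then A else setT).
  by move=> j _; case: eqVneq => [->|_].
apply/seteqP; split => [w /(_ i)|w Aw j sj].
  by rewrite eqxx; apply.
by case: eqP.
Qed.

Lemma indep_blocks s1 s2 : uniq (s1 ++ s2) ->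
  forall A B, <<s block s1 >> A -> <<s block s2 >> B ->
  P (A `&` B) = (P A * P B)%E.
Proof.
move=> us A B sA sB.
have [u1 h u2] : [/\ uniq s1, ~~ has (mem s1) s2 & uniq s2].
  by move: us; rewrite cat_uniq => /and3P[].
apply: (@indep_generated (block_pi s1) (block_pi s2)); rewrite //.
- exact: block_piP.
- exact: block_pi_setI.
- exact: block_piT.
- exact: block_piP.
- exact: block_pi_setI.
- exact: block_piT.
- move=> _ _ [A1 FA1 <-] [A2 FA2 <-].
  pose C i := if i \in s1 then A1 i else A2 i.
  have n12 i : i \in s2 -> i \notin s1.
    by move=> i2; apply/negP => i1; move/hasPn : h => /(_ i i2) /=; rewrite i1.
  have FC s : uniq s -> {subset s <= s1 ++ s2} ->
      P (\bigcap_(i in [set` s]) C i) = (\prod_(i <- s) P (C i))%E.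
    move=> us' ss; apply: indF => // i /ss; rewrite mem_cat /C.
    by case: ifPn => [i1 _|_ /= i2]; [exact: FA1|exact: FA2].
  have E1 : \bigcap_(i in [set` s1]) A1 i = \bigcap_(i in [set` s1]) C i.
    by apply: eq_bigcapr => i /= i1; rewrite /C i1.
  have E2 : \bigcap_(i in [set` s2]) A2 i = \bigcap_(i in [set` s2]) C i.
    by apply: eq_bigcapr => i /= /n12 i1; rewrite /C (negbTE i1).
  rewrite E1 E2 -bigcap_setU.
  have -> : [set` s1] `|` [set` s2] = [set` s1 ++ s2].
    by apply/seteqP; split => i /=; rewrite mem_cat => /orP.
  rewrite FC// big_cat/= !FC//.
  + by move=> i i2; rewrite mem_cat i2 orbT.
  + by move=> i i1; rewrite mem_cat i1.
- by apply: sub_sigma_algebra2 sA; exact: sub_block_pi.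
- by apply: sub_sigma_algebra2 sB; exact: sub_block_pi.
Qed.

End blocks.

Definition indep_rv d1 d2 (T1 : measurableType d1) (T2 : measurableType d2)
    (X : T -> T1) (Y : T -> T2) : Prop :=
  forall (A : set T1) (B : set T2), measurable A -> measurable B ->
    P (X @^-1` A `&` Y @^-1` B) = (P (X @^-1` A) * P (Y @^-1` B))%E.

Lemma indep_rv_comp (X Y : T -> R) (f g : R -> R) :
  measurable_fun setT f -> measurable_fun setT g -> indep_rv X Y ->
  indep_rv (f \o X) (g \o Y).
Proof.
move=> mf mg ind A B mA mB.
have mfA : measurable (f @^-1` A) by rewrite -[_ @^-1` _]setTI; exact: mf.
have mgB : measurable (g @^-1` B) by rewrite -[_ @^-1` _]setTI; exact: mg.
exact: (ind _ _ mfA mgB).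
Qed.

Section product.
Variables (X Y : T -> R).
Hypothesis iX : rint P X.
Hypothesis iY : rint P Y.
Hypothesis ind : indep_rv X Y.

Let mX := rint_measurable iX.
Let mY := rint_measurable iY.
Let mXY : measurable_fun setT (fun w => (X w, Y w)).
Proof. exact: measurable_fun_pair. Qed.

Let rX := as_mfun mX.
Let rY := as_mfun mY.
Let rXY := as_mfun mXY.

Let D1 := distribution P rX.
Let D2 := distribution P rY.
Let D := distribution P rXY.

Let DE (A : set (R * R)) : measurable A -> (D1 \x D2)%E A = D A.
Proof.
by move=> mA; apply: product_measure_unique => //= A1 A2 mA1 mA2; exact: ind.
Qed.

Let prodf (z : R * R) : \bar R := (z.1 * z.2)%:E.

Let mprodf : measurable_fun setT prodf.
Proof. by apply/measurable_EFinP; apply: measurable_funM. Qed.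

Let int1 : (\int[D1]_x `|x%:E| < +oo)%E.
Proof.
rewrite (ge0_integral_distribution (rX : {RV P >-> R}))//=; last first.
  by apply: measurableT_comp => //; exact/measurable_EFinP.
by move/integrableP: iX => [].
Qed.

Let int2 : (\int[D2]_x `|x%:E| < +oo)%E.
Proof.
rewrite (ge0_integral_distribution (rY : {RV P >-> R}))//=; last first.
  by apply: measurableT_comp => //; exact/measurable_EFinP.
by move/integrableP: iY => [].
Qed.

Let iprodf : (D1 \x D2)%E.-integrable setT prodf.
Proof.
apply/integrable12ltyP => //=.
have e x : (\int[D2]_y `|prodf (x, y)| =
    `|x%:E| * (\int[D2]_y `|y%:E|))%E.
  under eq_integral do rewrite /prodf/= normrM EFinM.
  rewrite ge0_integralZl//.
  by apply: measurableT_comp => //; exact/measurable_EFinP.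
under eq_integral do rewrite e.
rewrite ge0_integralZr//; last 2 first.
- by apply: measurableT_comp => //; exact/measurable_EFinP.
- exact: integral_ge0.
by apply: lte_mul_pinfty => //; [exact: integral_ge0|rewrite ge0_fin_numE//; exact: integral_ge0].
Qed.

(** By Tonelli's theorem for the joint law, which independence makes a product. *)
Lemma rintM : rint P (fun w => X w * Y w).
Proof.
apply/integrableP; split.
  by apply/measurable_EFinP; apply: measurable_funM.
have /integrableP[_] := iprodf.
rewrite (eq_measure_integral D)//=; last by move=> A mA _; exact: DE.
rewrite (ge0_integral_distribution
  (rXY : {RV P >-> (R * R)%type}))//=.
by apply/measurable_EFinP; apply: measurableT_comp => //; exact: measurable_funM.
Qed.

Lemma expectM : expect P (fun w => X w * Y w) = expect P X * expect P Y.
Proof.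
have h := integral12_prod_meas1 iprodf.
have e1 : (\int[D1 \x D2]_z prodf z = \int[P]_w (X w * Y w)%:E)%E.
  rewrite (eq_measure_integral D)//=; last by move=> A mA _; exact: DE.
  rewrite (integral_distribution (X := (rXY : {RV P >-> (R * R)%type})))//=.
  exact: rintM.
have idX : (\int[D1]_x x%:E = \int[P]_w (X w)%:E)%E.
  by rewrite (integral_distribution (X := (rX : {RV P >-> R})))//=; exact/measurable_EFinP.
have idY : (\int[D2]_x x%:E = \int[P]_w (Y w)%:E)%E.
  by rewrite (integral_distribution (X := (rY : {RV P >-> R})))//=; exact/measurable_EFinP.
have fX : (\int[P]_w (X w)%:E)%E \is a fin_num by exact: integrable_fin_num.
have fY : (\int[P]_w (Y w)%:E)%E \is a fin_num by exact: integrable_fin_num.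
rewrite /expect /Rintegral -e1 -h -fineM//; congr fine.
rewrite -idX -idY.
have iD2 : D2.-integrable setT EFin.
  by apply/integrableP; split => //; exact/measurable_EFinP.
have iD1 : D1.-integrable setT EFin.
  by apply/integrableP; split => //; exact/measurable_EFinP.
have eD2 : (\int[D2]_x x%:E = (fine (\int[P]_w (Y w)%:E))%:E)%E by rewrite fineK.
rewrite eD2 -integralZr//; apply: eq_integral => x _.
transitivity (\int[D2]_y (x%:E * y%:E))%E; last by rewrite integralZl// eD2.
by apply: eq_integral => y _; rewrite -EFinM.
Qed.

End product.

End independence.

(** * Sums of independent variables *)

Section independent_sums.
Context d (T : measurableType d) (R : realType) (P : probability T R).
Context (I : eqType) (F : I -> set (set T)).
Hypothesis Fm : forall i, F i `<=` measurable.
Hypothesis FI : forall i, setI_closed (F i).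
Hypothesis FT : forall i, F i setT.
Hypothesis indF : independent_systems P F.
Variable xi : I -> T -> R.
Hypothesis ad : forall i (A : set R), measurable A -> F i (xi i @^-1` A).

Lemma measurable_summand i : measurable_fun setT (xi i).
Proof. by move=> _ A mA; rewrite setTI; apply: (Fm (i := i)); exact: ad. Qed.

Lemma measurable_partial_sum (s : seq I) :
  measurable_fun setT (fun w => \sum_(i <- s) xi i w).
Proof. by apply: measurable_sum => i; exact: measurable_summand. Qed.

Lemma adapted_partial_sum (s s' : seq I) : {subset s <= s'} ->
  measurable_fun (setT : set (g_sigma_algebraType (block F s')))
    ((fun w => \sum_(i <- s) xi i w) : g_sigma_algebraType (block F s') -> R).
Proof.
elim: s => [|x s IH] ss.
  rewrite [X in measurable_fun _ X](_ : _ = cst 0)//.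
  by apply/funext => w; rewrite big_nil.
rewrite [X in measurable_fun _ X](_ : _ =
  (fun w => xi x w + \sum_(i <- s) xi i w)); last first.
  by apply/funext => w; rewrite big_cons.
apply: measurable_funD; last first.
  by apply: IH => y ys; apply: ss; rewrite inE ys orbT.
move=> _ A mA; rewrite setTI; apply: sub_sigma_algebra.
by exists x; [apply: ss; rewrite inE eqxx|exact: ad].
Qed.

Lemma indep_partial_sums (s1 s2 : seq I) : uniq (s1 ++ s2) ->
  indep_rv P (fun w => \sum_(i <- s1) xi i w) (fun w => \sum_(i <- s2) xi i w).
Proof.
move=> us A B mA mB; apply: (indep_blocks Fm FI FT indF us).
  by rewrite -[_ @^-1` _]setTI; apply: (@adapted_partial_sum s1 s1).
by rewrite -[_ @^-1` _]setTI; apply: (@adapted_partial_sum s2 s2).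
Qed.

Lemma indep_summand_rest x s : uniq (x :: s) ->
  indep_rv P (xi x) (fun w => \sum_(i <- s) xi i w).
Proof.
move=> us; have := @indep_partial_sums [:: x] s us.
by under [X in indep_rv _ X]eq_fun do rewrite big_seq1.
Qed.

Lemma measurable_contD (f : R -> R) (X : T -> R) a : continuous f ->
  measurable_fun setT X -> measurable_fun setT (fun w => f (X w + a)).
Proof.
move=> cf mX; have mf : measurable_fun setT f by exact: continuous_measurable_fun.
exact: (measurableT_comp mf (measurable_funD mX (measurable_cst a))).
Qed.

Lemma expect_cosD (X Y : T -> R) a : measurable_fun setT X ->
  measurable_fun setT Y -> indep_rv P X Y ->
  expect P (fun w => cos (X w + Y w + a)) =
  expect P (fun w => cos (X w)) * expect P (fun w => cos (Y w + a)) -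
  expect P (fun w => sin (X w)) * expect P (fun w => sin (Y w + a)).
Proof.
move=> mX mY ind.
have mc : measurable_fun setT (fun w => cos (X w)).
  by have := measurable_contD 0 (@continuous_cos R) mX; under eq_fun do rewrite addr0.
have ms : measurable_fun setT (fun w => sin (X w)).
  by have := measurable_contD 0 (@continuous_sin R) mX; under eq_fun do rewrite addr0.
have rb (f : T -> R) : measurable_fun setT f -> (forall w, `|f w| <= 1) -> rint P f.
  exact: rint_bounded.
have ic : rint P (fun w => cos (X w)) by apply: rb => // w; exact: cos_max.
have is_ : rint P (fun w => sin (X w)) by apply: rb => // w; exact: sin_max.
have jc : rint P (fun w => cos (Y w + a)).
  by apply: rb => [|w]; [exact: (measurable_contD _ (@continuous_cos R))|exact: cos_max].
have js : rint P (fun w => sin (Y w + a)).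
  by apply: rb => [|w]; [exact: (measurable_contD _ (@continuous_sin R))|exact: sin_max].
have mcos : measurable_fun [set: R] cos.
  exact: continuous_measurable_fun (@continuous_cos R).
have msin : measurable_fun [set: R] sin.
  exact: continuous_measurable_fun (@continuous_sin R).
have mshift (f : R -> R) : measurable_fun setT f ->
    measurable_fun [set: R] (fun y => f (y + a)).
  move=> mf; apply: (measurableT_comp mf); exact: measurable_funD.
have i1 : indep_rv P (cos \o X) ((fun y => cos (y + a)) \o Y).
  by apply: indep_rv_comp => //; exact: mshift.
have i2 : indep_rv P (sin \o X) ((fun y => sin (y + a)) \o Y).
  by apply: indep_rv_comp => //; exact: mshift.
rewrite -(expectM ic jc i1) -(expectM is_ js i2) -expectB; last 2 first.
- exact: (rintM ic jc i1).
- exact: (rintM is_ js i2).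
by congr (expect P _); apply/funext => w; rewrite -[X w + Y w + a]addrA (cosD (X w)).
Qed.

(** Thanks to the phase [a], cosines alone carry the information of complex
    characteristic functions, and a product of factors bounded by 1 turns the
    errors of the factors into their sum. *)
Lemma expect_cos_sum (v e : I -> R) (s : seq I) (a : R) : uniq s ->
  (forall i, 0 <= v i) ->
  (forall i, i \in s -> `|expect P (fun w => cos (xi i w)) - expR (- (v i / 2))| <= e i) ->
  (forall i, i \in s -> `|expect P (fun w => sin (xi i w))| <= e i) ->
  `|expect P (fun w => cos (\sum_(i <- s) xi i w + a))
     - cos a * expR (- ((\sum_(i <- s) v i) / 2))| <= 2 * \sum_(i <- s) e i.
Proof.
move=> us v0 hc hs; elim: s us hc hs => [_ _ _|x s IH us hc hs].
  under [X in expect _ X]eq_fun do rewrite big_nil add0r.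
  by rewrite !big_nil expect_cst mul0r oppr0 expR0 mulr1 subrr normr0 mulr0.
under [X in expect _ X]eq_fun do rewrite big_cons.
rewrite expect_cosD; last 3 first.
- exact: measurable_summand.
- exact: measurable_partial_sum.
- exact: indep_summand_rest.
rewrite !big_cons mulrDl opprD expRD mulrDr.
have us' : uniq s by case/andP: us.
have {}IH := IH us' (fun i si => hc i (@mem_behead _ (x :: s) i si))
  (fun i si => hs i (@mem_behead _ (x :: s) i si)).
have {}hc := hc x (mem_head x s); have {}hs := hs x (mem_head x s).
set Ec := expect P (fun w => cos (xi x w)) in hc *.
set Es := expect P (fun w => sin (xi x w)) in hs *.
set C := expect P (fun w => cos (\sum_(i <- s) xi i w + a)) in IH *.
set D := expect P (fun w => sin (\sum_(i <- s) xi i w + a)).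
have C1 : `|C| <= 1.
  by apply: norm_expect_le => [|w]; [apply: (measurable_contD _ (@continuous_cos R)); exact: measurable_partial_sum|exact: cos_max].
have D1 : `|D| <= 1.
  by apply: norm_expect_le => [|w]; [apply: (measurable_contD _ (@continuous_sin R)); exact: measurable_partial_sum|exact: sin_max].
set g := expR (- (v x / 2)) in hc *.
set G := expR (- _) in IH *.
have g1 : `|g| <= 1.
  by rewrite ger0_norm ?expR_ge0// -expR0 ler_expR oppr_le0 divr_ge0.
have -> : Ec * C - Es * D - cos a * (g * G) =
  (Ec - g) * C + g * (C - cos a * G) - Es * D by ring.
have h1 : `|(Ec - g) * C| <= e x by rewrite normrM -[leRHS]mulr1 ler_pM.
have h2 : `|g * (C - cos a * G)| <= 2 * \sum_(i <- s) e i.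
  by rewrite normrM -[leRHS]mul1r ler_pM.
have h3 : `|Es * D| <= e x by rewrite normrM -[leRHS]mulr1 ler_pM.
apply: (le_trans (ler_normB _ _)).
have := ler_normD ((Ec - g) * C) (g * (C - cos a * G)).
lra.
Qed.

Lemma expect_sum_sqr (s : seq I) : uniq s ->
  (forall i, rint P (xi i)) -> (forall i, rint P (fun w => xi i w ^+ 2)) ->
  (forall i, expect P (xi i) = 0) ->
  [/\ rint P (fun w => \sum_(i <- s) xi i w),
      rint P (fun w => (\sum_(i <- s) xi i w) ^+ 2) &
      expect P (fun w => (\sum_(i <- s) xi i w) ^+ 2) =
      \sum_(i <- s) expect P (fun w => xi i w ^+ 2)].
Proof.
move=> us i1 i2 z; elim: s us => [|x s IH] us.
  have e0 : (fun w => \sum_(i <- [::]) xi i w) = (fun=> 0).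
    by apply/funext => w; rewrite big_nil.
  under [X in rint P X]eq_fun do rewrite big_nil.
  have e1 : (fun w => (\sum_(i <- [::]) xi i w) ^+ 2) = (fun=> 0).
    by apply/funext => w; rewrite big_nil expr0n.
  by rewrite e1 big_nil expect_cst; split => //; exact: rint_cst.
have us' : uniq s by case/andP: us.
have [j1 j2 js] := IH us'.
have ind := indep_summand_rest us.
have e0 : (fun w => \sum_(i <- x :: s) xi i w) =
    (fun w => xi x w + \sum_(i <- s) xi i w).
  by apply/funext => w; rewrite big_cons.
have e1 : (fun w => (\sum_(i <- x :: s) xi i w) ^+ 2) =
    (fun w => (xi x w ^+ 2 + (\sum_(i <- s) xi i w) ^+ 2)
              + 2 * (xi x w * (\sum_(i <- s) xi i w))).
  by apply/funext => w; rewrite big_cons; ring.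
have iM := rintM (i1 x) j1 ind.
have iD := rintD (i2 x) j2.
rewrite e0 e1 big_cons; split.
- exact: rintD.
- by apply: rintD => //; exact: rintZ.
rewrite expectD ?expectZ ?expectD//; last exact: rintZ.
by rewrite (expectM (i1 x) j1 ind) z mul0r mulr0 addr0 js.
Qed.

End independent_sums.

(** * Maximal inequalities *)

Section maximal_inequalities.
Context d (T : measurableType d) (R : realType) (P : probability T R).
Variables (F : nat -> set (set T)) (xi : nat -> T -> R).
Hypothesis Fm : forall i, F i `<=` measurable.
Hypothesis FI : forall i, setI_closed (F i).
Hypothesis FT : forall i, F i setT.
Hypothesis indF : independent_systems P F.
Hypothesis ad : forall i (A : set R), measurable A -> F i (xi i @^-1` A).

Local Notation S m n := (fun w => \sum_(m <= i < n) xi i w).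

Let mS m n : measurable_fun setT (S m n).
Proof. by have := measurable_partial_sum Fm ad (index_iota m n). Qed.

Lemma measurable_norm_ge d' (T' : measurableType d') (X : T' -> R) (c : R) :
  measurable_fun setT X -> measurable [set w | c <= `|X w|].
Proof.
move=> mX; rewrite -[X in measurable X]setTI.
have mn : measurable_fun setT (fun w => `|X w|) by exact: measurableT_comp.
rewrite [X in _ `&` X](_ : _ = (fun w => `|X w|) @^-1` `[c, +oo[).
  exact: mn.
by apply/seteqP; split => w /=; rewrite in_itv/= andbT.
Qed.

Let mE m n c : measurable [set w | c <= `|S m n w|].
Proof. exact: measurable_norm_ge. Qed.

Lemma uniq_index_iota_cat k N : (k <= N)%N ->
  uniq (index_iota 0 k ++ index_iota k N).
Proof.
move=> kN; rewrite /index_iota subn0 -{2}(add0n k) -iotaD iota_uniq//.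
Qed.

Lemma mem_bigsetU (U : Type) n (E : nat -> set U) w :
  (\big[setU/set0]_(k < n) E k) w <-> exists2 k, (k < n)%N & E k w.
Proof. by rewrite -(bigcup_mkord n E); split => -[k kn Ek]; exists k. Qed.

(** Split at the first exceedance of [2 * c]: what remains of the sum is
    independent of the past and stays below [c] with probability at least 1 / 2, in
    which case the whole sum still exceeds [c]. *)
Lemma ottaviani (c : R) N : 0 < c ->
  (forall k, (k <= N)%N -> pr P [set w | c <= `|S k N w|] <= 1 / 2) ->
  pr P (\big[setU/set0]_(k < N.+1) [set w | 2 * c <= `|S 0 k w|]) <=
  2 * pr P [set w | c <= `|S 0 N w|].
Proof.
move=> c0 H; pose E k := [set w | 2 * c <= `|S 0 k w|].
rewrite (bigsetU_seqDU E N.+1).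
have mEk k : measurable (E k) by exact: mE.
have mA k : measurable (seqDU E k).
  by apply: measurableD => //; apply: bigsetU_measurable.
rewrite pr_trivIset//.
pose D k := [set w | c <= `|S k N w|].
have AD k : (k <= N)%N -> pr P (seqDU E k) <= 2 * pr P (seqDU E k `&` ~` D k).
  move=> kN; have mDC : measurable (~` D k) by apply: measurableC; exact: mE.
  have ind : P (seqDU E k `&` ~` D k) = (P (seqDU E k) * P (~` D k))%E.
    apply: (indep_blocks Fm FI FT indF (uniq_index_iota_cat kN)).
    - pose G := g_sigma_algebraType (block F (index_iota 0 k)).
      have mG j : (j <= k)%N -> measurable (E j : set G).
        move=> jk; apply: (@measurable_norm_ge _ G (S 0 j)).
        apply: (adapted_partial_sum ad) => i.
        by rewrite !mem_index_iota => /andP[-> /leq_trans]; apply.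
      have : measurable (seqDU E k : set G).
        apply: measurableD; first exact: mG.
        by apply: bigsetU_measurable => i _; apply: mG; exact: ltnW.
      by [].
    - pose G := g_sigma_algebraType (block F (index_iota k N)).
      have : measurable (~` D k : set G).
        apply: measurableC; apply: (@measurable_norm_ge _ G (S k N)).
        exact: (adapted_partial_sum ad).
      by [].
  have -> : pr P (seqDU E k `&` ~` D k) = pr P (seqDU E k) * (1 - pr P (D k)).
    rewrite -(prC P (mE _ _ _)); apply: EFin_inj; rewrite EFinM -!prE//.
    exact: measurableI.
  have := H k kN; rewrite -/(D k); have := pr_ge0 P (seqDU E k); nra.
apply: (@le_trans _ _ (\sum_(k < N.+1) 2 * pr P (seqDU E k `&` ~` D k))).
  by apply: ler_sum => k _; apply: AD; rewrite -ltnS.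
rewrite -mulr_sumr ler_wpM2l//.
rewrite -(@pr_trivIset _ _ _ P N.+1 (fun k => seqDU E k `&` ~` D k)); last 2 first.
- by move=> k; apply: measurableI => //; apply: measurableC; exact: mE.
- by apply: trivIset_setIr; exact: trivIset_seqDU.
apply: le_pr => //.
  apply: bigsetU_measurable => k _; apply: measurableI => //.
  by apply: measurableC; exact: mE.
move=> w /(@mem_bigsetU _ _ (fun k => seqDU E k `&` ~` D k))[k kN [[Ek _] nDk]].
have {}Ek : 2 * c <= `|S 0 k w| by [].
have {}nDk : `|S k N w| < c by rewrite ltNge; apply/negP.
rewrite /= (@big_cat_nat _ _ _ k)//=.
have := lerB_normD (\sum_(0 <= i < k) xi i w) (\sum_(k <= i < N) xi i w).
move: Ek nDk => /=; lra.
Qed.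

Lemma chebyshev_pr (X : T -> R) (c : R) : measurable_fun setT X ->
  rint P (fun w => X w ^+ 2) -> 0 < c ->
  pr P [set w | c <= `|X w|] <= expect P (fun w => X w ^+ 2) / c ^+ 2.
Proof.
move=> mX iX c0; apply: markov_pr => //.
- exact: measurable_norm_ge.
- by move=> w; exact: sqr_ge0.
- by rewrite exprn_gt0.
- move=> w /= cX; rewrite -(real_normK (num_real (X w))).
  by rewrite lerXn2r// nnegrE ltW.
Qed.

Section second_moments.
Variable s2 : R.
Hypothesis i1 : forall i, rint P (xi i).
Hypothesis i2 : forall i, rint P (fun w => xi i w ^+ 2).
Hypothesis z : forall i, expect P (xi i) = 0.
Hypothesis s2P : forall i, expect P (fun w => xi i w ^+ 2) <= s2.

Lemma s2_ge0 : 0 <= s2.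
Proof.
by apply: le_trans (s2P 0%N); apply: expect_ge0 => w; exact: sqr_ge0.
Qed.

Lemma pr_partial_sum_ge (c : R) m n : 0 < c ->
  pr P [set w | c <= `|S m n w|] <= (n - m)%:R * s2 / c ^+ 2.
Proof.
move=> c0.
have [_ j2 js] := expect_sum_sqr Fm FI FT indF ad (iota_uniq m (n - m)) i1 i2 z.
apply: (le_trans (chebyshev_pr (mS m n) j2 c0)).
rewrite ler_wpM2r ?invr_ge0 ?exprn_ge0 ?(ltW c0)//.
rewrite [leLHS]js (le_trans (ler_sum _ (fun i _ => s2P i)))//.
by rewrite big_const_seq count_predT size_iota iter_addr addr0 mulr_natl.
Qed.

(** When Chebyshev's bound is too weak for [ottaviani] to apply, the right-hand
    side exceeds 1. *)
Lemma pr_max_ge (c : R) N : 0 < c ->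
  pr P (\big[setU/set0]_(k < N.+1) [set w | c <= `|S 0 k w|]) <=
  8 * (N%:R * s2 / c ^+ 2).
Proof.
move=> c0; have c20 : 0 < c / 2 by rewrite divr_gt0.
have e : N%:R * s2 / (c / 2) ^+ 2 = 4 * (N%:R * s2 / c ^+ 2).
  by field; rewrite gt_eqF.
have s0 := s2_ge0.
have [le12|gt12] := leP (N%:R * s2 / (c / 2) ^+ 2) (1 / 2); last first.
  apply: (le_trans (pr_le1 _ _)); first exact: bigsetU_measurable.
  by move: gt12; rewrite e; lra.
have {1}-> : c = 2 * (c / 2) by rewrite mulrC divfK.
apply: (le_trans (ottaviani c20 _)).
  move=> k kN; apply: (le_trans (pr_partial_sum_ge _ _ c20)).
  apply: le_trans le12; rewrite ler_wpM2r ?invr_ge0 ?exprn_ge0 ?(ltW c20)//.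
  by rewrite ler_wpM2r// ler_nat leq_subr.
have := pr_partial_sum_ge 0 N c20; rewrite subn0 e => h.
apply: (le_trans (ler_wpM2l _ h)) => //; lra.
Qed.

(** On the dyadic block from [m * 2 ^ k] to [m * 2 ^ k.+1] the maximal inequality
    gives a bound proportional to [2 ^ (- k)], and these bounds are summable. *)
Lemma pr_tail_averages (a : R) m : 0 < a -> (0 < m)%N ->
  pr P [set w | exists2 n, (m <= n)%N & a * n%:R <= `|S 0 n w|] <=
  32 * s2 / (a ^+ 2 * m%:R).
Proof.
move=> a0 m0.
pose G k := \big[setU/set0]_(n < (m * 2 ^ k.+1).+1)
  [set w | a * (m * 2 ^ k)%:R <= `|S 0 n w|].
pose H K := \big[setU/set0]_(k < K) G k.
have mG k : measurable (G k) by exact: bigsetU_measurable.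
have mH K : measurable (H K) by exact: bigsetU_measurable.
have mR : 0 < m%:R :> R by rewrite ltr0n.
have sub : [set w | exists2 n, (m <= n)%N & a * n%:R <= `|S 0 n w|]
    `<=` \bigcup_K H K.
  move=> w [n mn an]; pose k := trunc_log 2 (n %/ m).
  have nm0 : (0 < n %/ m)%N by rewrite divn_gt0.
  have /andP[k1 k2] := trunc_log_bounds (isT : (1 < 2)%N) nm0.
  rewrite -/k in k1 k2.
  exists k.+1 => //; apply/mem_bigsetU; exists k => //.
  apply/(@mem_bigsetU _ _ (fun n => [set w | a * (m * 2 ^ k)%:R <= `|S 0 n w|])).
  exists n => /=.
    by move: k2; rewrite ltn_divLR// mulnC ltnS => /ltnW.
  apply: le_trans an; rewrite ler_wpM2l ?(ltW a0)// ler_nat.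
  by move: k1; rewrite leq_divRL// mulnC.
have mU : measurable [set w | exists2 n, (m <= n)%N & a * n%:R <= `|S 0 n w|].
  rewrite [X in measurable X](_ : _ =
    \bigcup_(n in [set n | (m <= n)%N]) [set w | a * n%:R <= `|S 0 n w|]).
    by apply: bigcup_measurable => n _.
  by apply/seteqP; split => w /= [n mn an]; exists n.
apply: (le_trans (le_pr P mU (bigcupT_measurable H mH) sub)).
apply: pr_bigcup_le => //.
  by move=> i j ij; rewrite subsetEset; exact: subset_bigsetU.
move=> K; apply: (le_trans (pr_bigsetU P (fun i _ => mG i))).
have s0 := s2_ge0.
have Gk k : pr P (G k) <= 16 * s2 / (a ^+ 2 * m%:R) * (1 / 2) ^+ k.
  have c0 : 0 < a * (m * 2 ^ k)%:R by rewrite mulr_gt0// ltr0n muln_gt0 m0 expn_gt0.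
  apply: (le_trans (pr_max_ge _ c0)).
  rewrite !natrM !natrX exprS div1r exprVn le_eqVlt; apply/orP; left; apply/eqP.
  have t0 : (2 : R) ^+ k != 0 by rewrite expf_neq0// pnatr_eq0.
  by field; rewrite t0 !gt_eqF.
apply: (le_trans (ler_sum _ (fun (i : 'I_K) _ => Gk i))).
rewrite -mulr_sumr.
have C0 : 0 <= 16 * s2 / (a ^+ 2 * m%:R).
  by rewrite divr_ge0// mulr_ge0// ?sqr_ge0// ltW.
have geo : \sum_(i < K) (1 / 2 : R) ^+ i <= 2.
  suff -> : \sum_(i < K) (1 / 2 : R) ^+ i = 2 - 2 * (1 / 2) ^+ K.
    by rewrite lerBlDr lerDl mulr_ge0// exprn_ge0// divr_ge0.
  elim: K => [|K IH]; first by rewrite big_ord0 expr0 mulr1 subrr.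
  by rewrite big_ord_recr/= IH exprS; field.
have -> : 32 * s2 / (a ^+ 2 * m%:R) = 16 * s2 / (a ^+ 2 * m%:R) * 2.
  by field; rewrite !gt_eqF.
by rewrite ler_wpM2l.
Qed.

End second_moments.
End maximal_inequalities.

(** * Trigonometric moments of normal laws *)

Section hyperbolic.
Context {R : realType}.
Implicit Types y z v : R.

(** The moments of a normal law are explicit for exponentials only. Cosine and
    sine are therefore compared with [1 - (cosh - 1)] and [sinh]; the errors are
    bounded by powers of [cosh - 1], the expectations of which are explicit again. *)
Definition coshB1 y : R := (expR y + expR (- y)) / 2 - 1.

Definition sinh_ y : R := (expR y - expR (- y)) / 2.

Lemma expRD_expRN_ge2 y : 2 <= expR y + expR (- y).
Proof.
have h : expR y * expR (- y) = 1 by rewrite -expRD subrr expR0.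
have := sqr_ge0 (expR y - expR (- y)); have := expR_gt0 y; have := expR_gt0 (- y).
nra.
Qed.

Lemma coshB1_ge0 y : 0 <= coshB1 y.
Proof. by have := expRD_expRN_ge2 y; rewrite /coshB1; lra. Qed.

Lemma coshB1_le z c : 0 <= c -> c <= z -> coshB1 c <= coshB1 z.
Proof.
move=> c0 cz; rewrite /coshB1.
have h1 : expR z * expR (- z) = 1 by rewrite -expRD subrr expR0.
have h2 : expR c * expR (- c) = 1 by rewrite -expRD subrr expR0.
have h3 : expR c <= expR z by rewrite ler_expR.
have h4 : 1 <= expR c by rewrite -expR0 ler_expR.
have h5 := expR_gt0 (- z); have h6 := expR_gt0 (- c).
have h7 : expR (- c) <= 1 by rewrite -expR0 ler_expR oppr_le0.
have h8 : expR (- z) <= 1 by rewrite -expR0 ler_expR oppr_le0 (le_trans c0).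
have : expR (- c) - expR (- z) = (expR z - expR c) * (expR (- c) * expR (- z)).
  by rewrite !expRN; field; rewrite !gt_eqF ?expR_gt0.
have : expR (- c) * expR (- z) <= 1 by rewrite mulr_ile1// ltW.
nra.
Qed.

Lemma sinh_MVT y : 0 <= y -> exists2 c, 0 <= c <= y &
  sinh_ y = (coshB1 c + 1) * y.
Proof.
move=> y0.
have der z : is_derive z 1 (@sinh_ : R -> R) (coshB1 z + 1).
  rewrite /sinh_ /coshB1; apply: is_derive_eq.
  by rewrite /GRing.scale/=; field.
have cs : continuous (@sinh_ : R -> R).
  move=> z; apply: differentiable_continuous; apply/derivable1_diffP.
  by have [] := der z.
have [c] := @MVT_segment R (@sinh_) (fun z => coshB1 z + 1) 0 y y0
  (fun z _ => der z) (continuous_subspaceT cs).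
rewrite in_itv/= => c01; rewrite /sinh_ oppr0 subrr mul0r !subr0 => e.
by exists c => //; rewrite e addr0.
Qed.

Lemma coshB1N y : coshB1 (- y) = coshB1 y.
Proof. by rewrite /coshB1 opprK addrC [in RHS]addrC [expR _ + _]addrC. Qed.

Lemma sinhN y : sinh_ (- y) = - sinh_ y.
Proof. by rewrite /sinh_ opprK -mulNr opprB. Qed.

Lemma coshB1_half y : coshB1 y = 2 * sinh_ (y / 2) ^+ 2.
Proof.
rewrite /coshB1 /sinh_.
have -> : expR y = expR (y / 2) ^+ 2 by rewrite -expRM_natl; congr expR; field.
have -> : expR (- y) = expR (- (y / 2)) ^+ 2 by rewrite -expRM_natl; congr expR; field.
by rewrite expRN; field; rewrite gt_eqF ?expR_gt0.
Qed.

Lemma sinh_bounds y : 0 <= y -> y <= sinh_ y /\ sinh_ y <= (coshB1 y + 1) * y.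
Proof.
move=> y0; have [c /andP[c0 cy] ->] := sinh_MVT y0.
have := coshB1_ge0 c; have := coshB1_le c0 cy; split; nra.
Qed.

Lemma coshB1_taylor y : y ^+ 2 <= 2 * coshB1 y /\
  `|coshB1 y - y ^+ 2 / 2| <= coshB1 y ^+ 2.
Proof.
wlog y0 : y / 0 <= y.
  move=> H; have [/H//|y0] := leP 0 y.
  by have := H (- y); rewrite coshB1N sqrrN; apply; rewrite oppr_ge0 ltW.
have z0 : 0 <= y / 2 by rewrite divr_ge0.
have [s1 s2] := sinh_bounds z0.
have -> : y = 2 * (y / 2) by field.
move: s1 s2 z0; set z := y / 2 => s1 s2 z0; rewrite -/z.
have e : 2 * z / 2 = z by field.
have := coshB1_half (2 * z); rewrite e => ->.
set sh := sinh_ z in s1 s2 *.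
have ch2 : (coshB1 z + 1) ^+ 2 = 1 + sh ^+ 2.
  rewrite /sh /coshB1 /sinh_ expRN; field; by rewrite gt_eqF ?expR_gt0.
have sq1 : z ^+ 2 <= sh ^+ 2 by rewrite lerXn2r// nnegrE; lra.
have sq2 : sh ^+ 2 <= (1 + sh ^+ 2) * z ^+ 2.
  by rewrite -ch2 -exprMn lerXn2r// nnegrE; lra.
have e1 : (2 * z) ^+ 2 = 4 * z ^+ 2 by ring.
have e2 : (2 * sh ^+ 2) ^+ 2 = 4 * (sh ^+ 2 * sh ^+ 2) by ring.
have sq3 : sh ^+ 2 * z ^+ 2 <= sh ^+ 2 * sh ^+ 2 by rewrite ler_wpM2l ?sqr_ge0.
have sq4 : 0 <= sh ^+ 2 * sh ^+ 2 by rewrite mulr_ge0 ?sqr_ge0.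
have sq5 : sh ^+ 2 <= z ^+ 2 + sh ^+ 2 * z ^+ 2 by move: sq2; rewrite mulrDl mul1r.
rewrite e1 e2; split; first lra.
by rewrite ger0_norm; lra.
Qed.

Lemma cos_cosh_error y : `|cos y - (1 - coshB1 y)| <= 5 * coshB1 y ^+ 2.
Proof.
have [h1 h2] := coshB1_taylor y.
have h3 := norm_cos_taylor4 y.
have h4 : `|y| ^+ 4 <= 4 * coshB1 y ^+ 2.
  have -> : `|y| ^+ 4 = (y ^+ 2) ^+ 2.
    by rewrite -exprM -normrX ger0_norm// (exprM y 2 2) sqr_ge0.
  have -> : 4 * coshB1 y ^+ 2 = (2 * coshB1 y) ^+ 2 by rewrite exprMn; ring.
  by rewrite lerXn2r// nnegrE ?sqr_ge0// mulr_ge0// coshB1_ge0.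
have -> : cos y - (1 - coshB1 y) =
  (cos y - (1 - y ^+ 2 / 2)) + (coshB1 y - y ^+ 2 / 2) by ring.
apply: (le_trans (ler_normD _ _)); lra.
Qed.

(** The free parameter [dl] splits the third-order error [`|y| * coshB1 y] by the
    inequality between arithmetic and geometric means. *)
Lemma sin_sinh_error y (dl : R) : 0 < dl ->
  `|sin y - sinh_ y| <= 3 * (dl * coshB1 y + coshB1 y ^+ 2 / dl).
Proof.
move=> d0.
have c0 := coshB1_ge0 y.
have [h1 _] := coshB1_taylor y.
have hs : `|sinh_ y - y| <= `|y| * coshB1 y.
  have [y0|y0] := leP 0 y.
    have [] := sinh_bounds y0; move=> s1 s2.
    rewrite ger0_norm ?subr_ge0// ger0_norm//; nra.
  have ny : 0 <= - y by rewrite oppr_ge0 ltW.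
  have [] := sinh_bounds ny; rewrite sinhN coshB1N => s1 s2.
  rewrite ler0_norm; last by lra.
  rewrite ler0_norm; last by lra.
  nra.
have h3 := norm_sinB y.
have h4 : `|y| ^+ 3 <= 2 * (`|y| * coshB1 y).
  by rewrite exprS real_normK ?num_real//; have := ler_wpM2l (normr_ge0 y) h1; lra.
have h5 : `|y| * coshB1 y <= dl * coshB1 y + coshB1 y ^+ 2 / dl.
  have dn : dl != 0 by rewrite gt_eqF.
  have -> : dl * coshB1 y + coshB1 y ^+ 2 / dl =
     ((dl * `|y|) ^+ 2 / dl / 2 + coshB1 y ^+ 2 / dl / 2) +
     (dl * (coshB1 y - y ^+ 2 / 2) + coshB1 y ^+ 2 / dl / 2).
    by rewrite exprMn real_normK ?num_real//; field.
  have a1 : 0 <= dl * (coshB1 y - y ^+ 2 / 2) by rewrite mulr_ge0//; lra.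
  have a2 : 0 <= coshB1 y ^+ 2 / dl / 2 by rewrite !divr_ge0// ?sqr_ge0// ltW.
  have a3 : `|y| * coshB1 y <= (dl * `|y|) ^+ 2 / dl / 2 + coshB1 y ^+ 2 / dl / 2.
    rewrite -subr_ge0.
    have -> : (dl * `|y|) ^+ 2 / dl / 2 + coshB1 y ^+ 2 / dl / 2 - `|y| * coshB1 y
      = (dl * `|y| - coshB1 y) ^+ 2 / dl / 2 by field.
    by rewrite !divr_ge0// ?sqr_ge0// ltW.
  lra.
have -> : sin y - sinh_ y = - (y - sin y) - (sinh_ y - y) by ring.
apply: (le_trans (ler_normB _ _)); rewrite normrN; lra.
Qed.

Lemma expR_le_quad v : 0 <= v -> v <= 1 / 2 -> expR v <= 1 + v + 2 * v ^+ 2.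
Proof.
move=> v0 v1; have h1 := expR_ge1Dx (- v).
have h2 : expR v * expR (- v) = 1 by rewrite -expRD subrr expR0.
have h3 := expR_gt0 v.
have h4 : expR v * (1 - v) <= expR v * expR (- v) by rewrite ler_pM2l.
rewrite h2 in h4.
rewrite -(@ler_pM2r _ (1 - v)); last by lra.
apply: le_trans h4 _; rewrite -subr_ge0.
have -> : (1 + v + 2 * v ^+ 2) * (1 - v) - 1 = v ^+ 2 * (1 - 2 * v) by ring.
by rewrite mulr_ge0 ?sqr_ge0//; lra.
Qed.

End hyperbolic.

Section normal_law.
Context {R : realType}.
Variables (s u : R).
Hypothesis s0 : s != 0.
Local Notation mu := (@lebesgue_measure R).
Local Notation p := (normal_pdf 0 s).

Let v := (u * s) ^+ 2 / 2.

Let nrm (f : R -> R) := \int[mu]_x (f x * p x).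
Let nint (f : R -> R) := mu.-integrable setT (EFin \o (fun x => f x * p x)).

(** By completing the square. *)
Lemma exp_tilt_normal_pdf k x :
  expR (k * x) * p x = expR (k ^+ 2 * s ^+ 2 / 2) * normal_pdf (k * s ^+ 2) s x.
Proof.
rewrite !normal_pdfE// mulrCA [RHS]mulrCA; congr (_ * _).
rewrite /normal_fun -!expRD; congr expR; field.
by rewrite s0.
Qed.

Let exp_int k : nint (fun x => expR (k * x)) /\
  nrm (fun x => expR (k * x)) = expR (k ^+ 2 * s ^+ 2 / 2).
Proof.
have e : (fun x => expR (k * x) * p x) =
  (fun x => expR (k ^+ 2 * s ^+ 2 / 2) * normal_pdf (k * s ^+ 2) s x).
  by apply/funext => x; exact: exp_tilt_normal_pdf.
rewrite /nint /nrm e; have ip := integrable_normal_pdf (k * s ^+ 2) s.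
split; first exact: (integrableZl _ _ ip).
by rewrite RintegralZl// /Rintegral integral_normal_pdf/= mulr1.
Qed.

Let nint_bounded (f : R -> R) c : measurable_fun setT f ->
  (forall x, `|f x| <= c) -> nint f.
Proof.
move=> mf fc; have ip := integrable_normal_pdf 0 s.
apply: (le_integrable _ _ _ (integrableZl _ c ip)) => //.
  by apply/measurable_EFinP; apply: measurable_funM => //; exact: measurable_normal_pdf.
move=> x _ /=; rewrite lee_fin !normrM ler_wpM2r//.
by rewrite (le_trans (fc x))// ler_norm.
Qed.

Let nintD f g : nint f -> nint g -> nint (fun x => f x + g x) /\
  nrm (fun x => f x + g x) = nrm f + nrm g.
Proof.
move=> hf hg.
have e : (fun x => (f x + g x) * p x) = (fun x => f x * p x + g x * p x).
  by apply/funext => x; rewrite mulrDl.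
rewrite /nint /nrm e; split; first exact: (integrableD _ hf hg).
exact: RintegralD.
Qed.

Let nintZ c f : nint f -> nint (fun x => c * f x) /\
  nrm (fun x => c * f x) = c * nrm f.
Proof.
move=> hf.
have e : (fun x => c * f x * p x) = (fun x => c * (f x * p x)).
  by apply/funext => x; rewrite mulrA.
rewrite /nint /nrm e; split; first exact: (integrableZl _ _ hf).
exact: RintegralZl.
Qed.

Let nint1 : nint (fun=> 1) /\ nrm (fun=> 1) = 1.
Proof.
have [h1 h2] := exp_int 0.
have e : (fun x => expR (0 * x)) = (fun=> 1 : R).
  by apply/funext => x; rewrite mul0r expR0.
by move: h1 h2; rewrite e expr0n/= !mul0r expR0.
Qed.

Let norm_nrm_le f g : nint f -> nint g -> (forall x, `|f x| <= g x) ->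
  `|nrm f| <= nrm g.
Proof.
move=> hf hg fg; apply: (le_trans (le_normr_Rintegral _ hf)) => //.
apply: le_Rintegral => //; first exact: (integrable_norm hf).
by move=> x _; rewrite normrM [X in _ * X]ger0_norm ?normal_pdf_ge0// ler_wpM2r// normal_pdf_ge0.
Qed.

Let e1 k : nint (fun x => expR (k * x)) := (exp_int k).1.

Let cosh_lin : nint (fun x => coshB1 (u * x)) /\
  nrm (fun x => coshB1 (u * x)) = expR v - 1.
Proof.
have e : (fun x => coshB1 (u * x)) =
    (fun x => 2^-1 * (expR (u * x) + expR (- u * x)) + (-1) * 1).
  by apply/funext => x; rewrite /coshB1 !mulNr; field.
have [i1 j1] := nintD (e1 u) (e1 (- u)).
have [i2 j2] := nintZ 2^-1 i1.
have [i3 j3] := nintZ (-1) nint1.1.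
have [i4 j4] := nintD i2 i3.
rewrite e; split=> //; rewrite j4 j2 j3 j1 !(exp_int _).2 nint1.2 sqrrN /v exprMn.
by field.
Qed.

Let cosh_sqr : nint (fun x => coshB1 (u * x) ^+ 2) /\
  nrm (fun x => coshB1 (u * x) ^+ 2) = expR (4 * v) / 2 + 3 / 2 - 2 * expR v.
Proof.
have e : (fun x => coshB1 (u * x) ^+ 2) =
    (fun x => (4^-1 * (expR ((2 * u) * x) + expR (- (2 * u) * x)) +
               (-1) * (expR (u * x) + expR (- u * x))) + 3 / 2 * 1).
  apply/funext => x; rewrite /coshB1 !mulNr.
  have -> : 2 * u * x = u * x + u * x by ring.
  rewrite opprD !expRD !expRN; field; by rewrite gt_eqF ?expR_gt0.
have [i1 j1] := nintD (e1 u) (e1 (- u)).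
have [i2 j2] := nintZ (-1) i1.
have [i3 j3] := nintD (e1 (2 * u)) (e1 (- (2 * u))).
have [i4 j4] := nintZ 4^-1 i3.
have [i5 j5] := nintZ (3 / 2) nint1.1.
have [i6 j6] := nintD i4 i2.
have [i7 j7] := nintD i6 i5.
rewrite e; split=> //; rewrite j7 j6 j5 j4 j3 j2 j1 !(exp_int _).2 nint1.2 !sqrrN.
have -> : (2 * u) ^+ 2 * s ^+ 2 / 2 = 4 * v by rewrite /v; field.
have -> : u ^+ 2 * s ^+ 2 / 2 = v by rewrite /v; field.
by field.
Qed.

Let sinh_int : nint (fun x => sinh_ (u * x)) /\
  nrm (fun x => sinh_ (u * x)) = 0.
Proof.
have e : (fun x => sinh_ (u * x)) =
    (fun x => 2^-1 * (expR (u * x) + (-1) * expR (- u * x))).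
  by apply/funext => x; rewrite /sinh_ !mulNr; field.
have [i0 j0] := nintZ (-1) (e1 (- u)).
have [i1 j1] := nintD (e1 u) i0.
have [i2 j2] := nintZ 2^-1 i1.
by rewrite e; split=> //; rewrite j2 j1 j0 !(exp_int _).2 sqrrN mulN1r subrr mulr0.
Qed.

Hypothesis v8 : v <= 1 / 8.

Let v0 : 0 <= v. Proof. by rewrite /v divr_ge0// sqr_ge0. Qed.

Let cosh_sqr_le : nrm (fun x => coshB1 (u * x) ^+ 2) <= 16 * v ^+ 2.
Proof.
rewrite cosh_sqr.2.
have h1 := expR_ge1Dx v.
have h2 : expR (4 * v) <= 1 + 4 * v + 2 * (4 * v) ^+ 2.
  by apply: expR_le_quad; have := v0; have := v8; lra.
rewrite exprMn in h2; lra.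
Qed.

Lemma normal_cos : `|\int[mu]_x (cos (u * x) * p x) - expR (- v)| <= 100 * v ^+ 2.
Proof.
have mc : measurable_fun setT (fun x => cos (u * x)).
  apply: (measurableT_comp (f := cos)); last exact: measurable_funM.
  exact: continuous_measurable_fun (@continuous_cos R).
have ic : nint (fun x => cos (u * x)) by apply: (nint_bounded mc) => x; exact: cos_max.
have [i1 j1] := nintZ (-1) ic.
have [i2 j2] := nintZ (-1) cosh_lin.1.
have [i3 j3] := nintD nint1.1 i2.
have [i4 j4] := nintZ (-1) i3.
have [i5 j5] := nintD ic i4.
have [i6 j6] := nintZ 5 cosh_sqr.1.
have h : `|nrm (fun x => cos (u * x)) - (1 - (expR v - 1))| <= 5 * (16 * v ^+ 2).
  have := norm_nrm_le i5 i6.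
  rewrite j6 j5 j4 j3 j2 cosh_lin.2 nint1.2 mulN1r mulN1r.
  move=> h; apply: (le_trans (h _)); last by rewrite ler_wpM2l// cosh_sqr_le.
  by move=> x; rewrite !mulN1r; exact: cos_cosh_error.
have h1 := expR_ge1Dx v.
have h2 : expR v <= 1 + v + 2 * v ^+ 2 by apply: expR_le_quad; have := v0; have := v8; lra.
have := expRN_error v0; rewrite -/(nrm _).
move: h; rewrite !ler_norml => /andP[h3 h4] /andP[h5 h6].
apply/andP; split; lra.
Qed.

Lemma normal_sin (dl : R) : 0 < dl ->
  `|\int[mu]_x (sin (u * x) * p x)| <= 3 * (dl * (2 * v) + 16 * v ^+ 2 / dl).
Proof.
move=> d0.
have mc : measurable_fun setT (fun x => sin (u * x)).
  apply: (measurableT_comp (f := sin)); last exact: measurable_funM.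
  exact: continuous_measurable_fun (@continuous_sin R).
have ic : nint (fun x => sin (u * x)) by apply: (nint_bounded mc) => x; exact: sin_max.
have [i1 j1] := nintZ (-1) sinh_int.1.
have [i2 j2] := nintD ic i1.
have [i3 j3] := nintZ dl cosh_lin.1.
have [i4 j4] := nintZ dl^-1 cosh_sqr.1.
have [i5 j5] := nintD i3 i4.
have [i6 j6] := nintZ 3 i5.
have := norm_nrm_le i2 i6; rewrite j6 j5 j4 j3 j2 j1 sinh_int.2 mulr0 addr0.
move=> h; apply: (le_trans (h _)).
  by move=> x; rewrite mulN1r [_^-1 * _]mulrC; exact: sin_sinh_error.
rewrite ler_wpM2l// lerD//; last first.
  by rewrite mulrC ler_wpM2r ?cosh_sqr_le// invr_ge0 ltW.
rewrite ler_wpM2l ?(ltW d0)// cosh_lin.2.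
have h2 : expR v <= 1 + v + 2 * v ^+ 2 by apply: expR_le_quad; have := v0; have := v8; lra.
have : v ^+ 2 <= 1 / 8 * v by rewrite expr2 ler_wpM2r.
have := v0; lra.
Qed.

End normal_law.

Section normal_variable.
Context d (T : measurableType d) (R : realType) (P : probability T R).
Variables (X : T -> R) (s : R).
Hypothesis mX : measurable_fun setT X.
Hypothesis lX : forall A : set R, measurable A ->
  P (X @^-1` A) = normal_prob 0 s A.
Local Notation mu := (@lebesgue_measure R).

(** [normal_prob] is defined by its density, so that its Radon-Nikodym derivative
    is that density. *)
Lemma expect_normal (f : R -> R) (c : R) : measurable_fun setT f ->
  (forall x, `|f x| <= c) ->
  expect P (fun w => f (X w)) = \int[mu]_x (f x * normal_pdf 0 s x).
Proof.
move=> mf fc.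
have mfX : measurable_fun setT (f \o X) by exact: measurableT_comp.
have iX : rint P (f \o X) by apply: (rint_bounded P (c := c) mfX) => w; exact: fc.
rewrite /expect /Rintegral; congr fine.
have mX' : measurable_fun setT (X : T -> measurableTypeR R) by exact: mX.
transitivity (\int[distribution P (as_mfun mX')]_x (f x)%:E)%E.
  rewrite (integral_distribution (X := (as_mfun mX' : {RV P >-> measurableTypeR R})))//.
  exact/measurable_EFinP.
transitivity (\int[normal_prob 0 s]_x (f x)%:E)%E.
  by apply: eq_measure_integral => A mA _; exact: lX.
have dom := normal_prob_dominates (0 : R) s.
have ifn : (normal_prob 0 s).-integrable setT (EFin \o f).
  apply: measurable_bounded_integrable => //.
    by rewrite (le_lt_trans (probability_le1 _ _)) ?ltry.
  exists c; split; first exact: num_real.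
  by move=> x cx w _ /=; rewrite (le_trans (fc w))// ltW.
rewrite -(Radon_Nikodym_change_of_variables dom)//.
under [RHS]eq_integral do rewrite EFinM.
rewrite Radon_NikodymE//.
case: cid => /= h [h1 h2 h3].
have mpdf : measurable_fun setT (EFin \o normal_pdf 0 s).
  by apply/measurable_EFinP; exact: measurable_normal_pdf.
have hae : ae_eq mu setT h (EFin \o normal_pdf 0 s).
  by apply: integral_ae_eq => //= E _ mE; rewrite -h3.
apply: ae_eq_integral => //.
- apply: emeasurable_funM; first exact/measurable_EFinP.
  exact: (measurable_int mu h2).
- by apply: emeasurable_funM => //; exact/measurable_EFinP.
- by apply: filterS hae => x /= hx /hx ->.
Qed.

End normal_variable.

(** * Characteristic functions of Brownian increments *)

Section preimage_systems.
Context d d' (T : measurableType d) (T' : measurableType d') (X : T -> T').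
Local Notation G := (preimage_set_system [set: T] X measurable).

Lemma preimage_system_measurable : measurable_fun setT X -> G `<=` measurable.
Proof. by move=> mX _ [B mB <-]; exact: mX. Qed.

Lemma preimage_system_setI : setI_closed G.
Proof.
move=> _ _ [A mA <-] [B mB <-]; exists (A `&` B); first exact: measurableI.
by rewrite !setTI preimage_setI.
Qed.

Lemma preimage_systemT : G setT.
Proof. by exists setT => //; rewrite setTI. Qed.

Lemma preimage_system_comp d2 (T2 : measurableType d2) (f : T' -> T2)
    (A : set T2) :
  measurable_fun setT f -> measurable A -> G ((f \o X) @^-1` A).
Proof.
by move=> mf mA; exists (f @^-1` A); rewrite ?setTI// -[_ @^-1` _]setTI; exact: mf.
Qed.

End preimage_systems.

Lemma eq_of_le_inv_nat {R : realType} (x y C : R) (k0 : nat) :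
  (forall k : nat, (k0 <= k)%N -> (0 < k)%N -> `|x - y| <= C / k%:R) -> x = y.
Proof.
move=> H; apply/eqP; rewrite -subr_eq0 -normr_le0; apply/ler_addgt0Pr => e e0.
rewrite add0r.
have [m mP] : exists m : nat, C / e < m%:R.
  by exists (Num.truncn (C / e)).+1; exact: truncnS_gt.
pose k := (maxn k0 m).+1.
apply: (le_trans (H k _ _)) => //; first by rewrite (leq_trans (leq_maxl _ _) (leqnSn _)).
rewrite ler_pdivrMr ?ltr0n// -ler_pdivrMl// mulrC (le_trans (ltW mP))// ler_nat.
by rewrite (leq_trans (leq_maxr k0 m) (leqnSn _)).
Qed.

Section brownian_motion.
Context d (T : measurableType d) (R : realType) (P : probability T R).
Variable W : R -> T -> R.
Hypothesis HW : standard_Brownian_motion P W.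

Let mW t : 0 <= t -> measurable_fun setT (W t).
Proof. by case: HW => h _ _ _ _; exact: h. Qed.

Section increments.
Variable t : nat -> R.
Hypothesis t0 : 0 <= t 0%N.
Hypothesis nt : nondecreasing_seq t.

Let tge0 i : 0 <= t i. Proof. by apply: le_trans t0 _; exact: nt. Qed.

Definition increment i w := W (t i.+1) w - W (t i) w.

Definition increment_system i := preimage_set_system [set: T] (increment i) measurable.

Lemma measurable_increment i : measurable_fun setT (increment i).
Proof. by apply: measurable_funB; exact: mW. Qed.

Lemma increment_systemP :
  [/\ forall i, increment_system i `<=` measurable,
      forall i, setI_closed (increment_system i),
      forall i, increment_system i setT &
      independent_systems P increment_system].
Proof.
split=> [i|i|i|].
- exact: preimage_system_measurable (measurable_increment i).
- exact: preimage_system_setI.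
- exact: preimage_systemT.
- by case: HW => _ _ h _ _; exact: h.
Qed.

Lemma increment_adapted (c : nat -> R) i (A : set R) : measurable A ->
  increment_system i ((fun w => c i * increment i w) @^-1` A).
Proof.
move=> mA; have mf : measurable_fun [set: R] (fun x : R => c i * x).
  exact: measurable_funM.
exact: (preimage_system_comp (increment i) mf mA).
Qed.

End increments.

(** For small [v] and [dl] the errors are small compared with [v]. This suffices, since
    long increments are cut into short ones. *)
Lemma increment_near_normal (a b u dl : R) : 0 <= a -> a < b -> 0 < dl ->
  u ^+ 2 * (b - a) / 2 <= 1 / 8 ->
  let v := u ^+ 2 * (b - a) / 2 in
  `|expect P (fun w => cos (u * (W b w - W a w))) - expR (- v)| <= 100 * v ^+ 2 /\
  `|expect P (fun w => sin (u * (W b w - W a w)))| <=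
    3 * (dl * (2 * v) + 16 * v ^+ 2 / dl).
Proof.
move=> a0 ab dl0 v8 v.
have b0 : 0 <= b by rewrite (le_trans a0)// ltW.
pose s := Num.sqrt (b - a).
have s0 : s != 0 by rewrite gt_eqF// sqrtr_gt0 subr_gt0.
have s2 : s ^+ 2 = b - a by rewrite sqr_sqrtr// subr_ge0 ltW.
have mD : measurable_fun setT (fun w => W b w - W a w).
  by apply: measurable_funB; exact: mW.
have lD (A : set R) : measurable A ->
    P ((fun w => W b w - W a w) @^-1` A) = normal_prob 0 s A.
  by move=> mA; case: HW => _ _ _ h _; exact: h.
have ve : (u * s) ^+ 2 / 2 = v by rewrite exprMn s2.
have mu (f : R -> R) : continuous f -> measurable_fun [set: R] (fun x => f (u * x)).
  move=> cf; apply: (measurableT_comp (f := f)); last exact: measurable_funM.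
  exact: continuous_measurable_fun.
split.
  rewrite (expect_normal mD lD (f := fun x => cos (u * x)) (c := 1)); last 2 first.
  - by apply: mu; exact: continuous_cos.
  - by move=> x; exact: cos_max.
  by have := @normal_cos R s u s0; rewrite ve; apply.
rewrite (expect_normal mD lD (f := fun x => sin (u * x)) (c := 1)); last 2 first.
- by apply: mu; exact: continuous_sin.
- by move=> x; exact: sin_max.
by have := @normal_sin R s u s0; rewrite ve; apply.
Qed.

(** The increment is a sum of [k ^ 2] independent ones, so that the estimates
    of the previous lemma add up to an exact value when [k] tends to infinity *)
Lemma expect_cos_increment (a b u ph : R) : 0 <= a -> a <= b ->
  expect P (fun w => cos (u * (W b w - W a w) + ph)) =
  cos ph * expR (- (u ^+ 2 * (b - a) / 2)).
Proof.
move=> a0; rewrite le_eqVlt => /predU1P[<-|ab].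
  have -> : (fun w => cos (u * (W a w - W a w) + ph)) = (fun=> cos ph).
    by apply/funext => w; rewrite subrr mulr0 add0r.
  by rewrite expect_cst subrr mulr0 mul0r oppr0 expR0 mulr1.
set V := u ^+ 2 * (b - a) / 2.
have V0 : 0 <= V by rewrite /V divr_ge0// mulr_ge0 ?sqr_ge0// subr_ge0 ltW.
(* [k ^ 2] increments, each with the error of [increment_near_normal] for
   [dl = k^-1] and [v = V / k ^ 2], add up to at most [(12 * V + 296 * V ^ 2) / k]. *)
apply: (@eq_of_le_inv_nat _ _ _ (12 * V + 296 * V ^+ 2) (Num.truncn (8 * V)).+1) => k k8 k0.
have kR : 0 < k%:R :> R by rewrite ltr0n.
have kn0 : (k%:R : R) != 0 by rewrite gt_eqF.
pose n := (k ^ 2)%N.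
have nR : n%:R = k%:R ^+ 2 :> R by rewrite /n natrX.
have nR0 : 0 < n%:R :> R by rewrite nR exprn_gt0.
have nn0 : (n%:R : R) != 0 by rewrite gt_eqF.
pose h := (b - a) / n%:R.
have h0 : 0 < h by rewrite divr_gt0// subr_gt0.
pose t i := a + i%:R * h.
have t00 : 0 <= t 0%N by rewrite /t mul0r addr0.
have nt : nondecreasing_seq t.
  by move=> i j ij; rewrite /t lerD2l ler_wpM2r ?(ltW h0)// ler_nat.
have tge0 i : 0 <= t i by rewrite (le_trans t00)// nt.
have tS i : t i.+1 - t i = h by rewrite /t -natr1; ring.
have tlt i : t i < t i.+1 by rewrite -subr_gt0 tS.
have [Fm FI FT ind] := increment_systemP t00 nt.
have ad := increment_adapted t (fun=> u).
have V8 : V / n%:R <= 1 / 8.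
  rewrite ler_pdivrMr// nR; have : 8 * V <= k%:R.
    apply: (le_trans (ltW (truncnS_gt _))); by rewrite ler_nat.
  have : k%:R <= k%:R ^+ 2 :> R by rewrite ler_eXnr// ler1n.
  lra.
pose v (i : nat) := u ^+ 2 * h.
have ve : u ^+ 2 * h / 2 = V / n%:R by rewrite /h /V; field.
pose e (i : nat) := 3 * (k%:R^-1 * (2 * (V / n%:R)) + 16 * (V / n%:R) ^+ 2 / k%:R^-1)
  + 100 * (V / n%:R) ^+ 2.
have e1 : 0 <= 100 * (V / n%:R) ^+ 2 by rewrite mulr_ge0// sqr_ge0.
have e2 : 0 <= 3 * (k%:R^-1 * (2 * (V / n%:R)) + 16 * (V / n%:R) ^+ 2 / k%:R^-1).
  have x0 : 0 <= V / n%:R by rewrite divr_ge0// ltW.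
  have i0 : 0 <= k%:R^-1 :> R by rewrite invr_ge0 ltW.
  apply: mulr_ge0 => //; apply: addr_ge0; first by apply: mulr_ge0 => //; exact: mulr_ge0.
  by apply: divr_ge0 => //; apply: mulr_ge0 => //; exact: sqr_ge0.
have kV0 : 0 < k%:R^-1 :> R by rewrite invr_gt0.
have near i := @increment_near_normal (t i) (t i.+1) u k%:R^-1 (tge0 i) (tlt i) kV0.
have := @expect_cos_sum _ _ _ P _ _ Fm FI FT ind _ ad v e (index_iota 0 n) ph
  (iota_uniq _ _).
move=> /(_ _ _ _).
have -> : (fun w => cos (\sum_(i <- index_iota 0 n) u * increment t i w + ph)) =
          (fun w => cos (u * (W b w - W a w) + ph)).
  apply/funext => w; congr (cos (_ + _)); rewrite -mulr_sumr; congr (_ * _).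
  rewrite /increment (telescope_sumr (fun i => W (t i) w))//.
  rewrite /t mul0r addr0 /h; congr (W _ w - _).
  by rewrite mulrC divfK// addrCA subrr addr0.
rewrite !big_const_seq !count_predT !size_iota subn0 !iter_addr !addr0.
have -> : v 0%N *+ n / 2 = V by rewrite -mulr_natr mulrAC ve divfK.
move=> H.
apply: (le_trans (H _ _ _)).
- by move=> i; rewrite mulr_ge0 ?sqr_ge0// ltW.
- move=> i _; have := near i; rewrite tS ve => /(_ V8)[h1 _].
  by apply: (le_trans h1); rewrite /e lerDr.
- move=> i _; have := near i; rewrite tS ve => /(_ V8)[_ h1].
  by apply: (le_trans h1); rewrite /e lerDl.
rewrite -[e 0%N *+ n]mulr_natr /e nR.
rewrite -subr_ge0.
have -> : (12 * V + 296 * V ^+ 2) / k%:R - 2 * ((3 * (k%:R^-1 * (2 * (V / k%:R ^+ 2)) +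
  16 * (V / k%:R ^+ 2) ^+ 2 / k%:R^-1) + 100 * (V / k%:R ^+ 2) ^+ 2) * k%:R ^+ 2)
  = 200 * V ^+ 2 * (k%:R - 1) / k%:R ^+ 2 by field.
apply: divr_ge0; last by rewrite exprn_ge0// ltW.
apply: mulr_ge0; first by rewrite mulr_ge0// sqr_ge0.
by rewrite subr_ge0 ler1n.
Qed.

(** Taking the phase [- pi / 2] turns a statement on cosines into one on sines,
    which provides both hypotheses of [expect_cos_sum] with error 0. *)
Lemma expect_cos_increments (t : nat -> R) (c : nat -> R) n (ph : R) :
  0 <= t 0%N -> nondecreasing_seq t ->
  expect P (fun w => cos (\sum_(0 <= i < n) c i * (W (t i.+1) w - W (t i) w) + ph)) =
  cos ph * expR (- ((\sum_(0 <= i < n) c i ^+ 2 * (t i.+1 - t i)) / 2)).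
Proof.
move=> t0 nt.
have [Fm FI FT ind] := increment_systemP t0 nt.
have ad := increment_adapted t c.
have tge0 i : 0 <= t i by rewrite (le_trans t0)// nt.
have key i s := @expect_cos_increment (t i) (t i.+1) (c i) s (tge0 i) (nt _ _ (leqnSn i)).
pose v i := c i ^+ 2 * (t i.+1 - t i).
have := @expect_cos_sum _ _ _ P _ _ Fm FI FT ind _ ad v (fun=> 0) (index_iota 0 n) ph
  (iota_uniq _ _).
rewrite [X in _ -> _ -> _ -> _ <= 2 * X]big1// mulr0 => H.
apply/eqP; rewrite -subr_eq0 -normr_le0; apply: H.
- by move=> i; rewrite mulr_ge0 ?sqr_ge0// subr_ge0 nt.
- move=> i _; have := key i 0; rewrite cos0 mul1r.
  under eq_fun do rewrite addr0.
  by move=> ->; rewrite subrr normr0.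
- move=> i _; have := key i (- (pi / 2)); rewrite cosN cos_pihalf mul0r.
  under eq_fun do rewrite cosBpihalf.
  by move=> ->; rewrite normr0.
Qed.

End brownian_motion.

Section brownian_vector.
Context d (T : measurableType d) (R : realType) (P : probability T R).
Variables (p : nat) (W : 'I_p -> R -> T -> R).
Hypothesis HW : independent_Brownian_motions P W.

Lemma process_sigma_algebra_measurable j : process_sigma_algebra (W j) `<=` measurable.
Proof.
apply: smallest_sub; first exact: sigma_algebra_measurable.
move=> A [t /= t0]; apply: preimage_system_measurable.
by have [/(_ j)[mW _ _ _ _] _] := HW; exact: mW.
Qed.

Lemma expect_cos_brownian_vector (t : nat -> R) (c : 'I_p -> nat -> R) n (ph : R) :
  0 <= t 0%N -> nondecreasing_seq t ->
  expect P (fun w => cos (\sum_j \sum_(0 <= i < n)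
     c j i * (W j (t i.+1) w - W j (t i) w) + ph)) =
  cos ph * expR (- ((\sum_j \sum_(0 <= i < n) c j i ^+ 2 * (t i.+1 - t i)) / 2)).
Proof.
move=> t0 nt; have [bm ind] := HW.
pose F j := process_sigma_algebra (W j).
have Fm j : F j `<=` measurable by exact: process_sigma_algebra_measurable.
pose G j := \bigcup_(t in [set t : R | 0 <= t])
  preimage_set_system [set: T] (W j t) measurable.
have FI j : setI_closed (F j) by exact: (@measurableI _ (g_sigma_algebraType (G j))).
have FT j : F j setT by exact: (@measurableT _ (g_sigma_algebraType (G j))).
pose xi j w := \sum_(0 <= i < n) c j i * (W j (t i.+1) w - W j (t i) w).
have ad j (A : set R) : measurable A -> F j (xi j @^-1` A).
  move=> mA.
  have mW s : 0 <= s ->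
      measurable_fun (setT : set (g_sigma_algebraType (G j))) (W j s : g_sigma_algebraType (G j) -> R).
    move=> s0 _ B mB; apply: sub_sigma_algebra; exists s => //; by exists B.
  have tge0 i : 0 <= t i by rewrite (le_trans t0)// nt.
  have : measurable_fun (setT : set (g_sigma_algebraType (G j))) (xi j : g_sigma_algebraType (G j) -> R).
    apply: measurable_sum => i; apply: measurable_funM => //.
    by apply: measurable_funB; exact: mW.
  by move=> /(_ measurableT A mA); rewrite setTI.
pose v j := \sum_(0 <= i < n) c j i ^+ 2 * (t i.+1 - t i).
have := @expect_cos_sum _ _ _ P _ F Fm FI FT ind xi ad v (fun=> 0) (index_enum 'I_p) ph
  (index_enum_uniq _).
rewrite [X in _ -> _ -> _ -> _ <= 2 * X]big1// mulr0 => H.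
apply/eqP; rewrite -subr_eq0 -normr_le0; apply: H.
- by move=> i; apply: sumr_ge0 => k _; rewrite mulr_ge0 ?sqr_ge0// subr_ge0 nt.
- move=> j _; have := expect_cos_increments (bm j) (c j) n 0 t0 nt; rewrite cos0 mul1r.
  under [X in expect P X]eq_fun do rewrite addr0.
  by move=> ->; rewrite subrr normr0.
- move=> j _; have := expect_cos_increments (bm j) (c j) n (- (pi / 2)) t0 nt.
  rewrite cosN cos_pihalf mul0r.
  under [X in expect P X]eq_fun do rewrite cosBpihalf.
  by move=> ->; rewrite normr0.
Qed.

End brownian_vector.

(** * Bernstein polynomials *)

Section bernstein.
Context {R : realType}.
Variable u : R.

(** The probability of [k] successes in [n] trials, defined by conditioning on the
    last trial, which makes the moments an induction. *)
Fixpoint bernstein (n k : nat) : R :=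
  if n is m.+1 then (1 - u) * bernstein m k + u * (if k is l.+1 then bernstein m l else 0)
  else (k == 0%N)%:R.

Lemma bernstein_gt n k : (n < k)%N -> bernstein n k = 0.
Proof.
elim: n k => [|n IH] [|k]//= nk; rewrite !IH ?mulr0 ?addr0//.
exact: ltn_trans nk.
Qed.

Lemma bernstein_ge0 n k : 0 <= u -> u <= 1 -> 0 <= bernstein n k.
Proof.
move=> u0 u1; elim: n k => [|n IH] k /=; first by rewrite ler0n.
by rewrite addr_ge0// mulr_ge0// ?subr_ge0//; case: k.
Qed.

Lemma sum_bernsteinS n (g : nat -> R) :
  \sum_(k < n.+2) bernstein n.+1 k * g k =
  (1 - u) * (\sum_(k < n.+1) bernstein n k * g k) +
  u * (\sum_(k < n.+1) bernstein n k * g k.+1).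
Proof.
rewrite /=; under eq_bigr do rewrite mulrDl -!mulrA.
rewrite big_split/= -!mulr_sumr; congr (_ * _ + _ * _).
  by rewrite big_ord_recr/= bernstein_gt// mul0r addr0.
by rewrite big_ord_recl/= mul0r add0r.
Qed.

Lemma sum_bernstein n : \sum_(k < n.+1) bernstein n k = 1.
Proof.
elim: n => [|n IH]; first by rewrite big_ord1.
have := sum_bernsteinS n (fun=> 1).
by under eq_bigr do rewrite mulr1; move=> ->; under eq_bigr do rewrite mulr1; rewrite IH; ring.
Qed.

Lemma bernstein_moments n :
  \sum_(k < n.+1) bernstein n k * (k%:R - n%:R * u) = 0 /\
  \sum_(k < n.+1) bernstein n k * (k%:R - n%:R * u) ^+ 2 = n%:R * (u * (1 - u)).
Proof.
elim: n => [|n [IH1 IH2]]; first by rewrite !big_ord1 /= !mul0r subr0 expr0n/= mulr0.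
have S0 := sum_bernstein n.
have E1 (a : R) : \sum_(k < n.+1) bernstein n k * (k%:R - n%:R * u + a) = a.
  by under eq_bigr do rewrite mulrDr; rewrite big_split/= IH1 add0r -mulr_suml S0 mul1r.
have E2 (a : R) : \sum_(k < n.+1) bernstein n k * (k%:R - n%:R * u + a) ^+ 2 =
    n%:R * (u * (1 - u)) + a ^+ 2.
  under eq_bigr => k _.
    have -> : bernstein n k * (k%:R - n%:R * u + a) ^+ 2 =
      bernstein n k * (k%:R - n%:R * u) ^+ 2 +
      (2 * a * (bernstein n k * (k%:R - n%:R * u)) + a ^+ 2 * bernstein n k) by ring.
    over.
  by rewrite !big_split/= IH2 -!mulr_sumr IH1 S0 mulr0 add0r mulr1.
split.
  rewrite (sum_bernsteinS n (fun k => k%:R - n.+1%:R * u)).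
  have -> : \sum_(k < n.+1) bernstein n k * (k%:R - n.+1%:R * u) = - u.
    by rewrite -[RHS]E1; apply: eq_bigr => k _; rewrite -natr1; ring.
  have -> : \sum_(k < n.+1) bernstein n k * (k.+1%:R - n.+1%:R * u) = 1 - u.
    by rewrite -[RHS]E1; apply: eq_bigr => k _; rewrite -!natr1; ring.
  ring.
rewrite (sum_bernsteinS n (fun k => (k%:R - n.+1%:R * u) ^+ 2)).
have -> : \sum_(k < n.+1) bernstein n k * (k%:R - n.+1%:R * u) ^+ 2 =
    n%:R * (u * (1 - u)) + (- u) ^+ 2.
  by rewrite -E2; apply: eq_bigr => k _; rewrite -natr1; ring.
have -> : \sum_(k < n.+1) bernstein n k * (k.+1%:R - n.+1%:R * u) ^+ 2 =
    n%:R * (u * (1 - u)) + (1 - u) ^+ 2.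
  by rewrite -E2; apply: eq_bigr => k _; rewrite -!natr1; ring.
by rewrite -natr1; ring.
Qed.

(** The variance [n * u * (1 - u)] bounds the mean absolute deviation after
    [`|y| / m ^ 2 <= m^-1 / 2 + y ^ 2 / m ^ 3 / 2]; taking [m ^ 2] trials avoids roots. *)
Lemma bernstein_concentration (m : nat) : (0 < m)%N -> 0 <= u -> u <= 1 ->
  \sum_(k < (m ^ 2).+1) bernstein (m ^ 2) k * `|k%:R / (m ^ 2)%:R - u| <= m%:R^-1.
Proof.
move=> m0 u0 u1; have mR : 0 < m%:R :> R by rewrite ltr0n.
set n := (m ^ 2)%N.
have nR : n%:R = m%:R ^+ 2 :> R by rewrite /n natrX.
have [_ h2] := bernstein_moments n.
apply: (@le_trans _ _ (\sum_(k < n.+1) bernstein n k *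
    (m%:R^-1 / 2 + (k%:R - n%:R * u) ^+ 2 / m%:R ^+ 3 / 2))).
  apply: ler_sum => k _; rewrite ler_wpM2l ?bernstein_ge0//.
  have -> : k%:R / n%:R - u = (k%:R - n%:R * u) / m%:R ^+ 2.
    by rewrite nR; field; rewrite gt_eqF.
  rewrite normrM [X in _ * X]gtr0_norm ?invr_gt0 ?exprn_gt0//.
  rewrite -(real_normK (num_real (k%:R - _))) -subr_ge0.
  set y := `|_|.
  have -> : m%:R^-1 / 2 + y ^+ 2 / m%:R ^+ 3 / 2 - y / m%:R ^+ 2 =
    (y - m%:R) ^+ 2 / m%:R ^+ 3 / 2 by field; rewrite gt_eqF.
  by rewrite !divr_ge0 ?sqr_ge0// exprn_ge0// ltW.
under eq_bigr do rewrite mulrDr.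
rewrite big_split/= -mulr_suml sum_bernstein mul1r.
rewrite (_ : \sum_(k < n.+1) _ = (\sum_(k < n.+1)
    bernstein n k * (k%:R - n%:R * u) ^+ 2) / m%:R ^+ 3 / 2); last first.
  by rewrite !mulr_suml; apply: eq_bigr => k _; rewrite !mulrA.
rewrite h2 nR.
have -> : m%:R ^+ 2 * (u * (1 - u)) / m%:R ^+ 3 / 2 = (u * (1 - u)) / 2 * m%:R^-1.
  by field; rewrite gt_eqF.
have : 0 < m%:R^-1 :> R by rewrite invr_gt0.
nra.
Qed.

End bernstein.

(** * Trigonometric approximation of Lipschitz functions *)

Section trigonometric_polynomials.
Context {R : realType} {I : finType}.
Implicit Types (f g : (I -> R) -> R) (x th : I -> R).

(** The functions whose expectations are controlled by characteristic functions. The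
    phases make this span of cosines an algebra, by the addition formulas. *)
Inductive trig_poly : ((I -> R) -> R) -> Prop :=
| trig_cos th a : trig_poly (fun x => cos (\sum_i th i * x i + a))
| trig_lin c f g : trig_poly f -> trig_poly g -> trig_poly (fun x => c * f x + g x).

Lemma trig_eq f g : f =1 g -> trig_poly f -> trig_poly g.
Proof. by move=> /funext ->. Qed.

Lemma trig_cst c : trig_poly (fun=> c).
Proof.
have t1 : trig_poly (fun=> 1).
  apply: trig_eq (trig_cos (fun=> 0) 0) => x.
  by rewrite big1 ?addr0 ?cos0// => i _; rewrite mul0r.
by apply: trig_eq (trig_lin (c - 1) t1 t1) => x; ring.
Qed.

Lemma trigD f g : trig_poly f -> trig_poly g -> trig_poly (fun x => f x + g x).
Proof. by move=> hf hg; apply: trig_eq (trig_lin 1 hf hg) => x; rewrite mul1r. Qed.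

Lemma trigZ c f : trig_poly f -> trig_poly (fun x => c * f x).
Proof. by move=> hf; apply: trig_eq (trig_lin c hf (trig_cst 0)) => x; rewrite addr0. Qed.

Lemma trigM f g : trig_poly f -> trig_poly g -> trig_poly (fun x => f x * g x).
Proof.
move=> hf; elim: hf g => [th a|c f1 f2 _ IH1 _ IH2] g hg; last first.
  by apply: trig_eq (trig_lin c (IH1 _ hg) (IH2 _ hg)) => x; ring.
elim: hg => [th' a'|c g1 g2 _ IH1 _ IH2]; last first.
  by apply: trig_eq (trig_lin c IH1 IH2) => x; ring.
have h1 := trig_cos (fun i => th i + th' i) (a + a').
have h2 := trig_cos (fun i => th i - th' i) (a - a').
apply: trig_eq (trigZ (1 / 2) (trigD h1 h2)) => x.
have -> : \sum_i (th i + th' i) * x i + (a + a') =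
    (\sum_i th i * x i + a) + (\sum_i th' i * x i + a').
  by under eq_bigr do rewrite mulrDl; rewrite big_split/=; ring.
have -> : \sum_i (th i - th' i) * x i + (a - a') =
    (\sum_i th i * x i + a) - (\sum_i th' i * x i + a').
  by under eq_bigr do rewrite mulrBl; rewrite sumrB; ring.
by rewrite cosD cosB; field.
Qed.

Lemma trig_sum (K : finType) (F : K -> (I -> R) -> R) :
  (forall k, trig_poly (F k)) -> trig_poly (fun x => \sum_k F k x).
Proof.
move=> hF; elim: (index_enum K) => [|k s IH].
  by apply: trig_eq (trig_cst 0) => x; rewrite big_nil.
by apply: trig_eq (trigD (hF k) IH) => x; rewrite big_cons.
Qed.

Lemma trig_prod (K : finType) (F : K -> (I -> R) -> R) :
  (forall k, trig_poly (F k)) -> trig_poly (fun x => \prod_k F k x).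
Proof.
move=> hF; elim: (index_enum K) => [|k s IH].
  by apply: trig_eq (trig_cst 1) => x; rewrite big_nil.
by apply: trig_eq (trigM (hF k) IH) => x; rewrite big_cons.
Qed.

Lemma trig_sin L i : trig_poly (fun x => sin (x i / L)).
Proof.
apply: trig_eq (trig_cos (fun j => if j == i then L^-1 else 0) (- (pi / 2))) => x.
rewrite cosBpihalf (bigD1 i)//= eqxx big1 ?addr0 1?mulrC//.
by move=> j /negbTE ->; rewrite mul0r.
Qed.

Lemma trig_bernstein n k (v : (I -> R) -> R) : trig_poly v ->
  trig_poly (fun x => bernstein (v x) n k).
Proof.
move=> hv; elim: n k => [|n IH] k /=; first exact: trig_cst.
apply: trigD; last first.
  by case: k => [|k]; apply: trigM => //; exact: trig_cst.
apply: trigM => //.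
by apply: trig_eq (trig_lin (-1) hv (trig_cst 1)) => x; ring.
Qed.

(** A Bernstein polynomial in the bounded variables [L * sin (x i / L)], which
    stay close to [x i] on bounded sets *)
Definition sin_bernstein (f : (I -> R) -> R) (L : R) (n : nat) (x : I -> R) : R :=
  \sum_(k : {ffun I -> 'I_n.+1})
     f (fun i => L * (2 * (k i)%:R / n%:R - 1)) *
     \prod_i bernstein ((1 + sin (x i / L)) / 2) n (k i).

Lemma trig_sin_bernstein f L n : trig_poly (sin_bernstein f L n).
Proof.
apply: trig_sum => k; apply: trigZ; apply: trig_prod => i; apply: trig_bernstein.
by apply: trig_eq (trig_lin (1 / 2) (trig_sin L i) (trig_cst (1 / 2))) => x; field.
Qed.

Variables (f : (I -> R) -> R) (C : R).
Hypothesis f01 : forall x, 0 <= f x <= 1.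
Hypothesis C0 : 0 <= C.
Hypothesis fC : forall x y, `|f x - f y| <= C * \sum_i `|x i - y i|.

Let b01 (t : R) : 0 <= (1 + sin t) / 2 /\ (1 + sin t) / 2 <= 1.
Proof. by have := sin_geN1 t; have := sin_le1 t; split; lra. Qed.

(** The products of Bernstein weights form a probability law on the grid, under
    which every coordinate is concentrated near [L * sin (x i / L)]. *)
Lemma sin_bernstein_error (L : R) (m : nat) x : 0 < L -> (0 < m)%N ->
  `|sin_bernstein f L (m ^ 2) x - f (fun i => L * sin (x i / L))| <=
  C * #|I|%:R * (2 * L) / m%:R.
Proof.
move=> L0 m0; set n := (m ^ 2)%N.
have nR0 : n%:R != 0 :> R by rewrite pnatr_eq0 -lt0n expn_gt0 m0.
pose b i (k : 'I_n.+1) := bernstein ((1 + sin (x i / L)) / 2) n k.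
have b0 i k : 0 <= b i k by have [? ?] := b01 (x i / L); exact: bernstein_ge0.
have b1 i : \sum_k b i k = 1 by exact: sum_bernstein.
have B1 : \sum_(k : {ffun I -> 'I_n.+1}) \prod_i b i (k i) = 1.
  by rewrite -(bigA_distr_bigA b) big1.
set fx := f (fun i => L * sin (x i / L)).
have -> : sin_bernstein f L n x - fx = \sum_(k : {ffun I -> 'I_n.+1})
   (f (fun i => L * (2 * (k i)%:R / n%:R - 1)) - fx) * \prod_i b i (k i).
  under [RHS]eq_bigr do rewrite mulrBl.
  by rewrite sumrB -mulr_sumr B1 mulr1.
apply: (le_trans (ler_norm_sum _ _ _)).
pose g j i (k : 'I_n.+1) := b i k *
  (if i == j then 2 * L * `|k%:R / n%:R - (1 + sin (x i / L)) / 2| else 1).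
apply: (@le_trans _ _ (\sum_(k : {ffun I -> 'I_n.+1})
   C * \sum_j \prod_i g j i (k i))).
  apply: ler_sum => k _; rewrite normrM [X in _ * X]ger0_norm; last first.
    by apply: prodr_ge0 => i _; exact: b0.
  have P0 : 0 <= \prod_i b i (k i) by apply: prodr_ge0 => i _; exact: b0.
  apply: (le_trans (ler_wpM2r P0 (fC _ _))).
  rewrite -mulrA ler_wpM2l// mulr_suml; apply: ler_sum => j _.
  rewrite /g big_split/= mulrC; apply: ler_wpM2l => //.
  rewrite (bigD1 j)//= eqxx big1 ?mulr1; last by move=> i /negbTE ->.
  rewrite -[X in X * `|_|]gtr0_norm ?mulr_gt0// -normrM.
  by rewrite le_eqVlt; apply/orP; left; apply/eqP; congr `|_|; field.
rewrite -mulr_sumr -!mulrA ler_wpM2l// exchange_big/=.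
apply: (@le_trans _ _ (\sum_(j : I) 2 * L / m%:R)); last first.
  by rewrite sumr_const -[leLHS]mulr_natl !mulrA.
apply: ler_sum => j _.
rewrite -(bigA_distr_bigA (g j)) (bigD1 j)//= [X in _ * X]big1 ?mulr1; last first.
  by move=> i ij; rewrite /g (negbTE ij); under eq_bigr do rewrite mulr1; exact: b1.
rewrite /g eqxx.
under eq_bigr do rewrite mulrCA.
rewrite -mulr_sumr ler_wpM2l ?mulr_ge0 ?(ltW L0)//.
by have [? ?] := b01 (x j / L); exact: bernstein_concentration.
Qed.

Lemma sin_bernstein01 (L : R) (n : nat) x : 0 <= sin_bernstein f L n x <= 1.
Proof.
pose b i (k : 'I_n.+1) := bernstein ((1 + sin (x i / L)) / 2) n k.
have b0 i k : 0 <= b i k by have [? ?] := b01 (x i / L); exact: bernstein_ge0.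
have b1 i : \sum_k b i k = 1 by exact: sum_bernstein.
have B1 : \sum_(k : {ffun I -> 'I_n.+1}) \prod_i b i (k i) = 1.
  by rewrite -(bigA_distr_bigA b) big1.
apply/andP; split.
  apply: sumr_ge0 => k _; apply: mulr_ge0.
    by have /andP[] := f01 (fun i => L * (2 * (k i)%:R / n%:R - 1)).
  by apply: prodr_ge0 => i _; exact: b0.
rewrite -[leRHS]B1; apply: ler_sum => k _; rewrite ler_piMl//.
  by apply: prodr_ge0 => i _; exact: b0.
by have /andP[] := f01 (fun i => L * (2 * (k i)%:R / n%:R - 1)).
Qed.

Lemma sin_distort_error (L rho : R) x : 0 < L -> (forall i, `|x i| <= rho) ->
  `|f (fun i => L * sin (x i / L)) - f x| <= C * #|I|%:R * (rho ^+ 3 / L ^+ 2).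
Proof.
move=> L0 xr; apply: (le_trans (fC _ _)); rewrite -mulrA ler_wpM2l//.
apply: (@le_trans _ _ (\sum_(j : I) rho ^+ 3 / L ^+ 2)); last first.
  by rewrite sumr_const -[leLHS]mulr_natl.
apply: ler_sum => i _; apply: (le_trans (sin_scale_error _ L0)).
rewrite ler_wpM2r ?invr_ge0 ?exprn_ge0 ?(ltW L0)// lerXn2r ?nnegrE//.
exact: le_trans (xr i).
Qed.

End trigonometric_polynomials.

(** * A continuity theorem of Levy *)

Section trig_poly_rv.
Context d (T : measurableType d) (R : realType) (P : probability T R).
Context (I : finType) (X : I -> T -> R).
Hypothesis mX : forall i, measurable_fun setT (X i).

Lemma measurable_linear_form (th : I -> R) :
  measurable_fun setT (fun w => \sum_i th i * X i w).
Proof. by apply: measurable_sum => i; apply: measurable_funM. Qed.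

Lemma rint_trig_poly g : trig_poly g -> rint P (fun w => g (X ^~ w)).
Proof.
elim=> [th a|c f1 f2 _ IH1 _ IH2]; last by apply: rintD => //; exact: rintZ.
apply: (@rint_bounded _ _ _ P _ 1) => [|w]; last exact: cos_max.
exact: (measurable_contD a (@continuous_cos R) (measurable_linear_form th)).
Qed.

(** Where all variables are below [rho] the approximation is uniformly good, and
    elsewhere both functions stay in [`[0, 1]]. *)
Lemma expect_sin_bernstein (f : (I -> R) -> R) (C rho L e : R) (m : nat) :
  (forall x, 0 <= f x <= 1) -> 0 <= C ->
  (forall x y, `|f x - f y| <= C * \sum_i `|x i - y i|) ->
  measurable_fun setT (fun w => f (X ^~ w)) ->
  0 <= rho -> 0 < L -> (0 < m)%N ->
  (forall i, pr P [set w | rho <= `|X i w|] <= e) ->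
  `|expect P (fun w => f (X ^~ w)) -
    expect P (fun w => sin_bernstein f L (m ^ 2) (X ^~ w))| <=
  #|I|%:R * (C * (rho ^+ 3 / L ^+ 2) + C * (2 * L) / m%:R + e).
Proof.
move=> f01 C0 fC mf r0 L0 m0 He.
pose A i := [set w | rho <= `|X i w|].
have mA i : measurable (A i) by exact: measurable_norm_ge.
pose E := C * #|I|%:R * (rho ^+ 3 / L ^+ 2) + C * #|I|%:R * (2 * L) / m%:R.
have if_ : rint P (fun w => f (X ^~ w)).
  apply: (@rint_bounded _ _ _ P _ 1) => // w; have /andP[h0 h1] := f01 (X ^~ w).
  by rewrite ger0_norm.
have ib := rint_trig_poly (trig_sin_bernstein f L (m ^ 2)).
rewrite -expectB//.
have iA : rint P (fun w => \sum_i \1_(A i) w).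
  by apply: rint_sum => i; exact: rint_indic.
have E0 : 0 <= E.
  rewrite addr_ge0// !mulr_ge0// ?invr_ge0 ?exprn_ge0//; exact: ltW.
apply: (le_trans (norm_expect (rintB if_ ib))).
apply: (@le_trans _ _ (expect P (fun w => E + \sum_i \1_(A i) w))).
  apply: le_expect; [exact/rint_norm/rintB|apply: rintD => //; exact: rint_cst|].
  move=> w; set x := X ^~ w.
  have S0 : 0 <= \sum_i (\1_(A i) w : R) by apply: sumr_ge0 => i _; rewrite indicE.
  have [/existsP[i /asboolP Ai]|] := boolP [exists i, `[< A i w >]].
    apply: (@le_trans _ _ 1).
      have /andP[h1 h2] := f01 x; have /andP[h3 h4] := sin_bernstein01 f01 L (m ^ 2) x.
      by rewrite ler_norml; apply/andP; split; lra.
    rewrite (bigD1 i)//= indicE mem_set//.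
    rewrite addrCA lerDl addr_ge0//; apply: sumr_ge0 => j _; by rewrite indicE.
  rewrite negb_exists => /forallP nA.
  have xr i : `|x i| <= rho.
    by have /asboolPn := nA i; rewrite /A/= => /negP; rewrite -ltNge => /ltW.
  apply: (@le_trans _ _ E); last by rewrite lerDl.
  have h1 := sin_distort_error C0 fC L0 xr.
  have h2 := sin_bernstein_error C0 fC x L0 m0.
  have := ler_normD (f x - f (fun i => L * sin (x i / L)))
     (f (fun i => L * sin (x i / L)) - sin_bernstein f L (m ^ 2) x).
  rewrite addrA subrK => /le_trans; apply.
  by rewrite /E lerD// distrC.
rewrite expectD//; last exact: rint_cst.
rewrite expect_cst expect_sum; last by move=> i; exact: rint_indic.
apply: (@le_trans _ _ (E + \sum_(i : I) e)).
  rewrite lerD2l; apply: ler_sum => i _; rewrite expect_indic//; exact: He.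
rewrite sumr_const -[e *+ _]mulr_natl /E le_eqVlt; apply/orP; left; apply/eqP.
ring.
Qed.

End trig_poly_rv.

Section levy_continuity.
Context d (T : measurableType d) d' (T' : measurableType d') (R : realType).
Variables (P : probability T R) (P' : probability T' R).
Context (I : finType) (J : Type) (F : set_system J) {FF : Filter F}.
Variables (U : J -> I -> T -> R) (V : I -> T' -> R).
Hypothesis mU : forall j i, measurable_fun setT (U j i).
Hypothesis mV : forall i, measurable_fun setT (V i).
Hypothesis cosU : forall th a,
  expect P (fun w => cos (\sum_i th i * U j i w + a)) @[j --> F] -->
  expect P' (fun w => cos (\sum_i th i * V i w + a)).
Hypothesis tightU : forall e : R, 0 < e -> exists2 rho : R, 0 <= rho &
  \forall j \near F, forall i, pr P [set w | rho <= `|U j i w|] <= e.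

Lemma cvg_trig_poly g : trig_poly g ->
  expect P (fun w => g ((U j) ^~ w)) @[j --> F] --> expect P' (fun w => g (V ^~ w)).
Proof.
elim=> [th a|c f1 f2 h1 IH1 h2 IH2]; first exact: cosU.
have r1 j := rint_trig_poly P (mU j) h1; have r2 j := rint_trig_poly P (mU j) h2.
have s1 := rint_trig_poly P' mV h1; have s2 := rint_trig_poly P' mV h2.
rewrite expectD//; last exact: rintZ.
rewrite expectZ//.
rewrite (_ : (fun j => _) = (fun j => c * expect P (fun w => f1 ((U j) ^~ w))
   + expect P (fun w => f2 ((U j) ^~ w)))); last first.
  by apply/funext => j; rewrite expectD ?expectZ//; exact: rintZ.
by apply: cvgD => //; apply: cvgZr.
Qed.

Lemma tight_variable (X : T' -> R) (e : R) : measurable_fun setT X -> 0 < e ->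
  exists n : nat, pr P' [set w | n%:R <= `|X w|] <= e.
Proof.
move=> mX e0; pose A n := [set w | n%:R <= `|X w|].
have mA n : measurable (A n) by exact: measurable_norm_ge.
have niA : nonincreasing_seq A.
  move=> i j ij; apply/subsetPset => w /=.
  by apply: le_trans; rewrite ler_nat.
have [n nP] := pr_bigcap_cvg P' mA niA e0.
exists n; apply: (le_trans nP).
rewrite (_ : \bigcap_n A n = set0) ?pr0 ?add0r//.
apply/seteqP; split => // w /(_ (Num.truncn `|X w|).+1 Logic.I) /=.
by rewrite /A/= leNgt truncnS_gt.
Qed.

Lemma tight_family (e : R) : 0 < e -> exists2 rho : R, 0 <= rho &
  forall i, pr P' [set w | rho <= `|V i w|] <= e.
Proof.
move=> e0; have /fin_all_exists[n nP] : forall i, exists n : nat,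
    pr P' [set w | n%:R <= `|V i w|] <= e by move=> i; exact: tight_variable.
exists (\max_i n i)%N%:R => [|i]; first by rewrite ler0n.
apply: le_trans (nP i); apply: le_pr; [exact: measurable_norm_ge..|].
by move=> w /=; apply: le_trans; rewrite ler_nat leq_bigmax.
Qed.

(** The Lipschitz function is replaced by a trigonometric polynomial, uniformly in
    [j] by tightness, and expectations of the latter converge by linearity. *)
Theorem levy_lipschitz (f : (I -> R) -> R) (C : R) :
  (forall x, 0 <= f x <= 1) -> 0 <= C ->
  (forall x y, `|f x - f y| <= C * \sum_i `|x i - y i|) ->
  (forall j, measurable_fun setT (fun w => f ((U j) ^~ w))) ->
  measurable_fun setT (fun w => f (V ^~ w)) ->
  expect P (fun w => f ((U j) ^~ w)) @[j --> F] --> expect P' (fun w => f (V ^~ w)).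
Proof.
move=> f01 C0 fC mfU mfV; apply/cvgrPdist_le => eta eta0.
(* Three comparisons, each with an error of three terms that are at most [e] per
   coordinate. *)
set c := #|I|%:R : R; have c0 : 0 <= c by rewrite ler0n.
pose e := eta / (9 * (c + 1)).
have e0 : 0 < e by rewrite divr_gt0// mulr_gt0// ltr_wpDl.
have ec : c * (e + e + e) <= eta / 3.
  have -> : eta / 3 = (c + 1) * (e + e + e).
    by rewrite /e; field; rewrite gt_eqF// ltr_wpDl.
  by rewrite ler_wpM2r ?lerDl// !addr_ge0// ltW.
have [r1 r10 r1P] := tightU e0.
have [r2 r20 r2P] := tight_family e0.
pose L r := 1 + C * r ^+ 3 / e.
have LP r : 0 <= r -> 0 < L r /\ C * (r ^+ 3 / L r ^+ 2) <= e.
  move=> r0; have a0 : 0 <= C * r ^+ 3 / e by apply: divr_ge0; [rewrite mulr_ge0// exprn_ge0|exact: ltW].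
  have L1 : 1 <= L r by rewrite lerDl.
  have L0 : 0 < L r by rewrite (lt_le_trans _ L1).
  split=> //; rewrite mulrA ler_pdivrMr ?exprn_gt0// [e * _]mulrC -ler_pdivrMr//.
  have : L r <= L r ^+ 2 by rewrite ler_eXnr.
  by apply: le_trans; rewrite lerDr.
pose m r := (Num.truncn (C * (2 * L r) / e)).+1.
have mP r : C * (2 * L r) / (m r)%:R <= e.
  by rewrite ler_pdivrMr ?ltr0n// [e * _]mulrC -ler_pdivrMr// ltW// truncnS_gt.
pose rr := Num.max r1 r2.
have rr0 : 0 <= rr by rewrite le_max r10.
have [L0 LE] := LP _ rr0.
have bnd : c * (C * (rr ^+ 3 / L rr ^+ 2) + C * (2 * L rr) / (m rr)%:R + e) <= eta / 3.
  by apply: le_trans ec; rewrite ler_wpM2l// lerD// lerD.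
have hV := @expect_sin_bernstein _ _ _ P' _ V mV f C rr (L rr) e (m rr)
  f01 C0 fC mfV rr0 L0 isT.
have /cvgrPdist_le/(_ (eta / 3)) := cvg_trig_poly (trig_sin_bernstein f (L rr) (m rr ^ 2)).
have e30 : 0 < eta / 3 by rewrite divr_gt0.
move=> /(_ e30) hB; near=> j.
have hU := @expect_sin_bernstein _ _ _ P _ (U j) (mU j) f C rr (L rr) e (m rr)
  f01 C0 fC (mfU j) rr0 L0 isT.
have h1 : forall i, pr P [set w | rr <= `|U j i w|] <= e.
  move=> i; have h : forall i, pr P [set w | r1 <= `|U j i w|] <= e by near: j.
  apply: le_trans (h i); apply: le_pr; [exact: measurable_norm_ge..|].
  by move=> w /=; apply: le_trans; rewrite le_max lexx.
have h2 : forall i, pr P' [set w | rr <= `|V i w|] <= e.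
  move=> i; apply: le_trans (r2P i); apply: le_pr; [exact: measurable_norm_ge..|].
  by move=> w /=; apply: le_trans; rewrite le_max lexx orbT.
have h3 : `|expect P' (fun w => sin_bernstein f (L rr) (m rr ^ 2) (V ^~ w)) -
   expect P (fun w => sin_bernstein f (L rr) (m rr ^ 2) ((U j) ^~ w))| <= eta / 3.
  by near: j.
have := le_trans (hU h1) bnd; have := le_trans (hV h2) bnd; move: h3.
rewrite !ler_norml => /andP[? ?] /andP[? ?] /andP[? ?]; apply/andP; split; lra.
Unshelve. all: by end_near. Qed.

End levy_continuity.

(** * Borel vectors and the distance function *)

Section borel_vectors.
Context {R : realType} {n : nat}.

Lemma measurable_open_cV (f : 'cV[R]_n -> R) : continuous f ->
  measurable_fun setT (f : borel_cV R n -> R).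
Proof.
move=> cf; apply: (@measurability _ _ (borel_cV R n) R setT f _ (RGenOInfty.measurableE R)).
move=> _ [_ [x ->] <-]; rewrite setTI.
apply: sub_sigma_algebra; rewrite /=.
by apply: open_comp => [y _|]; [exact: cf|exact: interval_open].
Qed.

Lemma measurable_coord i : measurable_fun setT ((fun x => x i 0) : borel_cV R n -> R).
Proof. apply: measurable_open_cV => x; exact: coord_continuous. Qed.

(** An open set is a countable union of boxes with rational centres and radii, and
    the preimages of boxes are intersections of events on the coordinates. *)
Lemma measurable_cV d (T : measurableType d) (X : T -> 'cV[R]_n) :
  (forall i, measurable_fun setT (fun w => X w i 0)) ->
  measurable_fun setT (X : T -> borel_cV R n).
Proof.
move=> mX; apply: (@measurability _ _ _ (borel_cV R n) setT X (@open 'cV[R]_n)) => //.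
move=> _ [Z oZ <-]; rewrite setTI.
pose box (q : {ffun 'I_n -> rat} * nat) : set 'cV[R]_n :=
  [set x | forall i, `|x i 0 - ratr (q.1 i)| < q.2.+1%:R^-1].
pose A q := if `[< box q `<=` Z >] then X @^-1` box q else set0.
have mA q : measurable (A q).
  rewrite /A; case: asboolP => // _.
  rewrite (_ : _ @^-1` _ = \bigcap_(i in [set: 'I_n])
      [set w | ~ (q.2.+1%:R^-1 <= `|X w i 0 - ratr (q.1 i)|)]).
    apply: fin_bigcap_measurable => // i _; apply: measurableC.
    by apply: measurable_norm_ge; apply: measurable_funB.
  apply/seteqP; split => w /= h i; last by rewrite ltNge; apply/negP; exact: h.
  by move=> _; apply/negP; rewrite -ltNge.
suff -> : X @^-1` Z = \bigcup_k (if unpickle k is Some q then A q else set0).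
  by apply: bigcupT_measurable => k; case: unpickle.
apply/seteqP; split => [w /= Zw|w [k _]]; last first.
  by case: unpickle => // q; rewrite /A; case: asboolP => // bZ Xw; exact: bZ.
have [e /= e0 eZ] : exists2 e : R, 0 < e & ball (X w) e `<=` Z.
  have /nbhs_ballP[e e0 ?] : nbhs (X w) Z by apply: open_nbhs_nbhs; split.
  by exists e.
pose k := Num.truncn (2 / e).
have k2 : k.+1%:R^-1 < e / 2.
  by rewrite -invf_div ltf_pV2 ?posrE ?divr_gt0// truncnS_gt.
have /fin_all_exists[q qP] : forall i, exists q : rat, `|X w i 0 - ratr q| < k.+1%:R^-1.
  move=> i; have k0 : 0 < k.+1%:R^-1 :> R by rewrite invr_gt0.
  have lt : X w i 0 - k.+1%:R^-1 < X w i 0 + k.+1%:R^-1 by rewrite ltrBlDr -addrA ltrDl addr_gt0.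
  have [q] := rat_in_itvoo lt.
  by rewrite in_itv/= => /andP[h1 h2]; exists q; rewrite distrC ltr_distl h1.
exists (pickle ([ffun i => q i], k)) => //; rewrite pickleK /A.
case: asboolP => [_ i|]; first by rewrite /= ffunE.
case; move=> x bx; apply: eZ; split => // i j; rewrite (ord1 j).
have := bx i; rewrite /= ffunE => h.
rewrite /ball/= (le_lt_trans (ler_distD (ratr (q i)) _ _))//.
rewrite [e]splitr ltrD//; first exact: lt_trans (qP i) k2.
by rewrite distrC (lt_trans h).
Qed.

End borel_vectors.

Section distance.
Context {R : realType} {p : nat}.
Variables (N : 'cV[R]_p -> R) (hN : distance_function N).

Lemma dist0 : N 0 = 0. Proof. by case: hN => _ h _ _ _; exact/h. Qed.

Lemma distN x : N (- x) = N x.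
Proof. by case: hN => _ _ _ h _; rewrite -scaleN1r h normrN1 mul1r. Qed.

Lemma dist_triangle x y : N (x + y) <= N x + N y.
Proof. by case: hN => h *; exact: h. Qed.

Lemma dist_ge0 x : 0 <= N x.
Proof.
have := dist_triangle x (- x); rewrite subrr dist0 distN; lra.
Qed.

Lemma distZ a x : N (a *: x) = `|a| * N x.
Proof. by case: hN => _ _ _ h _; exact: h. Qed.

Lemma dist_diff x y : `|N x - N y| <= N (x - y).
Proof.
have h1 := dist_triangle (x - y) y; have h2 := dist_triangle (y - x) x.
rewrite !subrK in h1 h2; have h3 := distN (x - y); rewrite opprB in h3.
by rewrite ler_norml; apply/andP; split; lra.
Qed.

(** The constant of the definition may be nonpositive when [p] is 0. *)
Lemma dist_bound : exists2 c : R, 0 < c & forall x, N x <= c * \sum_(i < p) `|x i 0|.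
Proof.
case: hN => _ _ _ _ [c cP]; exists (Num.max 1 c); first by rewrite lt_max ltr01.
move=> x; apply: (le_trans (cP x)); rewrite ler_wpM2r ?sumr_ge0//.
by rewrite le_max lexx orbT.
Qed.

Lemma dist_continuous : continuous N.
Proof.
have [c c0 cP] := dist_bound; move=> x A /nbhs_ballP[e /= e0 eA].
have k0 : 0 < e / (c * p.+1%:R) by rewrite divr_gt0// mulr_gt0.
apply/nbhs_ballP; exists (e / (c * p.+1%:R)) => //= y [_ xy].
apply: eA; rewrite /ball/=.
apply: (le_lt_trans (dist_diff _ _)); apply: (le_lt_trans (cP _)).
have h : \sum_(i < p) `|(x - y) i 0| <= \sum_(i < p) e / (c * p.+1%:R).
  by apply: ler_sum => i _; rewrite !mxE; have := xy i 0; rewrite /ball/= => /ltW.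
apply: (le_lt_trans (ler_wpM2l (ltW c0) h)).
rewrite sumr_const card_ord -[_ *+ p]mulr_natr.
have -> : c * (e / (c * p.+1%:R) * p%:R) = e * p%:R / p.+1%:R.
  have : 0 < p.+1%:R :> R by rewrite ltr0n.
  set q : R := p.+1%:R => q0; by field; rewrite !gt_eqF.
by rewrite ltr_pdivrMr// ltr_pM2l// ltr_nat.
Qed.

Lemma measurable_dist d (T : measurableType d) (X : T -> 'cV[R]_p) :
  (forall i, measurable_fun setT (fun w => X w i 0)) ->
  measurable_fun setT (fun w => N (X w)).
Proof.
move=> mX; exact: (measurableT_comp (measurable_open_cV dist_continuous) (measurable_cV mX)).
Qed.

End distance.

(** * Sums of independent identically distributed vectors *)

Section lindeberg_modulus.
Context d (T : measurableType d) (R : realType) (P : probability T R).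
Variable G : T -> R.
Hypothesis mG : measurable_fun setT G.
Hypothesis G0 : forall w, 0 <= G w.
Hypothesis iG : rint P (fun w => G w ^+ 2).

Lemma rint_lindeberg rho : 0 <= rho ->
  rint P (fun w => G w ^+ 2 * Num.min 1 (rho * G w)).
Proof.
move=> r0; apply: rint_le iG.
  apply: measurable_funM; first exact: measurable_funX.
  by apply: measurable_minr => //; exact: measurable_funM.
move=> w; rewrite ger0_norm ?mulr_ge0 ?sqr_ge0 ?le_min ?ler01 ?mulr_ge0//.
by rewrite ler_piMr ?sqr_ge0// ge_min lexx.
Qed.

(** Dominated convergence, with the square of [G] as integrable bound. *)
Lemma lindeberg_small (e : R) : 0 < e -> exists2 rho : R, 0 < rho &
  expect P (fun w => G w ^+ 2 * Num.min 1 (rho * G w)) <= e.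
Proof.
move=> e0; pose f n w := (G w ^+ 2 * Num.min 1 (n.+1%:R^-1 * G w))%:E.
have rn n : 0 <= n.+1%:R^-1 :> R by rewrite invr_ge0.
have fle n w : (`|f n w| <= (G w ^+ 2)%:E)%E.
  rewrite lee_fin ger0_norm ?mulr_ge0 ?sqr_ge0 ?le_min ?ler01 ?mulr_ge0//.
  by rewrite ler_piMr ?sqr_ge0// ge_min lexx.
have cv w : f ^~ w @ \oo --> 0%E.
  apply: cvg_EFin; first exact: nearW.
  apply: (@squeeze_cvgr _ _ _ _ (cst 0) (fun n => G w ^+ 3 * harmonic n)).
  - apply: nearW => n; apply/andP; split.
      by rewrite /= mulr_ge0 ?sqr_ge0 ?le_min ?ler01 ?mulr_ge0.
    have -> : G w ^+ 3 * harmonic n = G w ^+ 2 * (n.+1%:R^-1 * G w) by rewrite /=; ring.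
    by rewrite /= ler_wpM2l ?sqr_ge0// ge_min lexx orbT.
  - exact: cvg_cst.
  - by rewrite -(mulr0 (G w ^+ 3)); apply: cvgMr; exact: cvg_harmonic.
have [_ _] := @dominated_convergence _ T R P setT measurableT f (cst 0%E)
  (fun w => (G w ^+ 2)%:E)
  (fun n => measurable_int _ (rint_lindeberg (rn n))) (measurable_cst _)
  (aeW _ (fun w _ => cv w)) iG (aeW _ (fun w n _ => fle n w)).
rewrite integral0 => /fine_cvg /cvgrPdist_le/(_ e e0)[n _ /(_ n (leqnn n))] /=.
rewrite sub0r normrN => h; exists n.+1%:R^-1; first by rewrite invr_gt0.
exact: le_trans (ler_norm _) h.
Qed.

End lindeberg_modulus.

Lemma Lfun2_rint d (T : measurableType d) (R : realType) (P : probability T R)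
    (X : T -> R) : X \in Lfun P 2%:E -> rint P X.
Proof.
move=> h; apply/Lfun1_integrable; apply: Lfun_subset12 h.
exact: fin_num_measure.
Qed.

Section iid_vectors_theory.
Context d (T : measurableType d) (R : realType) (P : probability T R).
Variables (r : nat) (B : nat -> T -> 'cV[R]_r) (b : 'cV[R]_r) (S : 'M[R]_r).
Hypothesis Biid : iid_vectors P B.
Hypothesis Bm : forall i, has_mean_cov P (B i) b S.

Definition centered l i w : R := B i w l 0 - b l 0.

Definition linform (c : nat -> 'I_r -> R) i w : R := \sum_l c i l * centered l i w.

Definition sample_system i :=
  preimage_set_system [set: T] (B i : T -> borel_cV R r) measurable.

Lemma measurable_sample i : measurable_fun setT (B i : T -> borel_cV R r).
Proof. by case: Biid => h _ _; exact: h. Qed.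

Lemma sample_systemP :
  [/\ forall i, sample_system i `<=` measurable,
      forall i, setI_closed (sample_system i),
      forall i, sample_system i setT &
      independent_systems P sample_system].
Proof.
split=> [i|i|i|].
- exact: preimage_system_measurable (measurable_sample i).
- exact: preimage_system_setI.
- exact: preimage_systemT.
- by case: Biid => _ h _; exact: h.
Qed.

Lemma measurable_linform_cV (c : 'I_r -> R) :
  measurable_fun setT ((fun x => \sum_l c l * (x l 0 - b l 0)) : borel_cV R r -> R).
Proof.
apply: measurable_sum => l; apply: measurable_funM => //.
by apply: measurable_funB => //; exact: measurable_coord.
Qed.

Lemma linform_adapted c i (A : set R) : measurable A ->
  sample_system i (linform c i @^-1` A).
Proof.
exact: (preimage_system_comp (B i : T -> borel_cV R r) (measurable_linform_cV (c i))).
Qed.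

Lemma measurable_sample_coord l i : measurable_fun setT (fun w => B i w l 0).
Proof. exact: (measurableT_comp (measurable_coord l) (measurable_sample i)). Qed.

Lemma measurable_centered l i : measurable_fun setT (centered l i).
Proof. by apply: measurable_funB => //; exact: measurable_sample_coord. Qed.

Lemma rint_centered l i : rint P (centered l i).
Proof.
have [h _ _] := Bm i; apply: rintB; last exact: rint_cst.
exact: (Lfun2_rint (h l)).
Qed.

Lemma expect_centered l i : expect P (centered l i) = 0.
Proof.
have [h hm _] := Bm i; rewrite expectB; last 2 first.
- exact: (Lfun2_rint (h l)).
- exact: rint_cst.
rewrite expect_cst /expect /Rintegral; have := hm l; rewrite unlock => ->.
by rewrite subrr.
Qed.

Lemma centeredM k l i : rint P (fun w => centered k i w * centered l i w) /\
  expect P (fun w => centered k i w * centered l i w) = S k l.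
Proof.
have [h hm hc] := Bm i.
have L2 j : (fun w => B i w j 0 - b j 0) \in Lfun P 2%:E.
  have hB := rpredB (h j) (Lfun_cst P (b j 0) 2).
  have -> : (fun w => B i w j 0 - b j 0) = (fun w => B i w j 0) - cst (b j 0) by exact/funext.
  by apply: hB; rewrite lee_fin ler1n.
split; first by apply/Lfun1_integrable; exact: (Lfun2_mul_Lfun1 (L2 k) (L2 l)).
have := hc k l; rewrite covariance.unlock !hm /= unlock => e.
by rewrite /expect /Rintegral e.
Qed.

Lemma linformE c : (forall i, rint P (linform c i)) /\
  (forall i, expect P (linform c i) = 0).
Proof.
have i1 i l : rint P (fun w => c i l * centered l i w).
  by apply: rintZ; exact: rint_centered.
split=> i; first exact: rint_sum.
rewrite expect_sum// big1// => l _.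
by rewrite expectZ ?expect_centered ?mulr0//; exact: rint_centered.
Qed.

Lemma linform_sqr c i : rint P (fun w => linform c i w ^+ 2) /\
  expect P (fun w => linform c i w ^+ 2) = \sum_k \sum_l c i k * c i l * S k l.
Proof.
have e : (fun w => linform c i w ^+ 2) = (fun w => \sum_k \sum_l
    c i k * c i l * (centered k i w * centered l i w)).
  apply/funext => w; rewrite expr2 /linform mulr_suml; apply: eq_bigr => k _.
  by rewrite mulr_sumr; apply: eq_bigr => l _; ring.
have i1 k l : rint P (fun w => c i k * c i l * (centered k i w * centered l i w)).
  by apply: rintZ; exact: (centeredM k l i).1.
rewrite e; split; first by do 2 apply: rint_sum => ?.
rewrite expect_sum; last by move=> k; exact: rint_sum.
apply: eq_bigr => k _; rewrite expect_sum//; apply: eq_bigr => l _.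
by have [j1 <-] := centeredM k l i; rewrite expectZ.
Qed.

Lemma expect_iid (g : borel_cV R r -> R) i : measurable_fun setT g ->
  (forall x, 0 <= g x) -> expect P (fun w => g (B i w)) = expect P (fun w => g (B 0%N w)).
Proof.
move=> mg g0; rewrite /expect /Rintegral; congr fine.
have me : measurable_fun setT (EFin \o g) by exact/measurable_EFinP.
have e0 x : (0 <= (EFin \o g) x)%E by rewrite lee_fin.
have h j := @ge0_integral_distribution _ _ _ _ _ P (as_mfun (measurable_sample j)) _ me e0.
rewrite -[LHS](h i) -[RHS](h 0%N).
by apply: eq_measure_integral => A mA _; case: Biid => _ _ hB; exact: hB.
Qed.

Definition abs_sum i w : R := \sum_l `|centered l i w|.

Lemma measurable_abs_sum i : measurable_fun setT (abs_sum i).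
Proof.
apply: measurable_sum => l; apply: measurableT_comp => //; exact: measurable_centered.
Qed.

Lemma abs_sum_ge0 i w : 0 <= abs_sum i w.
Proof. by apply: sumr_ge0. Qed.

Lemma rint_abs_sum i : rint P (fun w => abs_sum i w ^+ 2).
Proof.
have e : (fun w => abs_sum i w ^+ 2) = (fun w => \sum_k \sum_l
    `|centered k i w * centered l i w|).
  apply/funext => w; rewrite expr2 /abs_sum mulr_suml; apply: eq_bigr => k _.
  by rewrite mulr_sumr; apply: eq_bigr => l _; rewrite normrM.
rewrite e; do 2 apply: rint_sum => ?.
by apply: rint_norm; exact: (centeredM _ _ _).1.
Qed.

Lemma expect_lindeberg rho i : 0 <= rho ->
  expect P (fun w => abs_sum i w ^+ 2 * Num.min 1 (rho * abs_sum i w)) =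
  expect P (fun w => abs_sum 0 w ^+ 2 * Num.min 1 (rho * abs_sum 0 w)).
Proof.
move=> r0.
pose G (x : borel_cV R r) := \sum_l `|x l 0 - b l 0|.
have mG : measurable_fun setT G.
  apply: measurable_sum => l; apply: measurableT_comp => //.
  by apply: measurable_funB => //; exact: measurable_coord.
have G0 x : 0 <= G x by exact: sumr_ge0.
apply: (@expect_iid (fun x => G x ^+ 2 * Num.min 1 (rho * G x)) i).
  apply: measurable_funM; first exact: measurable_funX.
  by apply: measurable_minr => //; exact: measurable_funM.
by move=> x; rewrite mulr_ge0 ?sqr_ge0// le_min ler01 mulr_ge0.
Qed.

End iid_vectors_theory.

(** * A central limit theorem with uniformity in the weights *)

Section central_limit.
Context d (T : measurableType d) (R : realType) (P : probability T R).
Variables (r : nat) (B : nat -> T -> 'cV[R]_r) (b : 'cV[R]_r) (S : 'M[R]_r).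
Hypothesis Biid : iid_vectors P B.
Hypothesis Bm : forall i, has_mean_cov P (B i) b S.

Local Notation G := (abs_sum B b).
Local Notation xi := (linform B b).

Definition quadform (c : 'I_r -> R) : R := \sum_k \sum_l c k * c l * S k l.

Let omega rho := expect P (fun w => G 0 w ^+ 2 * Num.min 1 (rho * G 0 w)).

Let g2 := expect P (fun w => G 0 w ^+ 2).

Let g2_ge0 : 0 <= g2.
Proof. by apply: expect_ge0 => w; exact: sqr_ge0. Qed.

Let omega_le rho rho' : 0 <= rho -> rho <= rho' -> omega rho <= omega rho'.
Proof.
move=> r0 rr; have mG := measurable_abs_sum b Biid 0; have iG := rint_abs_sum Bm 0.
apply: le_expect.
- exact: (rint_lindeberg mG (abs_sum_ge0 B b 0) iG).
- exact: (rint_lindeberg mG (abs_sum_ge0 B b 0) iG (le_trans r0 rr)).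
move=> w; rewrite ler_wpM2l ?sqr_ge0// le_min !ge_min lexx/=.
by rewrite ler_wpM2r ?orbT// abs_sum_ge0.
Qed.

Section one_summand.
Variables (c : nat -> 'I_r -> R) (rho : R) (i : nat).
Hypothesis r0 : 0 <= rho.
Hypothesis cr : forall l, `|c i l| <= rho.

Let q := quadform (c i).

Let xiG w : `|xi c i w| <= rho * G i w.
Proof.
apply: (le_trans (ler_norm_sum _ _ _)); rewrite /abs_sum mulr_sumr.
by apply: ler_sum => l _; rewrite normrM ler_wpM2r.
Qed.

Let xi2G w : xi c i w ^+ 2 <= rho ^+ 2 * G i w ^+ 2.
Proof.
rewrite -(real_normK (num_real (xi c i w))) -exprMn lerXn2r// nnegrE.
by rewrite mulr_ge0// abs_sum_ge0.
Qed.

Let mxi : measurable_fun setT (xi c i).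
Proof. by have [h _] := linformE Bm c; exact: rint_measurable (h i). Qed.

Lemma quadform_bounds : 0 <= quadform (c i) <= rho ^+ 2 * g2.
Proof.
have [i2 e2] := linform_sqr Bm c i.
rewrite /quadform -e2; apply/andP; split.
  by apply: expect_ge0 => w; exact: sqr_ge0.
have iG j := rint_abs_sum Bm j.
have -> : g2 = expect P (fun w => G i w ^+ 2).
  pose g (x : borel_cV R r) := \sum_l `|x l 0 - b l 0|.
  have mg : measurable_fun setT g.
    apply: measurable_sum => l; apply: measurableT_comp => //.
    by apply: measurable_funB => //; exact: measurable_coord.
  symmetry; apply: (@expect_iid _ _ _ P _ _ Biid (fun x => g x ^+ 2) i).
    exact: measurable_funX.
  by move=> x; exact: sqr_ge0.
rewrite -expectZ//; apply: le_expect => //; exact: rintZ.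
Qed.

(** The modulus [omega] is that of the first vector, since the vectors have the same
    law: this is where uniformity in the index and in the weights comes from. *)
Lemma linform_cos_sin :
  `|expect P (fun w => cos (xi c i w)) - expR (- (quadform (c i) / 2))| <=
    2 * (rho ^+ 2 * omega rho) + (rho ^+ 2 * g2) ^+ 2 / 4 /\
  `|expect P (fun w => sin (xi c i w))| <= 2 * (rho ^+ 2 * omega rho).
Proof.
have [h1 h2] := linformE Bm c; have [i2 e2] := linform_sqr Bm c i.
have /andP[q0 q1] := quadform_bounds.
have mG := measurable_abs_sum b Biid i; have iG := rint_abs_sum Bm i.
have iL := rint_lindeberg mG (abs_sum_ge0 B b i) iG r0.
have iL2 := rintZ 2 (rintZ (rho ^+ 2) iL).
have eL : expect P (fun w => 2 * (rho ^+ 2 * (G i w ^+ 2 * Num.min 1 (rho * G i w)))) =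
    2 * (rho ^+ 2 * omega rho).
  by rewrite expectZ ?expectZ ?(expect_lindeberg b Biid)//; exact: rintZ.
have dom w : 2 * (xi c i w ^+ 2 * Num.min 1 `|xi c i w|) <=
    2 * (rho ^+ 2 * (G i w ^+ 2 * Num.min 1 (rho * G i w))).
  rewrite ler_wpM2l// mulrA; apply: ler_pM; [exact: sqr_ge0| |exact: xi2G|].
    by rewrite le_min ler01/=.
  by rewrite le_min !ge_min lexx/= xiG orbT.
have ic : rint P (fun w => cos (xi c i w)).
  apply: (@rint_bounded _ _ _ P _ 1) => [|w]; last exact: cos_max.
  by have := measurable_contD 0 (@continuous_cos R) mxi; under eq_fun do rewrite addr0.
have is_ : rint P (fun w => sin (xi c i w)).
  apply: (@rint_bounded _ _ _ P _ 1) => [|w]; last exact: sin_max.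
  by have := measurable_contD 0 (@continuous_sin R) mxi; under eq_fun do rewrite addr0.
split.
  have iq : rint P (fun w => 1 - 1 / 2 * xi c i w ^+ 2).
    by apply: rintB; [exact: rint_cst|exact: rintZ].
  have eq : expect P (fun w => 1 - 1 / 2 * xi c i w ^+ 2) = 1 - quadform (c i) / 2.
    rewrite expectB ?expectZ ?expect_cst ?e2//; [|exact: rint_cst|exact: rintZ].
    by rewrite -/(quadform (c i)); field.
  have k1 : `|expect P (fun w => cos (xi c i w)) - (1 - quadform (c i) / 2)| <=
      2 * (rho ^+ 2 * omega rho).
    rewrite -eq -expectB// -eL; apply: (le_trans (norm_expect (rintB ic iq))).
    apply: le_expect => //; first exact/rint_norm/rintB.
    move=> w; apply: le_trans (dom w); have := cos_error (xi c i w).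
    by have -> : xi c i w ^+ 2 / 2 = 1 / 2 * xi c i w ^+ 2 by field.
  have k2 := expRN_error (divr_ge0 q0 (ler0n R 2)).
  have k3 : (quadform (c i) / 2) ^+ 2 <= (rho ^+ 2 * g2) ^+ 2 / 4.
    have -> : (quadform (c i) / 2) ^+ 2 = quadform (c i) ^+ 2 / 4 by field.
    by rewrite ler_pM2r ?invr_gt0// lerXn2r// nnegrE (le_trans q0).
  move: k1 k2; rewrite !ler_norml => /andP[? ?] /andP[? ?]; apply/andP; split; lra.
rewrite -[expect P _]subr0 -(h2 i) -expectB// -eL.
apply: (le_trans (norm_expect (rintB is_ (h1 i)))).
apply: le_expect => //; first exact/rint_norm/rintB.
by move=> w; apply: le_trans (dom w); exact: sin_error.
Qed.

End one_summand.

(** Weights of order [M ^ (- 1 / 2)] and a number of summands of order [M] keep the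
    sum of the Lindeberg errors below a multiple of [omega], evaluated at a point that
    tends to 0. *)
Lemma linform_clt (K L e : R) : 0 <= K -> 0 <= L -> 0 < e ->
  exists2 M0 : R, 0 < M0 & forall M : R, M0 <= M ->
  forall (n : nat) (c : nat -> 'I_r -> R) (a : R), n%:R <= L * M ->
    (forall i l, `|c i l| <= K / Num.sqrt M) ->
  `|expect P (fun w => cos (\sum_(0 <= i < n) xi c i w + a)) -
    cos a * expR (- ((\sum_(0 <= i < n) quadform (c i)) / 2))| <= e.
Proof.
move=> K0 L0 e0.
pose LK := L * K ^+ 2.
have LK0 : 0 <= LK by rewrite mulr_ge0 ?sqr_ge0.
pose e1 := e / (8 * (LK + 1)).
have e10 : 0 < e1 by rewrite divr_gt0// mulr_gt0// ltr_wpDl.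
have e1LK : 4 * LK * e1 <= e / 2.
  have -> : e / 2 = 4 * (LK + 1) * e1 by rewrite /e1; field; rewrite gt_eqF// ltr_wpDl.
  by rewrite ler_wpM2r ?(ltW e10)// ler_wpM2l// lerDl.
have [rho0 r00 rP] := lindeberg_small (measurable_abs_sum b Biid 0)
  (abs_sum_ge0 B b 0) (rint_abs_sum Bm 0) e10.
pose A := LK * K ^+ 2 * g2 ^+ 2 / e.
have A0 : 0 <= A by rewrite divr_ge0 ?(ltW e0)// !mulr_ge0 ?sqr_ge0.
exists (1 + (K / rho0) ^+ 2 + A); first by rewrite ltr_wpDr// ltr_wpDr// sqr_ge0.
move=> M MM n c a nM cK.
have s0 : 0 <= (K / rho0) ^+ 2 by rewrite sqr_ge0.
have M1 : 1 <= M by move: MM; lra.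
have M0 : 0 < M by rewrite (lt_le_trans _ M1).
have AM : A <= M by move: MM; lra.
have KM : (K / rho0) ^+ 2 <= M by move: MM; lra.
have sM0 : 0 < Num.sqrt M by rewrite sqrtr_gt0.
pose rho := K / Num.sqrt M.
have rho_0 : 0 <= rho by rewrite divr_ge0// ltW.
have rho2 : rho ^+ 2 = K ^+ 2 / M by rewrite /rho expr_div_n sqr_sqrtr// ltW.
have rr : rho <= rho0.
  rewrite /rho ler_pdivrMr// mulrC -ler_pdivrMr//.
  rewrite -(@ger0_norm _ (K / rho0)); last by rewrite divr_ge0// ltW.
  by rewrite -sqrtr_sqr ler_sqrt// ltW.
have om : omega rho <= e1 by apply: le_trans rP; exact: omega_le.
have om0 : 0 <= omega rho.
  apply: expect_ge0 => w; rewrite mulr_ge0 ?sqr_ge0// le_min ler01/=.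
  by rewrite mulr_ge0// abs_sum_ge0.
have [Fm FI FT ind] := sample_systemP Biid.
pose ei (i : nat) := 2 * (rho ^+ 2 * omega rho) + (rho ^+ 2 * g2) ^+ 2 / 4.
have := @expect_cos_sum _ _ _ P _ _ Fm FI FT ind _ (linform_adapted B b c)
  (fun i => quadform (c i)) ei (index_iota 0 n) a (iota_uniq _ _).
move=> H; apply: (le_trans (H _ _ _)).
- by move=> i; have /andP[] := quadform_bounds rho_0 (cK i).
- by move=> i _; have [] := linform_cos_sin rho_0 (cK i).
- move=> i _; have [_ h] := linform_cos_sin rho_0 (cK i).
  by apply: (le_trans h); rewrite lerDl divr_ge0// sqr_ge0.
rewrite big_const_seq count_predT size_iota subn0 iter_addr addr0 -[_ *+ n]mulr_natr.
have e4 : 2 * (ei 0%N * n%:R) = 4 * omega rho * (n%:R * rho ^+ 2) +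
  (rho ^+ 2 * g2 ^+ 2 / 2) * (n%:R * rho ^+ 2) by rewrite /ei; field.
rewrite [leLHS]e4.
have nr : n%:R * rho ^+ 2 <= LK.
  rewrite rho2 mulrA ler_pdivrMr// /LK mulrAC ler_wpM2r ?sqr_ge0//.
have t1 : 4 * omega rho * (n%:R * rho ^+ 2) <= e / 2.
  apply: le_trans e1LK; have -> : 4 * LK * e1 = 4 * e1 * LK by ring.
  by apply: ler_pM; [rewrite mulr_ge0|rewrite mulr_ge0// sqr_ge0|rewrite ler_wpM2l|].
have t2 : (rho ^+ 2 * g2 ^+ 2 / 2) * (n%:R * rho ^+ 2) <= e / 2.
  apply: (@le_trans _ _ (rho ^+ 2 * g2 ^+ 2 / 2 * LK)).
    by rewrite ler_wpM2l// divr_ge0// mulr_ge0 ?sqr_ge0.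
  rewrite rho2; have -> : K ^+ 2 / M * g2 ^+ 2 / 2 * LK = (A * e / M) / 2.
    by rewrite /A; field; rewrite !gt_eqF.
  by rewrite ler_pM2r ?invr_gt0// ler_pdivrMr// mulrC ler_wpM2l// ltW.
lra.
Qed.

End central_limit.

(** * Finite-dimensional laws of the limit process *)

Section bilinear_sums.
Context {R : realType}.

Lemma bilinear_expand (r m : nat) (a : 'I_m -> R) (x : 'I_m -> 'rV[R]_r) (S : 'M[R]_r) :
  \sum_l \sum_l' (\sum_k a k * x k 0 l) * (\sum_k a k * x k 0 l') * S l l' =
  \sum_k \sum_k' a k * a k' * (x k *m S *m (x k')^T) 0 0.
Proof.
have e k k' : (x k *m S *m (x k')^T) 0 0 = \sum_l \sum_l' x k 0 l * x k' 0 l' * S l l'.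
  rewrite mxE exchange_big/=; apply: eq_bigr => l' _.
  rewrite !mxE mulr_suml; apply: eq_bigr => l _; ring.
under [RHS]eq_bigr do under eq_bigr do rewrite e mulr_sumr.
under [RHS]eq_bigr do under eq_bigr do under eq_bigr do rewrite mulr_sumr.
under [LHS]eq_bigr do under eq_bigr do rewrite big_distrlr/= mulr_suml.
under [LHS]eq_bigr do under eq_bigr do under eq_bigr do rewrite mulr_suml.
under [LHS]eq_bigr do under eq_bigr do rewrite pair_bigA/=.
under [RHS]eq_bigr do under eq_bigr do rewrite pair_bigA/=.
rewrite pair_bigA/= [RHS]pair_bigA/= exchange_big/=.
by apply: eq_bigr => -[k k'] _; apply: eq_bigr => -[l l'] _ /=; ring.
Qed.

Lemma sum_if_lt (n q : nat) (f : nat -> R) : (q <= n)%N ->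
  \sum_(0 <= i < n) (if (i < q)%N then f i else 0) = \sum_(0 <= i < q) f i.
Proof.
by move=> qn; rewrite -big_mkcond/= (big_nat_widen 0 q n).
Qed.

End bilinear_sums.

Section fdd_brownian.
Context d' (T' : measurableType d') (R : realType) (P' : probability T' R).
Variables (p m : nat) (W : 'I_p -> R -> T' -> R) (Q Sigma : 'M[R]_p).
Hypothesis HW : independent_Brownian_motions P' W.
Hypothesis HQ : is_psd_sqrt Q Sigma.
Variable u : nat -> R.
Hypothesis u0 : u 0%N = 0.
Hypothesis nu : nondecreasing_seq u.

(** The index pairs a time of the grid with a coordinate. *)
Definition Vvec (kj : 'I_m * 'I_p) w : R := (Q *m \col_j W j (u kj.1.+1) w) kj.2 0.

Let uge0 i : 0 <= u i. Proof. by rewrite -u0 nu. Qed.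

Lemma measurable_Vvec kj : measurable_fun setT (Vvec kj).
Proof.
rewrite /Vvec; under [X in measurable_fun _ X]eq_fun do rewrite mxE.
apply: measurable_sum => j; apply: measurable_funM => //.
under [X in measurable_fun _ X]eq_fun do rewrite mxE.
by have [/(_ j)[mW _ _ _ _] _] := HW; exact: mW.
Qed.

(** The bilinear form of [Sigma] at the coefficients of the times [k] and [k']. *)
Definition Dform (th : 'I_m * 'I_p -> R) (k k' : 'I_m) : R :=
  ((\row_j th (k, j)) *m Sigma *m (\row_j th (k', j))^T) 0 0.

(** Summation by parts turns the linear form in the values into one in the
    independent increments, and back again in the exponent, where the covariances
    [min (u k, u l)] appear. *)
Lemma expect_cos_Vvec (th : 'I_m * 'I_p -> R) a :
  expect P' (fun w => cos (\sum_kj th kj * Vvec kj w + a)) =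
  cos a * expR (- ((\sum_(k < m) \sum_(k' < m) u (minn k k').+1 * Dform th k k') / 2)).
Proof.
pose al (k : 'I_m) : 'rV_p := (\row_j th (k, j)) *m Q.
pose c (j : 'I_p) (i : nat) : R := \sum_(k < m) (if (i <= k)%N then al k 0 j else 0).
have [bm _] := HW; have [QT _ QQ] := HQ.
have mW j t : 0 <= t -> measurable_fun setT (W j t).
  by have [mW _ _ _ _] := bm j; exact: mW.
have W0 : {ae P', forall w, forall j, W j 0 w = 0}.
  have : {ae P', forall w, forall j, j \in index_enum 'I_p -> W j 0 w = 0}.
    elim: (index_enum 'I_p) => [|j s IH]; first by apply: aeW.
    have [_ h _ _ _] := bm j; apply: filterS2 h IH => w h1 h2 i.
    by rewrite inE => /predU1P[->|/h2].
  by apply: filterS => w h j; apply: h; rewrite mem_index_enum.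
transitivity (expect P' (fun w => cos (\sum_j \sum_(0 <= i < m)
    c j i * (W j (u i.+1) w - W j (u i) w) + a))).
  apply: expect_ae.
  - apply: (measurable_contD a (@continuous_cos R)).
    by apply: measurable_linear_form => kj; exact: measurable_Vvec.
  - apply: (measurable_contD a (@continuous_cos R)).
    apply: measurable_sum => j; apply: measurable_sum => i; apply: measurable_funM => //.
    by apply: measurable_funB; exact: mW.
  - apply: filterS W0 => w W0; congr (cos (_ + _)).
    transitivity (\sum_(j < p) \sum_(k < m) al k 0 j * W j (u k.+1) w).
      rewrite exchange_big/=.
      have -> : \sum_kj th kj * Vvec kj w = \sum_k \sum_j th (k, j) * Vvec (k, j) w.
        by rewrite pair_bigA; apply: eq_bigr => -[].
      apply: eq_bigr => k _; rewrite /Vvec/=.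
      under eq_bigr do rewrite mxE mulr_sumr.
      rewrite exchange_big/=; apply: eq_bigr => j _.
      by rewrite /al [X in _ = X * _]mxE mulr_suml; apply: eq_bigr => j' _; rewrite !mxE mulrA.
    apply: eq_bigr => j _; rewrite /c.
    under [RHS]eq_bigr do rewrite mulr_suml.
    rewrite exchange_big/=; apply: eq_bigr => k _.
    rewrite (eq_big_nat _ _ (F2 := fun i => if (i < k.+1)%N
      then al k 0 j * (W j (u i.+1) w - W j (u i) w) else 0)); last first.
      by move=> i _; rewrite ltnS; case: ifP => // _; rewrite mul0r.
    rewrite sum_if_lt// -mulr_sumr (telescope_sumr (fun i => W j (u i) w))//.
    by rewrite u0 W0 subr0.
rewrite (expect_cos_brownian_vector HW); [|by rewrite u0|by []].
congr (_ * expR (- (_ / 2))).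
transitivity (\sum_(0 <= i < m) (u i.+1 - u i) *
   \sum_(k < m) \sum_(k' < m) (i <= k)%N%:R * (i <= k')%N%:R * Dform th k k').
  rewrite exchange_big/=; apply: eq_bigr => i _.
  rewrite -mulr_suml mulrC; congr (_ * _).
  have := bilinear_expand (fun k : 'I_m => (i <= k)%N%:R) al 1%:M.
  under [in RHS]eq_bigr do under eq_bigr do
    rewrite /al mulmx1 trmx_mul QT mulmxA -(mulmxA _ Q Q) QQ.
  move=> <-; apply: eq_bigr => j _.
  have I1 (j1 j2 : 'I_p) : (1%:M : 'M[R]_p) j1 j2 = (j1 == j2)%:R by rewrite mxE.
  rewrite (bigD1 j)//= I1 eqxx mulr1 [X in _ + X]big1 ?addr0; last first.
    by move=> j' jj; rewrite I1 eq_sym (negbTE jj) mulr0.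
  rewrite expr2 /c; congr (_ * _); apply: eq_bigr => k _.
    by case: ifP; rewrite (mul1r, mul0r).
  by case: ifP; rewrite (mul1r, mul0r).
under eq_bigr do rewrite mulr_sumr.
rewrite exchange_big/=; apply: eq_bigr => k _.
under eq_bigr do rewrite mulr_sumr.
rewrite exchange_big/=; apply: eq_bigr => k' _.
rewrite (eq_big_nat _ _ (F2 := fun i => (if (i < (minn k k').+1)%N
      then (u i.+1 - u i) else 0) * Dform th k k')); last first.
  move=> i _; rewrite mulrA; congr (_ * _); rewrite ltnS -natrM mulnb.
  case: (leqP k k') => kk.
    by case: (leqP i k) => ik; rewrite ?mulr0// (leq_trans ik kk) mulr1.
  by case: (leqP i k') => ik; rewrite ?andbF ?mulr0// (leq_trans ik (ltnW kk)) mulr1.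
rewrite -mulr_suml sum_if_lt.
  by rewrite telescope_sumr// u0 subr0.
by rewrite /minn; case: ifP.
Qed.

End fdd_brownian.

(** * Finite-dimensional laws of the averages *)

Section partial_sums.
Context d (T : measurableType d) (R : realType).
Variables (r : nat) (B : nat -> T -> 'cV[R]_r) (b : 'cV[R]_r).

Definition psum l n w : R := \sum_(0 <= i < n) centered B b l i w.

Lemma average_centered n w l : (0 < n)%N ->
  (average B n w - b) l 0 = psum l n w / n%:R.
Proof.
move=> n0; have nR : n%:R != 0 :> R by rewrite pnatr_eq0 -lt0n.
rewrite /psum /average !mxE summxE big_mkord /centered sumrB.
by rewrite sumr_const card_ord -[_ *+ n]mulr_natr; field.
Qed.

End partial_sums.

Section scaled_sums.
Context d (T : measurableType d) (R : realType) (P : probability T R).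
Variables (r : nat) (B : nat -> T -> 'cV[R]_r) (b : 'cV[R]_r) (S : 'M[R]_r).
Hypothesis Biid : iid_vectors P B.
Hypothesis Bm : forall i, has_mean_cov P (B i) b S.
Variables (p m : nat) (A : 'M[R]_(p, r)) (u : nat -> R).
Hypothesis upos : forall k, 0 < u k.+1.
Hypothesis nu : nondecreasing_seq u.

(** The first time after [M / u], decreasing in [u]: the average at this time,
    multiplied by [sqrt M], corresponds to Brownian motion at time [u]. *)
Definition grid_index (M : R) (k : nat) : nat := (Num.truncn (M / u k.+1)).+1.

Definition Uvec (M : R) (kj : 'I_m * 'I_p) w : R :=
  Num.sqrt M * (A *m (average B (grid_index M kj.1) w - b)) kj.2 0.

Lemma grid_index_gt M k : M / u k.+1 < (grid_index M k)%:R.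
Proof. exact: truncnS_gt. Qed.

Lemma grid_index_le M k : 0 <= M -> (grid_index M k)%:R <= M / u k.+1 + 1.
Proof.
move=> M0; rewrite /grid_index -natr1 lerD2r -truncn_ge_nat//.
by rewrite divr_ge0// ltW.
Qed.

Lemma ratio_grid_index_le M k : 0 < M -> M / (grid_index M k)%:R <= u k.+1.
Proof.
move=> M0; rewrite ler_pdivrMr ?ltr0n// mulrC -ler_pdivrMr//.
exact/ltW/grid_index_gt.
Qed.

Lemma ratio_grid_index_cvg k : M / (grid_index M k)%:R @[M --> +oo] --> u k.+1.
Proof.
have uk := upos k.
apply/cvgrPdist_le => e e0; near=> M.
have M0 : 0 < M by near: M; exact: nbhs_pinfty_gt.
have n0 : 0 < (grid_index M k)%:R :> R by rewrite ltr0n.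
rewrite ger0_norm ?subr_ge0 ?ratio_grid_index_le//.
have h := grid_index_le k (ltW M0).
rewrite lerBlDr -lerBlDl ler_pdivlMr//.
have [e1|e1] := leP (u k.+1) e.
  apply: (@le_trans _ _ 0); last exact: ltW.
  by rewrite mulr_le0_ge0 ?subr_le0// ltW.
apply: (le_trans (ler_wpM2l _ h)); first by rewrite subr_ge0 ltW.
have M1 : u k.+1 ^+ 2 / e <= M by near: M; apply: nbhs_pinfty_ge; exact: num_real.
rewrite ler_pdivrMr// in M1.
rewrite -(@ler_pM2r _ (u k.+1))//.
have -> : (u k.+1 - e) * (M / u k.+1 + 1) * u k.+1 = (u k.+1 - e) * (M + u k.+1).
  by field; rewrite gt_eqF.
nra.
Unshelve. all: by end_near. Qed.

Lemma UvecE M (kj : 'I_m * 'I_p) w : Uvec M kj w =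
  Num.sqrt M / (grid_index M kj.1)%:R * \sum_l A kj.2 l * psum B b l (grid_index M kj.1) w.
Proof.
rewrite /Uvec mxE !mulr_sumr; apply: eq_bigr => l _.
by rewrite average_centered//; ring.
Qed.

Lemma measurable_psum l n : measurable_fun setT (psum B b l n).
Proof. by apply: measurable_sum => i; exact: (measurable_centered b Biid l i). Qed.

Lemma measurable_Uvec M kj : measurable_fun setT (Uvec M kj).
Proof.
rewrite (funext (UvecE M kj)).
apply: measurable_funM => //; apply: measurable_sum => l; apply: measurable_funM => //.
exact: measurable_psum.
Qed.

Lemma linform_psum (q : nat) (a : 'I_r -> R) w :
  \sum_(0 <= i < q) linform B b (fun=> a) i w = \sum_l a l * psum B b l q w.
Proof.
rewrite /linform exchange_big/=; apply: eq_bigr => l _.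
by rewrite /psum mulr_sumr.
Qed.

Section cosine.
Variable th : 'I_m * 'I_p -> R.

Let be (k : 'I_m) : 'rV[R]_r := (\row_j th (k, j)) *m A.
Let sc (M : R) (k : 'I_m) : R := Num.sqrt M / (grid_index M k)%:R.
Let n (M : R) : nat := (\sum_(k < m) grid_index M k)%N.
Let c (M : R) (i : nat) (l : 'I_r) : R :=
  \sum_(k < m) (if (i < grid_index M k)%N then sc M k else 0) * be k 0 l.

Let len M (k : 'I_m) : (grid_index M k <= n M)%N.
Proof. by rewrite /n (bigD1 k)//= leq_addr. Qed.

Let Uvec_linform M w : \sum_kj th kj * Uvec M kj w =
  \sum_(0 <= i < n M) linform B b (c M) i w.
Proof.
have -> : \sum_kj th kj * Uvec M kj w = \sum_k \sum_j th (k, j) * Uvec M (k, j) w.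
  by rewrite pair_bigA; apply: eq_bigr => -[].
transitivity (\sum_(k < m) \sum_l be k 0 l * (sc M k * psum B b l (grid_index M k) w)).
  apply: eq_bigr => k _; under eq_bigr do rewrite UvecE/= mulrA mulr_sumr.
  rewrite exchange_big/=; apply: eq_bigr => l _.
  rewrite /be [X in _ = X * _]mxE mulr_suml; apply: eq_bigr => j _.
  by rewrite mxE /sc; ring.
rewrite /linform; under [RHS]eq_bigr do under eq_bigr do rewrite /c mulr_suml.
rewrite exchange_big/= [RHS]exchange_big/=; apply: eq_bigr => l _.
rewrite [RHS]exchange_big/=; apply: eq_bigr => k _.
rewrite /psum -(sum_if_lt (fun i => centered B b l i w) (len M k)) !mulr_sumr.
by apply: eq_bigr => i _; case: (ltnP i (grid_index M k)) => _; rewrite ?mul0r ?mulr0//; ring.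
Qed.

Let quad_c M : 0 < M -> \sum_(0 <= i < n M) quadform S (c M i) =
  \sum_(k < m) \sum_(k' < m) M / (grid_index M (minn k k'))%:R *
     Dform (A *m S *m A^T) th k k'.
Proof.
move=> M0.
transitivity (\sum_(0 <= i < n M) \sum_(k < m) \sum_(k' < m)
    (if (i < grid_index M k)%N then sc M k else 0) *
    (if (i < grid_index M k')%N then sc M k' else 0) * Dform (A *m S *m A^T) th k k').
  apply: eq_bigr => i _; rewrite /quadform bilinear_expand.
  apply: eq_bigr => k _; apply: eq_bigr => k' _; congr (_ * _).
  by rewrite /Dform /be trmx_mul !mulmxA.
rewrite exchange_big/=; apply: eq_bigr => k _.
rewrite exchange_big/=; apply: eq_bigr => k' _.
rewrite -mulr_suml; congr (_ * _).
have gmono k1 k2 : (k1 <= k2)%N -> (grid_index M k2 <= grid_index M k1)%N.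
  move=> kk; rewrite ltnS le_truncn// ler_pM2l// lef_pV2 ?posrE//.
  exact: nu.
have key (k1 k2 : 'I_m) : (k1 <= k2)%N ->
  \sum_(0 <= i < n M) (if (i < grid_index M k1)%N then sc M k1 else 0) *
   (if (i < grid_index M k2)%N then sc M k2 else 0) = M / (grid_index M k1)%:R.
  move=> kk; rewrite (eq_bigr (fun i => if (i < grid_index M k2)%N then sc M k1 * sc M k2 else 0)).
    rewrite sum_if_lt; last exact: len.
    rewrite sumr_const_nat subn0 -[_ *+ _]mulr_natr /sc mulrACA -expr2 sqr_sqrtr ?ltW//.
    by field; rewrite !pnatr_eq0.
  move=> i _; case: (ltnP i (grid_index M k2)) => i2; last by rewrite mulr0.
  by rewrite (leq_trans i2 (gmono _ _ kk)).
case: leqP => kk; first exact: key.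
under eq_bigr do rewrite mulrC; exact/key/ltnW.
Qed.

Let quad_lim : \sum_(k < m) \sum_(k' < m) M / (grid_index M (minn k k'))%:R *
     Dform (A *m S *m A^T) th k k' @[M --> +oo] -->
  \sum_(k < m) \sum_(k' < m) u (minn k k').+1 * Dform (A *m S *m A^T) th k k'.
Proof.
apply: cvg_big => [|k _]; first exact: add_continuous.
apply: cvg_big => [|k' _]; first exact: add_continuous.
apply: cvgMr_tmp.
exact: ratio_grid_index_cvg.
Qed.

(** The values at several times are linear forms in the sample with weights constant
    on blocks. As two averages share the vectors up to the smaller time, their
    covariance is [M] divided by the larger time, hence nearly the smaller of the two
    points of the grid. *)
Lemma expect_cos_Uvec_cvg a :
  expect P (fun w => cos (\sum_kj th kj * Uvec M kj w + a)) @[M --> +oo] -->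
  cos a * expR (- ((\sum_(k < m) \sum_(k' < m)
     u (minn k k').+1 * Dform (A *m S *m A^T) th k k') / 2)).
Proof.
have lim2 : cos a * expR (- ((\sum_(0 <= i < n M) quadform S (c M i)) / 2)) @[M --> +oo] -->
  cos a * expR (- ((\sum_(k < m) \sum_(k' < m)
     u (minn k k').+1 * Dform (A *m S *m A^T) th k k') / 2)).
  apply: cvgMl_tmp; apply: (cvg_comp _ expR); last exact: continuous_expR.
  apply: cvgN; apply: cvgMr_tmp.
  apply: cvg_trans quad_lim; apply: near_eq_cvg; near=> M.
  by rewrite quad_c//; near: M; exact: nbhs_pinfty_gt.
apply/cvgrPdist_le => e e0.
have e20 : 0 < e / 2 by rewrite divr_gt0.
pose K := \sum_(k < m) \sum_l u k.+1 * `|be k 0 l|.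
pose L := \sum_(k < m) (1 / u k.+1 + 1).
have K0 : 0 <= K.
  by apply: sumr_ge0 => k _; apply: sumr_ge0 => l _; rewrite mulr_ge0// ltW.
have L0 : 0 <= L.
  by apply: sumr_ge0 => k _; rewrite addr_ge0// divr_ge0// ltW.
have [M0 M00 clt] := linform_clt Biid Bm K0 L0 e20.
have /cvgrPdist_le/(_ (e / 2) e20) lim3 := lim2.
near=> M.
have MM0 : M0 <= M by near: M; apply: nbhs_pinfty_ge; exact: num_real.
have M1 : 1 <= M by near: M; apply: nbhs_pinfty_ge; exact: num_real.
have M_0 : 0 < M by rewrite (lt_le_trans _ M1).
have sM0 : 0 < Num.sqrt M by rewrite sqrtr_gt0.
have nL : (n M)%:R <= L * M.
  rewrite /n natr_sum mulr_suml; apply: ler_sum => k _.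
  apply: (le_trans (grid_index_le k (ltW M_0))).
  have -> : (1 / u k.+1 + 1) * M = M / u k.+1 + M by field; rewrite gt_eqF.
  by rewrite lerD2l.
have cK i l : `|c M i l| <= K / Num.sqrt M.
  apply: (le_trans (ler_norm_sum _ _ _)); rewrite /K mulr_suml.
  apply: ler_sum => k _; rewrite (bigD1 l)//= mulrDl.
  rewrite -[leLHS]addr0; apply: lerD; last first.
    rewrite divr_ge0 ?(ltW sM0)//; apply: sumr_ge0 => l' _; by rewrite mulr_ge0// ltW.
  rewrite normrM mulrAC ler_wpM2r//.
  apply: (@le_trans _ _ (sc M k)).
    by case: ifP => _; rewrite ?normr0 ?ger0_norm// divr_ge0// ltW.
  rewrite ler_pdivlMr// /sc mulrAC -expr2 sqr_sqrtr ?(ltW M_0)//.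
  exact: ratio_grid_index_le.
have h1 := clt M MM0 (n M) (c M) a nL cK.
have h2 : `|cos a * expR (- ((\sum_(k < m) \sum_(k' < m)
     u (minn k k').+1 * Dform (A *m S *m A^T) th k k') / 2)) -
   cos a * expR (- ((\sum_(0 <= i < n M) quadform S (c M i)) / 2))| <= e / 2.
  by near: M.
under [X in expect P X]eq_fun do rewrite Uvec_linform.
move: h1 h2; rewrite !ler_norml => /andP[? ?] /andP[? ?]; apply/andP; split; lra.
Unshelve. all: by end_near. Qed.

End cosine.

(** By Chebyshev's inequality. *)
Lemma tight_Uvec (e : R) : 0 < e -> exists2 rho : R, 0 <= rho &
  \forall M \near +oo, forall kj, pr P [set w | rho <= `|Uvec M kj w|] <= e.
Proof.
move=> e0; pose q (j : 'I_p) := quadform S (A j).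
have q0 j : 0 <= q j.
  have [i2 e2] := linform_sqr Bm (fun=> A j) 0.
  by rewrite /q /quadform -e2; apply: expect_ge0 => w; exact: sqr_ge0.
pose C := \sum_(k < m) \sum_j u k.+1 * q j.
have C0 : 0 <= C.
  by apply: sumr_ge0 => k _; apply: sumr_ge0 => j _; rewrite mulr_ge0// ltW.
have rho1 : 1 <= 1 + C / e by rewrite lerDl divr_ge0// ltW.
exists (1 + C / e); first exact: le_trans rho1.
near=> M => -[k j].
have M0 : 0 < M by near: M; exact: nbhs_pinfty_gt.
have sM0 : 0 < Num.sqrt M by rewrite sqrtr_gt0.
set rho := 1 + C / e in rho1 *.
have r0 : 0 < rho by rewrite (lt_le_trans _ rho1).
set N := grid_index M k.
have N0 : 0 < N%:R :> R by rewrite ltr0n.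
have [Fm FI FT ind] := sample_systemP Biid.
have [l1 l2] := linformE Bm (fun=> A j).
have h := @pr_partial_sum_ge _ _ _ P _ _ Fm FI FT ind (linform_adapted B b (fun=> A j))
  (q j) l1 (fun i => (linform_sqr Bm _ i).1) l2 _ (rho * N%:R / Num.sqrt M) 0 N.
have cpos : 0 < rho * N%:R / Num.sqrt M by rewrite divr_gt0// mulr_gt0.
rewrite (_ : [set w | _] = [set w | rho * N%:R / Num.sqrt M <=
    `|\sum_(0 <= i < N) linform B b (fun=> A j) i w|]); last first.
  have cs : 0 < Num.sqrt M / N%:R by rewrite divr_gt0.
  have e2 : rho * N%:R / Num.sqrt M = (Num.sqrt M / N%:R)^-1 * rho.
    by field; rewrite !gt_eqF.
  by apply/seteqP; split => w /=;
    rewrite UvecE/= linform_psum normrM (gtr0_norm cs) e2 ler_pdivrMl.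
apply: (le_trans (h _ cpos)); first by move=> i; rewrite (linform_sqr Bm _ i).2.
rewrite subn0.
have -> : N%:R * q j / (rho * N%:R / Num.sqrt M) ^+ 2 = (M / N%:R * q j) / rho ^+ 2.
  by rewrite expr_div_n sqr_sqrtr ?(ltW M0)//; field; rewrite !gt_eqF.
rewrite ler_pdivrMr ?exprn_gt0//.
apply: (@le_trans _ _ C).
  apply: (@le_trans _ _ (u k.+1 * q j)).
    by rewrite ler_wpM2r// ratio_grid_index_le.
  rewrite /C (bigD1 k)//= (bigD1 j)//= -!addrA lerDl addr_ge0//.
    by apply: sumr_ge0 => j' _; rewrite mulr_ge0// ltW.
  by apply: sumr_ge0 => k' _; apply: sumr_ge0 => j' _; rewrite mulr_ge0// ltW.
rewrite mulrC -ler_pdivrMr//; apply: (@le_trans _ _ rho); first by rewrite lerDr.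
by rewrite ler_eXnr.
Unshelve. all: by end_near. Qed.

End scaled_sums.

(** * Total differentiability *)

Section total_differentiability.
Context {R : realType} {r : nat}.
Implicit Types (f : 'cV[R]_r -> R) (x y b : 'cV[R]_r).

Lemma is_derive_line f x (l : 'I_r) (t : R) :
  derivable f (x + t *: delta_mx l 0) (delta_mx l 0) ->
  is_derive t 1 (fun s : R => f (x + s *: delta_mx l 0))
    (partial f l (x + t *: delta_mx l 0)).
Proof.
have e : (fun h : R => h^-1 *: (f (x + (h *: 1 + t) *: delta_mx l 0) -
      f (x + t *: delta_mx l 0))) =
    (fun h : R => h^-1 *: (f (h *: delta_mx l 0 + (x + t *: delta_mx l 0)) -
      f (x + t *: delta_mx l 0))).
  apply/funext => h; congr (_ *: (f _ - _)).
  have -> : h *: (1 : R) = h by rewrite /GRing.scale/= mulr1.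
  by rewrite scalerDl addrCA.
move=> df; apply: DeriveDef.
  by rewrite /derivable /= e; exact: df.
by rewrite /partial /derive /= e.
Qed.

Lemma mean_value_line f x (l : 'I_r) (s : R) :
  (forall t : R, `|t| <= `|s| -> derivable f (x + t *: delta_mx l 0) (delta_mx l 0)) ->
  exists2 t, `|t| <= `|s| &
  f (x + s *: delta_mx l 0) - f x = partial f l (x + t *: delta_mx l 0) * s.
Proof.
move=> df; pose g (t : R) := f (x + t *: delta_mx l 0).
have g0 : g 0 = f x by rewrite /g scale0r addr0.
have dg (t : R) : `|t| <= `|s| -> is_derive t 1 g (partial f l (x + t *: delta_mx l 0)).
  by move=> ts; apply: is_derive_line; exact: df.
have cg (t : R) : `|t| <= `|s| -> {for t, continuous g}.
  move=> ts; apply: differentiable_continuous; apply/derivable1_diffP.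
  by have [] := dg t ts.
have [s0|s0] := leP 0 s.
- have b1 (t : R) : 0 <= t <= s -> `|t| <= `|s| by move=> /andP[t0 ts]; rewrite !ger0_norm.
  have [t| |t ts e] := @MVT_segment R g (fun t => partial f l (x + t *: delta_mx l 0)) 0 s s0.
  + by rewrite in_itv/= => /andP[t0 ts]; apply: dg; apply: b1; rewrite !ltW.
  + by apply: continuous_in_subspaceT => t; rewrite inE/= in_itv/= => /b1; exact: cg.
  + exists t; last by rewrite -[LHS]/(g s - f x) -g0 e subr0.
    by apply: b1; move: ts; rewrite in_itv.
- have b1 (t : R) : s <= t <= 0 -> `|t| <= `|s|.
    by move=> /andP[ts t0]; rewrite (ltr0_norm s0) ler0_norm// lerN2.
  have [t| |t ts e] := @MVT_segment R g (fun t => partial f l (x + t *: delta_mx l 0)) s 0 (ltW s0).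
  + by rewrite in_itv/= => /andP[t0 ts]; apply: dg; apply: b1; rewrite !ltW.
  + by apply: continuous_in_subspaceT => t; rewrite inE/= in_itv/= => /b1; exact: cg.
  + exists t; last first.
      by rewrite -[LHS]/(g s - f x) -g0 -[LHS]opprB e sub0r mulrN opprK.
    by apply: b1; move: ts; rewrite in_itv.
Qed.

(** Continuous partial derivatives give a total derivative: move from [b] to
    [x] one coordinate at a time *)
Lemma C1_near_differentiable f b (eta : R) : C1_near f b -> 0 < eta ->
  exists2 rho : R, 0 < rho & forall x, (forall l, `|x l 0 - b l 0| < rho) ->
  `|f x - f b - \sum_l partial f l b * (x l 0 - b l 0)| <=
    eta * \sum_l `|x l 0 - b l 0|.
Proof.
move=> hC eta0.
have /nbhs_ballP[rho /= rho0 hrho] : \forall x \near b, forall l : 'I_r,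
    derivable f x (delta_mx l 0) /\ `|partial f l b - partial f l x| <= eta.
  have hb := nbhs_singleton hC.
  have h2 : \forall x \near b, forall l : 'I_r, `|partial f l b - partial f l x| <= eta.
    apply: (@filter_forall 'cV[R]_r 'I_r (fun l => [set x | `|partial f l b - partial f l x| <= eta]) (nbhs b) (nbhs_filter b)) => l; have [_ cl] := hb l.
    by move/cvgrPdist_le : cl; apply.
  near=> x => l; split; last by have : forall l, `|partial f l b - partial f l x| <= eta by near: x.
  have : forall l : 'I_r, derivable f x (delta_mx l 0) /\ {for x, continuous (partial f l)}.
    by near: x.
  by move=> /(_ l)[].
exists rho => // x xb.
pose y (k : nat) : 'cV[R]_r := \col_l (if (l < k)%N then x l 0 else b l 0).
have y0 : y 0%N = b by apply/matrixP => i j; rewrite mxE (ord1 j).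
have yr : y r = x by apply/matrixP => i j; rewrite mxE (ord1 j) ltn_ord.
have yS (l : 'I_r) : y l.+1 = y l + (x l 0 - b l 0) *: delta_mx l 0.
  apply/matrixP => i j; rewrite !mxE (ord1 j) eqxx andbT ltnS leq_eqVlt.
  case: (eqVneq i l) => [->|il]; first by rewrite eqxx/= ltnn; ring.
  have -> : (i == l :> nat) = false by apply/negbTE.
  by rewrite /= mulr0 addr0.
have step (l : 'I_r) : `|f (y l.+1) - f (y l) - partial f l b * (x l 0 - b l 0)| <=
    eta * `|x l 0 - b l 0|.
  have inb (t : R) : `|t| <= `|x l 0 - b l 0| -> ball b rho (y l + t *: delta_mx l 0).
    move=> tl; split => // i j; rewrite /ball/= !mxE (ord1 j) eqxx andbT.
    case: (eqVneq i l) => [->|il].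
      by rewrite ltnn mulr1 opprD addrA subrr sub0r normrN (le_lt_trans tl).
    rewrite mulr0 addr0; case: ifP => _; last by rewrite subrr normr0.
    by rewrite distrC.
  have [|t tl] := @mean_value_line f (y l) l (x l 0 - b l 0).
    by move=> t /inb /hrho /(_ l)[].
  rewrite -yS => ->; rewrite -mulrBl normrM ler_wpM2r//.
  by have [_] := hrho _ (inb t tl) l; rewrite distrC.
have -> : f x - f b = \sum_(l < r) (f (y l.+1) - f (y l)).
  by rewrite -(big_mkord xpredT (fun k => f (y k.+1) - f (y k))) telescope_sumr// yr y0.
rewrite -sumrB mulr_sumr; apply: (le_trans (ler_norm_sum _ _ _)).
exact: ler_sum.
Unshelve. all: by end_near. Qed.

End total_differentiability.

(** * Deviations of the averages and the remainder *)

Section finite_unions.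
Context d (T : measurableType d) (R : realType) (P : probability T R).

Lemma measurable_exists (I : finType) (F : I -> set T) :
  (forall i, measurable (F i)) -> measurable [set w | exists i, F i w].
Proof.
move=> mF; rewrite (_ : [set w | _] = \bigcup_(i in [set: I]) F i).
  by apply: fin_bigcup_measurable.
by apply/seteqP; split => [w [i Fi]|w [i _ Fi]]; exists i.
Qed.

Lemma pr_exists (I : finType) (F : I -> set T) : (forall i, measurable (F i)) ->
  pr P [set w | exists i, F i w] <= \sum_i pr P (F i).
Proof.
move=> mF.
have mG (s : seq I) : measurable [set w | exists2 i, i \in s & F i w].
  rewrite (_ : [set w | _] = \bigcup_(i in [set` s]) F i).
    exact: fin_bigcup_measurable.
  by apply/seteqP; split => w [i ? ?]; exists i.
have H (s : seq I) : pr P [set w | exists2 i, i \in s & F i w] <= \sum_(i <- s) pr P (F i).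
  elim: s => [|i s IH].
    rewrite big_nil (_ : [set w | _] = set0) ?pr0//.
    by apply/seteqP; split => w // [].
  rewrite big_cons; apply: le_trans (_ : _ <= pr P (F i) + pr P [set w | exists2 i, i \in s & F i w]) _; last by rewrite lerD2l.
  apply: le_prU => // w [j]; rewrite inE => /predU1P[->|js] Fj; first by left.
  by right; exists j.
apply: le_trans (H (index_enum I)); apply: le_pr => //; first exact: measurable_exists.
by move=> w [i Fi]; exists i => //; rewrite mem_index_enum.
Qed.

Lemma measurable_exists_nat (D : set nat) (F : nat -> set T) :
  (forall i, measurable (F i)) -> measurable [set w | exists2 i, D i & F i w].
Proof.
move=> mF; rewrite (_ : [set w | _] = \bigcup_(i in D) F i); first exact: bigcup_measurable.
by apply/seteqP; split => w [i ? ?]; exists i.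
Qed.

Lemma measurable_ge (X : T -> R) (c : R) : measurable_fun setT X ->
  measurable [set w | c <= X w].
Proof.
move=> mX; rewrite -[X in measurable X]setTI.
rewrite [X in _ `&` X](_ : _ = X @^-1` `[c, +oo[); first exact: mX.
by apply/seteqP; split => w /=; rewrite in_itv/= andbT.
Qed.

End finite_unions.

Section deviations.
Context d (T : measurableType d) (R : realType) (P : probability T R).
Variables (r : nat) (B : nat -> T -> 'cV[R]_r) (b : 'cV[R]_r) (S : 'M[R]_r).
Hypothesis Biid : iid_vectors P B.
Hypothesis Bm : forall i, has_mean_cov P (B i) b S.

Lemma centered_adapted l i (A : set R) : measurable A ->
  sample_system B i (centered B b l i @^-1` A).
Proof.
move=> mA; have mf : measurable_fun setT ((fun x => x l 0 - b l 0) : borel_cV R r -> R).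
  by apply: measurable_funB => //; exact: measurable_coord.
exact: (preimage_system_comp (B i : T -> borel_cV R r) mf mA).
Qed.

Lemma variance_ge0 l : 0 <= S l l.
Proof.
have [_ <-] := centeredM Bm l l 0.
by apply: expect_ge0 => w; rewrite -expr2 sqr_ge0.
Qed.

Lemma centered_sqr l i : rint P (fun w => centered B b l i w ^+ 2) /\
  expect P (fun w => centered B b l i w ^+ 2) = S l l.
Proof.
have e : (fun w => centered B b l i w ^+ 2) =
  (fun w => centered B b l i w * centered B b l i w) by apply/funext => w; rewrite expr2.
by rewrite e; exact: (centeredM Bm l l i).
Qed.

Definition deviation (m : nat) (a : R) : set T :=
  [set w | exists2 n, (m <= n)%N & exists l, a * n%:R <= `|psum B b l n w|].

Lemma measurable_deviation m a : measurable (deviation m a).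
Proof.
apply: (@measurable_exists_nat _ _ [set n | (m <= n)%N]
  (fun n => [set w | exists l, a * n%:R <= `|psum B b l n w|])) => n.
apply: (measurable_exists (F := fun l => [set w | a * n%:R <= `|psum B b l n w|])) => l.
by apply: measurable_norm_ge; exact: (measurable_psum b Biid).
Qed.

(** The factor is the constant of [pr_tail_averages]. *)
Definition total_variance : R := 32 * \sum_l S l l.

Lemma total_variance_ge0 : 0 <= total_variance.
Proof. by rewrite mulr_ge0// sumr_ge0// => l _; exact: variance_ge0. Qed.

(** A union bound over the coordinates. *)
Lemma pr_deviation m a : 0 < a -> (0 < m)%N ->
  pr P (deviation m a) <= total_variance / (a ^+ 2 * m%:R).
Proof.
move=> a0 m0; have [Fm FI FT ind] := sample_systemP Biid.
pose E l := [set w | exists2 n, (m <= n)%N & a * n%:R <= `|psum B b l n w|].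
have mE l : measurable (E l).
  apply: (@measurable_exists_nat _ _ [set n | (m <= n)%N]
    (fun n => [set w | a * n%:R <= `|psum B b l n w|])) => n.
  by apply: measurable_norm_ge; exact: (measurable_psum b Biid).
apply: (@le_trans _ _ (pr P [set w | exists l, E l w])).
  apply: le_pr; [exact: measurable_deviation|exact: measurable_exists|].
  by move=> w [n mn [l h]]; exists l, n.
apply: (le_trans (pr_exists P mE)).
have -> : total_variance / (a ^+ 2 * m%:R) = \sum_l 32 * S l l / (a ^+ 2 * m%:R).
  by rewrite /total_variance mulr_sumr mulr_suml.
apply: ler_sum => l _.
apply: (pr_tail_averages Fm FI FT ind (centered_adapted l)) => //.
- by move=> i; exact: (rint_centered Bm).
- by move=> i; exact: (centered_sqr l i).1.
- by move=> i; exact: (expect_centered Bm).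
- by move=> i; rewrite (centered_sqr l i).2.
Qed.

End deviations.

Section remainder_bounds.
Context d (T : measurableType d) (R : realType) (P : probability T R).
Variables (p r : nat) (N : 'cV[R]_p -> R).
Hypothesis hN : distance_function N.
Variables (B : nat -> T -> 'cV[R]_r) (b : 'cV[R]_r) (S : 'M[R]_r).
Hypothesis Biid : iid_vectors P B.
Hypothesis Bm : forall i, has_mean_cov P (B i) b S.
Variable h : 'I_p -> 'cV[R]_r -> R.
Hypothesis hmeas : forall j, measurable_fun [set: borel_cV R r] (h j : borel_cV R r -> R).
Hypothesis hC1 : forall j, C1_near (h j) b.

Lemma measurable_average n l : measurable_fun setT (fun w => average B n w l 0).
Proof.
rewrite /average; under [X in measurable_fun _ X]eq_fun do rewrite mxE summxE.
apply: measurable_funM => //; apply: measurable_sum => i.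
exact: (measurable_sample_coord Biid).
Qed.

Lemma measurable_estimator n j : measurable_fun setT (fun w => estimator B h n w j 0).
Proof.
rewrite /estimator /apply_cV; under [X in measurable_fun _ X]eq_fun do rewrite mxE.
exact: (measurableT_comp (hmeas j) (measurable_cV (measurable_average n))).
Qed.

Lemma measurable_error n (c : 'cV[R]_p) :
  measurable_fun setT (fun w => N (estimator B h n w - c)).
Proof.
apply: (measurable_dist hN) => j.
under [X in measurable_fun _ X]eq_fun do rewrite !mxE.
apply: measurable_funB => //.
by have := measurable_estimator n j; under eq_fun do rewrite !mxE.
Qed.

Lemma measurable_remainder n : measurable_fun setT (fun w => N (remainder B h b n w)).
Proof.
apply: (measurable_dist hN) => j; rewrite /remainder.
rewrite (_ : (fun w => _) = (fun w => estimator B h n w j 0 - h j b -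
    \sum_l Jacobi h b j l * (average B n w l 0 - b l 0))); last first.
  by apply/funext => w; rewrite !mxE; congr (_ - _); apply: eq_bigr => l _; rewrite !mxE.
apply: measurable_funB; first by apply: measurable_funB => //; exact: measurable_estimator.
apply: measurable_sum => l; apply: measurable_funM => //; apply: measurable_funB => //.
exact: measurable_average.
Qed.

Definition remainder_event (m : nat) (dl : R) : set T :=
  [set w | exists2 n, (m <= n)%N & dl <= Num.sqrt m%:R * N (remainder B h b n w)].

Lemma measurable_remainder_event m dl : measurable (remainder_event m dl).
Proof.
apply: (@measurable_exists_nat _ _ [set n | (m <= n)%N]
  (fun n => [set w | dl <= Num.sqrt m%:R * N (remainder B h b n w)])) => n.
by apply: measurable_ge; apply: measurable_funM => //; exact: measurable_remainder.
Qed.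

Lemma remainder_le (eta : R) : 0 < eta ->
  exists2 rho : R, 0 < rho & forall n w, (0 < n)%N ->
    (forall l, `|psum B b l n w| < rho * n%:R) ->
    N (remainder B h b n w) <= eta * \sum_l `|psum B b l n w| / n%:R.
Proof.
move=> eta0; have [c c0 cP] := dist_bound hN.
pose e := eta / (c * p.+1%:R).
have e0 : 0 < e by rewrite divr_gt0// mulr_gt0.
have /fin_all_exists[rho rhoP] : forall j, exists rho : R, 0 < rho /\ forall (x : 'cV[R]_r),
    (forall l, `|x l 0 - b l 0| < rho) ->
  `|h j x - h j b - \sum_l partial (h j) l b * (x l 0 - b l 0)| <=
    e * \sum_l `|x l 0 - b l 0|.
  by move=> j; have [rho r0 H] := C1_near_differentiable (hC1 j) e0; exists rho.
pose rh := \big[Num.min/1]_j rho j.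
have rh0 : 0 < rh by apply: lt_bigmin => // j _; have [] := rhoP j.
exists rh => // n w n0 hw.
have nR : 0 < n%:R :> R by rewrite ltr0n.
have avg l : average B n w l 0 - b l 0 = psum B b l n w / n%:R.
  by rewrite -average_centered// !mxE.
have absavg l : `|average B n w l 0 - b l 0| = `|psum B b l n w| / n%:R.
  by rewrite avg normrM normfV (gtr0_norm nR).
apply: (le_trans (cP _)).
have -> : \sum_l `|psum B b l n w| / n%:R = \sum_l `|average B n w l 0 - b l 0|.
  by apply: eq_bigr => l _; rewrite absavg.
set s := \sum_l `|average B n w l 0 - b l 0|.
have s0 : 0 <= s by exact: sumr_ge0.
have comp j : `|remainder B h b n w j 0| <= e * s.
  have [_ H] := rhoP j.
  have cl l : `|average B n w l 0 - b l 0| < rho j.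
    rewrite absavg ltr_pdivrMr//; apply: (lt_le_trans (hw l)).
    by rewrite ler_wpM2r ?(ltW nR)// /rh; exact: bigmin_le.
  have -> : remainder B h b n w j 0 = h j (average B n w) - h j b -
      \sum_l partial (h j) l b * (average B n w l 0 - b l 0).
    rewrite /remainder /estimator /apply_cV !mxE; congr (_ - _).
    by apply: eq_bigr => l _; rewrite !mxE.
  exact: (H _ cl).
apply: (le_trans (ler_wpM2l (ltW c0) (ler_sum _ (fun j _ => comp j)))).
rewrite sumr_const card_ord -[_ *+ p]mulr_natr.
have -> : c * (e * s * p%:R) = eta * s * (p%:R / p.+1%:R).
  have : 0 < p.+1%:R :> R by rewrite ltr0n.
  by rewrite /e; set q : R := p.+1%:R => q0; field; rewrite !gt_eqF.
rewrite ler_piMr ?mulr_ge0 ?(ltW eta0)// ler_pdivrMr// mul1r ler_nat//.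
Qed.

(** The remainder is small because it is bounded by a small multiple of the
    deviation of the average, which is of order [m ^ (- 1 / 2)] after time [m] *)
Lemma remainder_small (dl e : R) : 0 < dl -> 0 < e ->
  exists2 m0 : nat, (0 < m0)%N &
  forall m, (m0 <= m)%N -> pr P (remainder_event m dl) <= e.
Proof.
move=> dl0 e0; pose C := total_variance S.
have C0 : 0 <= C := total_variance_ge0 Bm.
(* The deviation exceeds [a / sqrt m] with probability at most [C / a ^ 2], which is
   at most [e / 2]; below it, [eta] keeps the remainder under [dl / 2]. *)
pose a := 1 + 2 * C / e.
have t1 : 1 <= a by rewrite lerDl; apply: divr_ge0; [exact: mulr_ge0|exact: ltW].
have t0 : 0 < a by rewrite (lt_le_trans _ t1).
pose eta := dl / (2 * r.+1%:R * a).
have eta0 : 0 < eta by rewrite divr_gt0// !mulr_gt0.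
have [rho rho0 rhoP] := remainder_le eta0.
pose m0 := (Num.truncn (2 * C / (rho ^+ 2 * e))).+1.
exists m0 => // m mm.
have m_0 : (0 < m)%N by exact: leq_trans mm.
have mR : 0 < m%:R :> R by rewrite ltr0n.
have sm : 0 < Num.sqrt m%:R :> R by rewrite sqrtr_gt0.
have am : 0 < a / Num.sqrt m%:R by rewrite divr_gt0.
apply: (@le_trans _ _ (pr P (deviation B b m rho) + pr P (deviation B b m (a / Num.sqrt m%:R)))).
  apply: le_prU; [exact: measurable_remainder_event|exact: (measurable_deviation b Biid)..|].
  move=> w [n mn hn]; have n0 : (0 < n)%N by exact: leq_trans mn.
  have nR : 0 < n%:R :> R by rewrite ltr0n.
  have [?|nd] := pselect (deviation B b m rho w); [by left|right].
  apply: contrapT => nd2.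
  have h1 l : `|psum B b l n w| < rho * n%:R.
    by rewrite ltNge; apply/negP => h'; apply: nd; exists n => //; exists l.
  have h2 l : `|psum B b l n w| / n%:R <= a / Num.sqrt m%:R.
    rewrite ler_pdivrMr//; apply/ltW; rewrite ltNge; apply/negP => h'.
    by apply: nd2; exists n => //; exists l.
  have := rhoP n w n0 h1.
  move/(le_trans)/(_ (ler_wpM2l (ltW eta0) (ler_sum _ (fun l _ => h2 l)))).
  rewrite sumr_const card_ord -[_ *+ r]mulr_natr => h3.
  have := le_trans hn (ler_wpM2l (ltW sm) h3).
  have -> : Num.sqrt m%:R * (eta * (a / Num.sqrt m%:R * r%:R)) =
      dl / 2 * (r%:R / r.+1%:R).
    have : 0 < r.+1%:R :> R by rewrite ltr0n.
    by rewrite /eta; set q : R := r.+1%:R => q0; field; rewrite !gt_eqF.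
  apply/negP; rewrite -ltNge; apply: (@le_lt_trans _ _ (dl / 2)).
    by rewrite ler_piMr ?divr_ge0 ?(ltW dl0)// ler_pdivrMr// mul1r ler_nat.
  by rewrite ltr_pdivrMr// ltr_pMr// ltr1n.
have h1 := pr_deviation Biid Bm rho0 m_0.
have h2 := pr_deviation Biid Bm am m_0.
have k1 : C / (rho ^+ 2 * m%:R) <= e / 2.
  have c1 : 2 * C / (rho ^+ 2 * e) <= m%:R.
    by apply: (le_trans (ltW (truncnS_gt _))); rewrite ler_nat.
  rewrite ler_pdivrMr ?mulr_gt0 ?exprn_gt0// in c1.
  rewrite ler_pdivrMr ?mulr_gt0 ?exprn_gt0//; lra.
have k2 : C / ((a / Num.sqrt m%:R) ^+ 2 * m%:R) <= e / 2.
  rewrite expr_div_n sqr_sqrtr ?ler0n// divfK ?gt_eqF//.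
  rewrite ler_pdivrMr ?exprn_gt0//.
  apply: (@le_trans _ _ (e / 2 * a)).
    by rewrite /a mulrDr mulr1 -[leLHS]add0r lerD ?divr_ge0 ?(ltW e0)//
      le_eqVlt; apply/orP; left; apply/eqP; field; rewrite gt_eqF.
  by rewrite ler_wpM2l ?divr_ge0 ?(ltW e0)// ler_eXnr.
rewrite [e]splitr; apply: lerD; [exact: le_trans h1 k1|exact: le_trans h2 k2].
Qed.

End remainder_bounds.

(** * Oscillation over one step *)

Section shifted_systems.
Context d (T : measurableType d) (R : realType) (P : probability T R).

Lemma independent_shift (F : nat -> set (set T)) a :
  independent_systems P F -> independent_systems P (fun i => F (i + a)%N).
Proof.
move=> ind s A us FA.
have us' : uniq (map (addn^~ a) s) by rewrite map_inj_uniq//; exact: addIn.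
have := ind _ (fun i => A (i - a)%N) us'.
rewrite big_map; under eq_bigr do rewrite addnK.
move=> <-; last by move=> i /mapP[j js ->]; rewrite addnK; exact: FA.
congr (P _); apply/seteqP; split => w /= h i; first by move=> /mapP[j js ->]; rewrite addnK; exact: h.
by move=> si; have := h (i + a)%N; rewrite addnK; apply; exact: (map_f (addn^~ a)).
Qed.

End shifted_systems.

Section block_oscillation.
Context d (T : measurableType d) (R : realType) (P : probability T R).
Variables (r : nat) (B : nat -> T -> 'cV[R]_r) (b : 'cV[R]_r) (S : 'M[R]_r).
Hypothesis Biid : iid_vectors P B.
Hypothesis Bm : forall i, has_mean_cov P (B i) b S.

Local Notation D l n0 n1 := (fun w => \sum_(n0 <= i < n1) centered B b l i w).

Lemma measurable_block l n0 n1 : measurable_fun setT (D l n0 n1).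
Proof. by apply: measurable_sum => i; exact: (measurable_centered b Biid). Qed.

Lemma pr_block_ge l (c : R) n0 n1 : 0 < c ->
  pr P [set w | c <= `|D l n0 n1 w|] <= (n1 - n0)%:R * S l l / c ^+ 2.
Proof.
move=> c0; have [Fm FI FT ind] := sample_systemP Biid.
apply: (pr_partial_sum_ge Fm FI FT ind (centered_adapted B b l)) => //.
- by move=> i; exact: (rint_centered Bm).
- by move=> i; exact: (centered_sqr Bm l i).1.
- by move=> i; exact: (expect_centered Bm).
- by move=> i; rewrite (centered_sqr Bm l i).2.
Qed.

(** [ottaviani] applied to the sample from time [n0] on. *)
Lemma pr_block_max l (c : R) n0 n1 : (n0 <= n1)%N -> 0 < c ->
  (n1 - n0)%:R * S l l / c ^+ 2 <= 1 / 2 ->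
  pr P [set w | exists k : 'I_(n1 - n0).+1, 2 * c <= `|D l n0 (n0 + k) w|] <=
  2 * pr P [set w | c <= `|D l n0 n1 w|].
Proof.
move=> n01 c0 small; have [Fm FI FT ind] := sample_systemP Biid.
set n := (n1 - n0)%N in small *.
have sh k1 k2 w : \sum_(k1 <= i < k2) centered B b l (i + n0) w = D l (k1 + n0) (k2 + n0) w.
  by rewrite big_addn addnK.
have n1E : n1 = (n + n0)%N by rewrite /n subnK.
have := @ottaviani _ _ _ P (fun i => sample_system B (i + n0)) (fun i => centered B b l (i + n0))
  (fun i => Fm (i + n0)%N) (fun i => FI (i + n0)%N) (fun i => FT (i + n0)%N)
  (@independent_shift _ _ _ P _ n0 ind) (fun i A mA => centered_adapted B b l (i + n0) mA) c n c0.
have e k1 k2 a : [set w | a <= `|\sum_(k1 <= i < k2) centered B b l (i + n0) w|] =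
    [set w | a <= `|D l (k1 + n0) (k2 + n0) w|].
  by apply/seteqP; split => w /=; rewrite sh.
rewrite n1E e add0n => H; apply: le_trans (H _).
  apply: le_pr.
  - apply: measurable_exists => k; apply: measurable_norm_ge; exact: measurable_block.
  - apply: bigsetU_measurable => k _; rewrite e; apply: measurable_norm_ge; exact: measurable_block.
  move=> w [k hk]; apply/(@mem_bigsetU _ _ (fun k =>
    [set w | 2 * c <= `|\sum_(0 <= i < k) centered B b l (i + n0) w|])).
  by exists k => //=; rewrite sh add0n addnC.
move=> k kn; rewrite e; apply: (le_trans (pr_block_ge _ _ _ c0)).
apply: le_trans small; rewrite ler_wpM2r ?invr_ge0 ?sqr_ge0//.
by rewrite ler_wpM2r ?(variance_ge0 Bm)// ler_nat subnDr leq_subr.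
Qed.

Lemma one_sub_cos_ge (x : R) : `|x| <= 1 / 2 -> x ^+ 2 / 4 <= 1 - cos x.
Proof.
move=> x2; have := norm_cos_taylor4 x; rewrite ler_norml => /andP[_].
have -> : `|x| ^+ 4 = (x ^+ 2) * (x ^+ 2) by rewrite -(real_normK (num_real x)); ring.
have : x ^+ 2 <= 1 / 4.
  rewrite -(real_normK (num_real x)); have := normr_ge0 x; nra.
have := sqr_ge0 x; set y := x ^+ 2; nra.
Qed.

Lemma cos_block_cvg (K L e : R) : 0 <= K -> 0 <= L -> 0 < e ->
  exists2 M0 : R, 0 < M0 & forall M : R, M0 <= M ->
  forall l n0 n1 (t : R), (n0 <= n1)%N -> n1%:R <= L * M -> 0 <= t <= K ->
  `|expect P (fun w => cos (t / Num.sqrt M * D l n0 n1 w)) -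
    expR (- (t ^+ 2 * ((n1 - n0)%:R / M * S l l) / 2))| <= e.
Proof.
move=> K0 L0 e0; have [M0 M00 H] := linform_clt Biid Bm K0 L0 e0.
exists M0 => // M MM l n0 n1 t n01 n1L /andP[t0 tK].
have M_0 : 0 < M by rewrite (lt_le_trans M00).
have sM : 0 < Num.sqrt M by rewrite sqrtr_gt0.
pose a := t / Num.sqrt M.
have a0 : 0 <= a by rewrite divr_ge0// ltW.
pose c (i : nat) (l' : 'I_r) : R := if (n0 <= i)%N && (l' == l) then a else 0.
have cE i : c i l = if (n0 <= i)%N then a else 0 by rewrite /c eqxx andbT.
have c0 i l' : l' != l -> c i l' = 0 by rewrite /c => /negbTE ->; rewrite andbF.
have cK i l' : `|c i l'| <= K / Num.sqrt M.
  rewrite /c; case: ifP => _; last by rewrite normr0 divr_ge0// ltW.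
  by rewrite ger0_norm// ler_wpM2r// invr_ge0 ltW.
have h := H M MM n1 c 0 n1L cK.
have split2 (f : nat -> R) : \sum_(0 <= i < n1) (if (n0 <= i)%N then f i else 0) =
    \sum_(n0 <= i < n1) f i.
  rewrite (big_cat_nat (n := n0))//= big_nat big1 ?add0r; last first.
    by move=> i /andP[_ i0]; rewrite leqNgt i0.
  by apply: eq_big_nat => i /andP[-> _].
have e1 w : \sum_(0 <= i < n1) linform B b c i w + 0 = a * D l n0 n1 w.
  rewrite addr0 mulr_sumr -split2; apply: eq_bigr => i _.
  rewrite /linform (bigD1 l)//= big1 ?addr0.
    by rewrite cE; case: ifP => _; rewrite ?mul0r.
  by move=> l' /(c0 i) ->; rewrite mul0r.
have e2 : \sum_(0 <= i < n1) quadform S (c i) = t ^+ 2 * ((n1 - n0)%:R / M * S l l).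
  transitivity (\sum_(0 <= i < n1) if (n0 <= i)%N then a ^+ 2 * S l l else 0).
    apply: eq_bigr => i _; rewrite /quadform (bigD1 l)//= [X in _ + X]big1 ?addr0.
      rewrite (bigD1 l)//= [X in _ + X]big1 ?addr0.
        by rewrite !cE; case: ifP => _; rewrite ?mul0r// expr2.
      by move=> l' /(c0 i) ->; rewrite mulr0 mul0r.
    by move=> l' /(c0 i) ->; rewrite big1// => k _; rewrite !mul0r.
  rewrite split2 sumr_const_nat -[_ *+ _]mulr_natr /a expr_div_n sqr_sqrtr ?(ltW M_0)//.
  by field; rewrite gt_eqF.
under [X in expect P X]eq_fun do rewrite -e1.
by move: h; rewrite e2 cos0 mul1r.
Qed.

(** Chebyshev's inequality would give a bound of order [1 / q]; the fourth
    moment of the limit law of the block, reached through [(1 - cos) ^ 2], gives [1 / q ^ 2] *)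
Lemma pr_block_small (L c : R) (q : nat) : 0 <= L -> 0 < c -> (0 < q)%N ->
  exists2 M0 : R, 0 < M0 & forall M : R, M0 <= M ->
  forall l n0 n1, (n0 <= n1)%N -> n1%:R <= L * M -> (n1 - n0)%:R <= 2 * M / q%:R ->
  pr P [set w | c * Num.sqrt M <= `|D l n0 n1 w|] <=
  (128 * S l l ^+ 2 / c ^+ 4 + 8 * S l l + 1) / q%:R ^+ 2.
Proof.
move=> L0 c0 q0; have qR : 0 < q%:R :> R by rewrite ltr0n.
set Q : R := q%:R in qR *.
pose e := c ^+ 4 / (48 * Q ^+ 4).
have e0 : 0 < e by rewrite divr_gt0 ?mulr_gt0 ?exprn_gt0.
(* The variance of [t] times the block is of order [1 / q ^ 2], and so is the
   probability that this variable exceeds 1 / 2. *)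
pose t := (Num.sqrt Q)^-1.
have sQ : 0 < Num.sqrt Q by rewrite sqrtr_gt0.
have t0 : 0 < t by rewrite invr_gt0.
have t2 : t ^+ 2 = Q^-1 by rewrite exprVn sqr_sqrtr ?ltW.
have K0 : 0 <= 2 * t by rewrite mulr_ge0// ltW.
have [M0 M00 H] := cos_block_cvg K0 L0 e0.
exists M0 => // M MM l n0 n1 n01 n1L nn.
have M_0 : 0 < M by rewrite (lt_le_trans M00).
have sM : 0 < Num.sqrt M by rewrite sqrtr_gt0.
set s := S l l; have s0 : 0 <= s by exact: (variance_ge0 Bm).
pose v := (n1 - n0)%:R / M * s.
have v0 : 0 <= v by rewrite mulr_ge0// divr_ge0// ltW.
have vQ : v <= 2 * s / Q.
  have -> : 2 * s / Q = 2 / Q * s by ring.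
  rewrite /v ler_wpM2r// ler_pdivrMr//; apply: (le_trans nn).
  by rewrite le_eqVlt; apply/orP; left; apply/eqP; ring.
pose Z w := t / Num.sqrt M * D l n0 n1 w.
have mZ : measurable_fun setT Z by apply: measurable_funM => //; exact: measurable_block.
have h1 : `|expect P (fun w => cos (Z w)) - expR (- (t ^+ 2 * v / 2))| <= e.
  by apply: H => //; rewrite (ltW t0)/=; move: t0; lra.
have h2 : `|expect P (fun w => cos (2 * Z w)) - expR (- ((2 * t) ^+ 2 * v / 2))| <= e.
  have := H M MM l n0 n1 (2 * t) n01 n1L; rewrite K0 lexx => /(_ isT).
  congr (`|expect P _ - _| <= e); apply/funext => w; rewrite /Z; congr cos; ring.
have mcos (a : R) : measurable_fun setT (fun w => cos (a * Z w)).
  have := measurable_contD 0 (@continuous_cos R) (measurable_funM (measurable_cst a) mZ).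
  by under eq_fun do rewrite addr0.
have rcos (a : R) : rint P (fun w => cos (a * Z w)).
  by apply: (@rint_bounded _ _ _ _ _ 1) => // w; rewrite ler_norml cos_geN1 cos_le1.
have rcos1 : rint P (fun w => cos (Z w)).
  by have := rcos 1; under eq_fun do rewrite mul1r.
(* In the expectation of [3 / 2 - 2 * cos Z + 1 / 2 * cos (2 * Z)] the terms of
   order 0 and 1 in the variance cancel. *)
pose f w := (1 - cos (Z w)) ^+ 2.
have fE : f = (fun w => (3 / 2 - 2 * cos (Z w)) + 1 / 2 * cos (2 * Z w)).
  apply/funext => w; rewrite /f (_ : 2 * Z w = Z w + Z w); last by ring.
  by rewrite cosD; have := cos2Dsin2 (Z w); set x := cos _; set y := sin _; rewrite !expr2; lra.
have rf : rint P f.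
  rewrite fE; apply: rintD; last exact: rintZ.
  by apply: rintB; [exact: rint_cst|exact: rintZ].
pose x := t ^+ 2 * v / 2.
have xE : x = v / (2 * Q) by rewrite /x t2; field; rewrite gt_eqF.
have x0 : 0 <= x by rewrite xE divr_ge0// mulr_ge0// ltW.
have xs : x <= s / Q ^+ 2.
  rewrite xE ler_pdivrMr ?mulr_gt0//; apply: (le_trans vQ).
  by rewrite le_eqVlt; apply/orP; left; apply/eqP; field; rewrite gt_eqF.
have Ef : expect P f <= 8 * (s / Q ^+ 2) ^+ 2 + 3 * e.
  have x4 : (2 * t) ^+ 2 * v / 2 = 4 * x by rewrite /x; ring.
  have -> : expect P f = 3 / 2 - 2 * expect P (fun w => cos (Z w)) +
      1 / 2 * expect P (fun w => cos (2 * Z w)).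
    rewrite fE expectD; last exact: rintZ.
    - rewrite expectB; [|exact: rint_cst|exact: rintZ].
      by rewrite expect_cst !expectZ//.
    - by apply: rintB; [exact: rint_cst|exact: rintZ].
  have e1 := expR_ge1Dx (- x); have e2 := @expRN_error _ (4 * x) (mulr_ge0 (ler0n _ 4) x0).
  rewrite x4 in h2; rewrite -/x in h1.
  have xx : x ^+ 2 <= (s / Q ^+ 2) ^+ 2 by rewrite lerXn2r ?nnegrE//; exact: le_trans x0 xs.
  move: h1 h2 e2; rewrite !ler_norml => /andP[? ?] /andP[? ?] /andP[? ?].
  have : (4 * x) ^+ 2 = 16 * x ^+ 2 by ring.
  lra.
apply: (@le_trans _ _ (pr P [set w | (2 * t)^-1 * Num.sqrt M <= `|D l n0 n1 w|] +
   pr P [set w | (t * c) ^+ 4 / 16 <= f w])).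
  apply: le_prU; [exact: (measurable_norm_ge _ (measurable_block _ _ _))..| |].
    by apply: measurable_ge; exact: rint_measurable rf.
  move=> w /= hw.
  have Zw : `|Z w| = t / Num.sqrt M * `|D l n0 n1 w|.
    by rewrite normrM ger0_norm// divr_ge0// ltW.
  have [Z2|Z2] := leP `|Z w| (1 / 2); [right|left]; last first.
    move: Z2; rewrite Zw => /ltW /(ler_wpM2l (ltW (divr_gt0 sM t0))).
    have -> : Num.sqrt M / t * (1 / 2) = (2 * t)^-1 * Num.sqrt M by field; rewrite gt_eqF.
    have -> // : Num.sqrt M / t * (t / Num.sqrt M * `|D l n0 n1 w|) = `|D l n0 n1 w|.
    by field; rewrite !gt_eqF.
  have tcZ : t * c <= `|Z w|.
    rewrite Zw; apply: le_trans (ler_wpM2l (ltW (divr_gt0 t0 sM)) hw).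
    by rewrite le_eqVlt; apply/orP; left; apply/eqP; field; rewrite gt_eqF.
  have := one_sub_cos_ge Z2; rewrite /= /f => h.
  have -> : (t * c) ^+ 4 / 16 = ((t * c) ^+ 2 / 4) ^+ 2 by field.
  have tc0 : 0 <= (t * c) ^+ 2 / 4 by rewrite divr_ge0// sqr_ge0.
  have tc1 : (t * c) ^+ 2 / 4 <= 1 - cos (Z w).
    apply: le_trans h; rewrite ler_wpM2r//.
    by rewrite -(real_normK (num_real (Z w))) lerXn2r// nnegrE mulr_ge0// ltW.
  by rewrite lerXn2r ?nnegrE//; exact: le_trans tc0 tc1.
have -> : (128 * s ^+ 2 / c ^+ 4 + 8 * s + 1) / Q ^+ 2 =
   8 * s / Q ^+ 2 + (8 * (s / Q ^+ 2) ^+ 2 + 3 * e) / ((t * c) ^+ 4 / 16).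
  have -> : (t * c) ^+ 4 = c ^+ 4 / Q ^+ 2.
    by rewrite exprMn -[4%N]/(2 * 2)%N exprM t2 exprVn mulrC.
  by rewrite /e; field; rewrite !gt_eqF.
apply: lerD.
  apply: (le_trans (pr_block_ge _ _ _ _)); first by rewrite mulr_gt0// invr_gt0 mulr_gt0.
  have -> : (n1 - n0)%:R * S l l / ((2 * t)^-1 * Num.sqrt M) ^+ 2 = 4 * t ^+ 2 * v.
    rewrite exprMn sqr_sqrtr ?(ltW M_0)// /v -/s; field.
    by rewrite !gt_eqF.
  rewrite t2; apply: (le_trans (ler_wpM2l _ vQ)).
    by rewrite mulr_ge0// invr_ge0 ltW.
  by rewrite le_eqVlt; apply/orP; left; apply/eqP; field; rewrite gt_eqF.
have tc4 : 0 < (t * c) ^+ 4 / 16 by rewrite divr_gt0// exprn_gt0// mulr_gt0.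
apply: (le_trans (markov_pr _ rf _ tc4 _)).
- by apply: measurable_ge; exact: rint_measurable rf.
- by move=> w; exact: sqr_ge0.
- by [].
- by rewrite ler_wpM2r// invr_ge0 ltW.
Qed.

End block_oscillation.

(** * Oscillation over a grid *)

Section oscillation.
Context d (T : measurableType d) (R : realType) (P : probability T R).
Variables (r : nat) (B : nat -> T -> 'cV[R]_r) (b : 'cV[R]_r) (S : 'M[R]_r).
Hypothesis Biid : iid_vectors P B.
Hypothesis Bm : forall i, has_mean_cov P (B i) b S.

(** The first time after [M * t], for the times [t = 1 + i / q] at distance [1 / q]. *)
Definition step_index (M : R) (q i : nat) : nat := (Num.truncn (M * (1 + i%:R / q%:R))).+1.

Lemma step_index_gt M q i : M * (1 + i%:R / q%:R) < (step_index M q i)%:R.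
Proof. exact: truncnS_gt. Qed.

Lemma step_index_le M q i : 0 <= M -> (step_index M q i)%:R <= M * (1 + i%:R / q%:R) + 1.
Proof.
move=> M0; rewrite /step_index -natr1 lerD2r -truncn_ge_nat//.
by rewrite mulr_ge0// addr_ge0// divr_ge0.
Qed.

Lemma step_index_mono M q i j : 0 <= M -> (i <= j)%N -> (step_index M q i <= step_index M q j)%N.
Proof.
move=> M0 ij; rewrite ltnS le_truncn// ler_wpM2l// lerD2l ler_wpM2r ?invr_ge0//.
by rewrite ler_nat.
Qed.

Lemma step_indexB M q i : 0 <= M -> q%:R <= M -> (0 < q)%N ->
  (step_index M q i.+1 - step_index M q i)%:R <= 2 * M / q%:R.
Proof.
move=> M0 qM q0; have qR : 0 < q%:R :> R by rewrite ltr0n.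
rewrite natrB ?step_index_mono//.
have h1 := ltW (step_index_gt M q i); have h2 := step_index_le q i.+1 M0.
apply: (le_trans (lerB h2 h1)).
rewrite -[i.+1%:R]natr1 ler_pdivlMr//.
have -> : (M * (1 + (i%:R + 1) / q%:R) + 1 - M * (1 + i%:R / q%:R)) * q%:R = M + q%:R.
  by field; rewrite gt_eqF.
by move: qM; lra.
Qed.

(** The oscillation within a step is measured from the beginning of the step. *)
Definition oscillation (M : R) (q m : nat) (a : R) : set T :=
  [set w | exists i : 'I_m, exists l : 'I_r,
     exists k : 'I_(step_index M q i.+1 - step_index M q i).+1,
     a * Num.sqrt M <=
       `|\sum_(step_index M q i <= j < step_index M q i + k) centered B b l j w|].

Let measurable_osc_block M q i l a : measurable [set w |
     exists k : 'I_(step_index M q i.+1 - step_index M q i).+1,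
     a * Num.sqrt M <=
       `|\sum_(step_index M q i <= j < step_index M q i + k) centered B b l j w|].
Proof.
apply: measurable_exists => k; apply: measurable_norm_ge; exact: (measurable_block b Biid).
Qed.

Lemma measurable_oscillation M q m a : measurable (oscillation M q m a).
Proof.
by apply: measurable_exists => i; apply: measurable_exists => l; exact: measurable_osc_block.
Qed.

(** There are [L * q] steps, each oscillating with a probability of order
    [1 / q ^ 2]. *)
Lemma oscillation_small (a e : R) (L : nat) : 0 < a -> 0 < e ->
  exists2 q0 : nat, (0 < q0)%N & forall q, (q0 <= q)%N -> exists2 M0 : R, 0 < M0 &
  forall M : R, M0 <= M -> pr P (oscillation M q (L * q) a) <= e.
Proof.
move=> a0 e0; pose c := a / 2; have c0 : 0 < c by rewrite divr_gt0.
pose K l := 128 * S l l ^+ 2 / c ^+ 4 + 8 * S l l + 1.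
have K0 l : 0 <= K l.
  by rewrite addr_ge0// addr_ge0// ?mulr_ge0 ?invr_ge0 ?exprn_ge0 ?sqr_ge0 ?(variance_ge0 Bm)// ltW.
pose C := \sum_l K l; have C0 : 0 <= C by exact: sumr_ge0.
pose V := \sum_l S l l.
have V0 : 0 <= V by apply: sumr_ge0 => l _; exact: (variance_ge0 Bm).
pose x1 := 2 * L%:R * C / e; pose x2 := 4 * V / c ^+ 2.
have x10 : 0 <= x1 by apply: divr_ge0; [apply: mulr_ge0 => //; exact: mulr_ge0|exact: ltW].
have x20 : 0 <= x2 by apply: divr_ge0; [exact: mulr_ge0|exact: sqr_ge0].
exists (Num.truncn (x1 + x2)).+1 => // q qq.
have q0 : (0 < q)%N by exact: leq_trans qq.
have qR : 0 < q%:R :> R by rewrite ltr0n.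
have qx : x1 + x2 <= q%:R by apply: (le_trans (ltW (truncnS_gt _))); rewrite ler_nat.
have [M0 M00 H] := pr_block_small Biid Bm (L := L%:R + 2) (addr_ge0 (ler0n _ L) (ler0n _ 2)) c0 q0.
exists (M0 + q%:R); first exact: addr_gt0.
move=> M MM.
have MM0 : M0 <= M by move: MM qR; lra.
have Mq : q%:R <= M by move: MM M00; lra.
have M1 : 1 <= M by apply: le_trans Mq; rewrite ler1n.
have M_0 : 0 < M by rewrite (lt_le_trans _ M1).
have sM : 0 < Num.sqrt M by rewrite sqrtr_gt0.
have blk (i : 'I_(L * q)) l : pr P [set w |
     exists k : 'I_(step_index M q i.+1 - step_index M q i).+1,
     a * Num.sqrt M <=
       `|\sum_(step_index M q i <= j < step_index M q i + k) centered B b l j w|] <=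
     2 * (K l / q%:R ^+ 2).
  have n01 := step_index_mono q (ltW M_0) (leqnSn i).
  have nq := step_indexB i (ltW M_0) Mq q0.
  have -> : a * Num.sqrt M = 2 * (c * Num.sqrt M) by rewrite /c; field.
  have cM : 0 < c * Num.sqrt M by rewrite mulr_gt0.
  apply: (le_trans (pr_block_max Biid Bm n01 cM _)).
    rewrite exprMn sqr_sqrtr ?(ltW M_0)// ler_pdivrMr ?mulr_gt0 ?exprn_gt0//.
    apply: (le_trans (ler_wpM2r (variance_ge0 Bm l) nq)).
    have SV : S l l <= V.
      by rewrite /V (bigD1 l)//= lerDl sumr_ge0// => l' _; exact: (variance_ge0 Bm).
    have : x2 <= q%:R by move: qx x10; lra.
    rewrite /x2 ler_pdivrMr ?exprn_gt0// => h.
    rewrite mulrAC ler_pdivrMr//.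
    have -> : 2 * M * S l l = M * (2 * S l l) by ring.
    have -> : 1 / 2 * (c ^+ 2 * M) * q%:R = M * (1 / 2 * (q%:R * c ^+ 2)) by ring.
    rewrite ler_wpM2l ?(ltW M_0)//; lra.
  rewrite ler_wpM2l//; apply: H => //.
  apply: (le_trans (step_index_le _ _ (ltW M_0))).
  have : (i.+1%:R / q%:R : R) <= L%:R.
    by rewrite ler_pdivrMr// -natrM ler_nat.
  move=> /(ler_wpM2l (ltW M_0)) h; rewrite mulrDr mulr1.
  by rewrite (mulrC _ M) mulrDr; move: h M1; lra.
apply: (le_trans (pr_exists P _)).
  by move=> i; apply: measurable_exists => l; exact: measurable_osc_block.
apply: (@le_trans _ _ (\sum_(i < L * q) \sum_l 2 * (K l / q%:R ^+ 2))).
  apply: ler_sum => i _; apply: (le_trans (pr_exists P _)).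
    by move=> l; exact: measurable_osc_block.
  by apply: ler_sum => l _; exact: blk.
rewrite -mulr_sumr -mulr_suml -/C sumr_const card_ord -[_ *+ _]mulr_natr natrM.
have -> : 2 * (C / q%:R ^+ 2) * (L%:R * q%:R) = 2 * L%:R * C / q%:R.
  by field; rewrite gt_eqF.
have : x1 <= q%:R by apply: le_trans qx; rewrite lerDl.
by rewrite /x1 !ler_pdivrMr// [q%:R * e]mulrC.
Qed.

End oscillation.

(** * Convergence of the maxima over a grid *)

Section ramp_function.
Context {R : realType}.
Variables lo hi : R.
Hypothesis lohi : lo < hi.

(** A continuous approximation of the indicator of [`[hi, +oo[] *)
Definition ramp (x : R) : R := Num.min 1 (Num.max 0 ((x - lo) / (hi - lo))).

Let d0 : 0 < hi - lo. Proof. by rewrite subr_gt0. Qed.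

Lemma ramp01 x : 0 <= ramp x <= 1.
Proof. by rewrite /ramp le_min ler01 le_max lexx/= ge_min lexx. Qed.

Lemma ramp_hi x : hi <= x -> ramp x = 1.
Proof.
move=> hx; apply/min_idPl; rewrite le_max; apply/orP; right.
by rewrite ler_pdivlMr// mul1r lerD2r.
Qed.

Lemma ramp_lo x : x <= lo -> ramp x = 0.
Proof.
move=> hx; rewrite /ramp (max_idPl _) ?(min_idPr _)//.
by rewrite mulr_le0_ge0 ?subr_le0// invr_ge0 ltW.
Qed.

Lemma ramp_lipschitz x y : `|ramp x - ramp y| <= (hi - lo)^-1 * `|x - y|.
Proof.
have -> : (hi - lo)^-1 * `|x - y| = `|(x - lo) / (hi - lo) - (y - lo) / (hi - lo)|.
  by rewrite -mulrBl opprB addrA subrK normrM normfV (gtr0_norm d0) mulrC.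
rewrite /ramp; move: (_ / _) (_ / _) => t s.
have hn (u v : R) : u - v <= `|u - v| /\ v - u <= `|u - v|.
  by split; [exact: ler_norm|rewrite distrC; exact: ler_norm].
have hmax : `|Num.max 0 s - Num.max 0 t| <= `|s - t|.
  have [h1 h2] := hn s t; have h3 := normr_ge0 (s - t).
  by case: (leP 0 s) => ?; case: (leP 0 t) => ?; rewrite ler_norml; apply/andP; split; lra.
apply: (le_trans _ hmax); move: (Num.max 0 s) (Num.max 0 t) => a b'.
have [h1 h2] := hn a b'; have h3 := normr_ge0 (a - b').
by case: (leP 1 a) => ?; case: (leP 1 b') => ?; rewrite ler_norml; apply/andP; split; lra.
Qed.

Lemma measurable_ramp : measurable_fun setT ramp.
Proof.
apply: measurable_minr => //; apply: measurable_maxr => //.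
by apply: measurable_funM => //; exact: measurable_funB.
Qed.

End ramp_function.

Section bigmax_lemmas.
Context {R : realType}.

Lemma measurable_bigmax d (T : measurableType d) (I : Type) (s : seq I) (F : I -> T -> R) :
  (forall i, measurable_fun setT (F i)) ->
  measurable_fun setT (fun w => \big[Num.max/0]_(i <- s) F i w).
Proof.
move=> mF; elim: s => [|i s IH].
  by under [X in measurable_fun _ X]eq_fun do rewrite big_nil; exact: measurable_cst.
by under [X in measurable_fun _ X]eq_fun do rewrite big_cons; exact: measurable_maxr.
Qed.

Lemma bigmax_lipschitz (I : finType) (x y : I -> R) :
  `|\big[Num.max/0]_i x i - \big[Num.max/0]_i y i| <= \sum_i `|x i - y i|.
Proof.
have key (u v : I -> R) : \big[Num.max/0]_i u i <= \big[Num.max/0]_i v i + \sum_i `|u i - v i|.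
  apply: bigmax_le => [|i _].
    by rewrite addr_ge0 ?sumr_ge0//; exact: bigmax_ge_id.
  apply: (@le_trans _ _ (v i + `|u i - v i|)); first by have := ler_norm (u i - v i); lra.
  apply: lerD; first exact: le_bigmax.
  by rewrite (bigD1 i)//= lerDl sumr_ge0.
have h1 := key x y; have h2 := key y x.
have e : \sum_i `|y i - x i| = \sum_i `|x i - y i| by apply: eq_bigr => i _; rewrite distrC.
rewrite e in h2; move: h1 h2; set a := \big[_/_]_i _; set b' := \big[_/_]_i _ => h1 h2.
by rewrite ler_norml; apply/andP; split; lra.
Qed.

End bigmax_lemmas.

Lemma expect_le_pr d (T : measurableType d) (R : realType) (P : probability T R)
    (f : T -> R) (A : set T) : measurable A -> rint P f ->
  (forall w, f w <= 1) -> (forall w, ~ A w -> f w <= 0) -> expect P f <= pr P A.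
Proof.
move=> mA rf f1 f0; rewrite -expect_indic//; apply: le_expect => //; first exact: rint_indic.
move=> w; rewrite indicE; have [wA|wA] := boolP (w \in A); first exact: f1.
by apply: f0 => /mem_set wA'; move: wA; rewrite wA'.
Qed.

(** The ramp of the maximum lies between the indicators of two events of the same
    form, at the levels [hi] and [lo]. *)
Lemma expect_ramp_bounds d (T : measurableType d) (R : realType) (P : probability T R)
    (I : finType) (E : I -> T -> R) lo hi : (forall k, measurable_fun setT (E k)) ->
  0 < lo -> lo < hi ->
  pr P [set w | exists k, hi <= E k w] <= expect P (fun w => ramp lo hi (\big[Num.max/0]_k E k w)) /\
  expect P (fun w => ramp lo hi (\big[Num.max/0]_k E k w)) <= pr P [set w | exists k, lo <= E k w].
Proof.
move=> mE lo0 lohi; have r01 w := ramp01 lo hi (\big[Num.max/0]_k E k w).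
have rf : rint P (fun w => ramp lo hi (\big[Num.max/0]_k E k w)).
  apply: (@rint_bounded _ _ _ _ _ 1) => [|w].
    by apply: (measurableT_comp (measurable_ramp lo hi)); exact: measurable_bigmax.
  by have /andP[? ?] := r01 w; rewrite ger0_norm.
have mex c : measurable [set w | exists k, c <= E k w].
  by apply: measurable_exists => k; exact: measurable_ge.
split.
  rewrite -[leRHS]divr1; apply: markov_pr => //.
  - by move=> w; case/andP: (r01 w).
  - by move=> w [k hk]; rewrite ramp_hi//; apply: (le_trans hk); exact: le_bigmax.
apply: expect_le_pr => // [w|w nk]; first by case/andP: (r01 w).
rewrite ramp_lo//; apply: bigmax_le => [|k _]; first exact: ltW.
by rewrite leNgt; apply/negP => /ltW hk; apply: nk; exists k.
Qed.

Section maxima.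
Context d (T : measurableType d) (R : realType) (P : probability T R).
Context d' (T' : measurableType d') (P' : probability T' R).
Variables (p r m : nat) (N : 'cV[R]_p -> R).
Hypothesis hN : distance_function N.
Variables (B : nat -> T -> 'cV[R]_r) (b : 'cV[R]_r) (S : 'M[R]_r).
Hypothesis Biid : iid_vectors P B.
Hypothesis Bm : forall i, has_mean_cov P (B i) b S.
Variables (A : 'M[R]_(p, r)) (u : nat -> R).
Hypothesis u0 : u 0%N = 0.
Hypothesis upos : forall k, 0 < u k.+1.
Hypothesis nu : nondecreasing_seq u.
Variables (W : 'I_p -> R -> T' -> R) (Q : 'M[R]_p).
Hypothesis HW : independent_Brownian_motions P' W.
Hypothesis HQ : is_psd_sqrt Q (A *m S *m A^T).

Definition scaled_error (M : R) (k : nat) w : R :=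
  N (Num.sqrt M *: (A *m (average B (grid_index u M k) w - b))).

Definition limit_error (k : nat) w : R := N (Q *m \col_j W j (u k.+1) w).

Let maxdist (x : 'I_m * 'I_p -> R) : R := \big[Num.max/0]_(k < m) N (\col_j x (k, j)).

Let scaled_errorE M (k : 'I_m) w :
  N (\col_j Uvec B b A u M (k, j) w) = scaled_error M k w.
Proof. by congr N; apply/colP => j; rewrite !mxE /Uvec /= mxE. Qed.

Let limit_errorE (k : 'I_m) w :
  N (\col_j Vvec W Q u (k, j) w) = limit_error k w.
Proof. by congr N; apply/colP => j; rewrite !mxE /Vvec /= mxE. Qed.

Let mU M (kj : 'I_m * 'I_p) : measurable_fun setT (Uvec B b A u M kj : T -> R).
Proof. exact: (measurable_Uvec b Biid). Qed.

Let mV (kj : 'I_m * 'I_p) : measurable_fun setT (Vvec W Q u kj).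
Proof. exact: (measurable_Vvec Q HW u0 nu). Qed.

Lemma measurable_scaled_error M (k : 'I_m) : measurable_fun setT (scaled_error M k).
Proof.
rewrite -(funext (scaled_errorE M k)); apply: (measurable_dist hN) => j.
by under [X in measurable_fun _ X]eq_fun do rewrite mxE; exact: mU.
Qed.

Lemma measurable_limit_error (k : 'I_m) : measurable_fun setT (limit_error k).
Proof.
rewrite -(funext (limit_errorE k)); apply: (measurable_dist hN) => j.
by under [X in measurable_fun _ X]eq_fun do rewrite mxE; exact: mV.
Qed.

Lemma expect_ramp_cvg lo hi : lo < hi ->
  expect P (fun w => ramp lo hi (\big[Num.max/0]_(k < m) scaled_error M k w)) @[M --> +oo] -->
  expect P' (fun w => ramp lo hi (\big[Num.max/0]_(k < m) limit_error k w)).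
Proof.
move=> lohi; have [c c0 cP] := dist_bound hN.
have d0 : 0 < hi - lo by rewrite subr_gt0.
have lip x y : `|ramp lo hi (maxdist x) - ramp lo hi (maxdist y)| <=
    (hi - lo)^-1 * c * \sum_kj `|x kj - y kj|.
  apply: (le_trans (ramp_lipschitz lohi _ _)); rewrite -mulrA ler_wpM2l ?invr_ge0 ?(ltW d0)//.
  rewrite /maxdist; apply: (le_trans (bigmax_lipschitz _ _)).
  have -> : \sum_kj `|x kj - y kj| = \sum_k \sum_j `|x (k, j) - y (k, j)|.
    by rewrite pair_bigA; apply: eq_bigr => -[].
  rewrite mulr_sumr; apply: ler_sum => k _.
  apply: (le_trans (dist_diff hN _ _)); apply: (le_trans (cP _)).
  by rewrite ler_wpM2l ?(ltW c0)//; apply: ler_sum => j _; rewrite !mxE.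
have maxU M w : maxdist ((Uvec B b A u M) ^~ w) = \big[Num.max/0]_(k < m) scaled_error M k w.
  by apply: eq_bigr => k _; exact: scaled_errorE.
have maxV w : maxdist ((Vvec W Q u) ^~ w) = \big[Num.max/0]_(k < m) limit_error k w.
  by apply: eq_bigr => k _; exact: limit_errorE.
have eU M : expect P (fun w => ramp lo hi (\big[Num.max/0]_(k < m) scaled_error M k w)) =
    expect P (fun w => ramp lo hi (maxdist ((Uvec B b A u M) ^~ w))).
  by congr (expect P _); apply/funext => w; rewrite maxU.
have eV : expect P' (fun w => ramp lo hi (\big[Num.max/0]_(k < m) limit_error k w)) =
    expect P' (fun w => ramp lo hi (maxdist ((Vvec W Q u) ^~ w))).
  by congr (expect P' _); apply/funext => w; rewrite maxV.
rewrite (funext eU) eV.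
apply: (@levy_lipschitz _ _ _ _ _ P P' _ _ +oo _ (fun M => Uvec (m := m) B b A u M)
  (Vvec (m := m) W Q u) mU mV _ (tight_Uvec Biid Bm m A upos) (fun x => ramp lo hi (maxdist x))
  ((hi - lo)^-1 * c) _ _ lip).
- move=> th a; rewrite (expect_cos_Vvec HW HQ u0 nu).
  exact: (expect_cos_Uvec_cvg Biid Bm upos nu).
- by move=> x; exact: ramp01.
- by rewrite mulr_ge0 ?invr_ge0 ?(ltW d0) ?(ltW c0).
- move=> M; under [X in measurable_fun _ X]eq_fun do rewrite maxU.
  apply: (measurableT_comp (measurable_ramp lo hi)).
  by apply: measurable_bigmax => k; exact: measurable_scaled_error.
- under [X in measurable_fun _ X]eq_fun do rewrite maxV.
  apply: (measurableT_comp (measurable_ramp lo hi)).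
  by apply: measurable_bigmax => k; exact: measurable_limit_error.
Qed.

(** Convergence in law at two levels instead of continuity points of the limit. *)
Lemma cvg_exists_error lo hi e : 0 < lo -> lo < hi -> 0 < e ->
  \forall M \near +oo,
  pr P [set w | exists k : 'I_m, hi <= scaled_error M k w] <=
    pr P' [set w | exists k : 'I_m, lo <= limit_error k w] + e /\
  pr P' [set w | exists k : 'I_m, hi <= limit_error k w] <=
    pr P [set w | exists k : 'I_m, lo <= scaled_error M k w] + e.
Proof.
move=> lo0 lohi e0; have /cvgrPdist_le/(_ e e0) h := expect_ramp_cvg lohi.
near=> M; have h' : `|expect P' (fun w => ramp lo hi (\big[Num.max/0]_(k < m) limit_error k w)) -
   expect P (fun w => ramp lo hi (\big[Num.max/0]_(k < m) scaled_error M k w))| <= e by near: M.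
have [h1 h2] := expect_ramp_bounds P (measurable_scaled_error M) lo0 lohi.
have [h3 h4] := expect_ramp_bounds P' measurable_limit_error lo0 lohi.
by move: h'; rewrite ler_norml => /andP[? ?]; split; lra.
Unshelve. all: by end_near. Qed.

End maxima.

(** * Exceedances and what causes them *)

Section matrix_bound.
Context {R : realType}.

Lemma dist_mulmx (p r : nat) (N : 'cV[R]_p -> R) (hN : distance_function N)
    (A : 'M[R]_(p, r)) : exists2 K, 0 < K & forall x : 'cV[R]_r, N (A *m x) <= K * \sum_l `|x l 0|.
Proof.
have [c c0 cP] := dist_bound hN.
pose K := c * \sum_j \sum_l `|A j l|.
have K0 : 0 <= K by rewrite mulr_ge0 ?(ltW c0)// sumr_ge0// => j _; exact: sumr_ge0.
exists (K + 1); first by rewrite ltr_wpDl.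
move=> x; apply: (le_trans (cP _)).
have x0 : 0 <= \sum_l `|x l 0| by exact: sumr_ge0.
apply: (@le_trans _ _ (K * \sum_l `|x l 0|)); last by rewrite ler_wpM2r// lerDl.
rewrite /K -mulrA ler_wpM2l ?(ltW c0)// mulr_suml; apply: ler_sum => j _.
rewrite mxE; apply: (le_trans (ler_norm_sum _ _ _)); rewrite mulr_suml.
apply: ler_sum => l _; rewrite normrM ler_wpM2l//.
by rewrite (bigD1 l)//= lerDl sumr_ge0.
Qed.

End matrix_bound.

Section exceedance.
Context d (T : measurableType d) (R : realType) (P : probability T R).
Variables (p r : nat) (N : 'cV[R]_p -> R).
Hypothesis hN : distance_function N.
Variables (B : nat -> T -> 'cV[R]_r) (b : 'cV[R]_r) (S : 'M[R]_r).
Hypothesis Biid : iid_vectors P B.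
Hypothesis Bm : forall i, has_mean_cov P (B i) b S.
Variable h : 'I_p -> 'cV[R]_r -> R.
Hypothesis hmeas : forall j, measurable_fun [set: borel_cV R r] (h j : borel_cV R r -> R).
Hypothesis hC1 : forall j, C1_near (h j) b.

Local Notation A := (Jacobi h b).

(** The error at some time after [M] on the scale [sqrt M] at which it has a limit. *)
Definition exceedance (M Z : R) : set T := [set w | exists2 n : nat, M < n%:R &
  Z <= Num.sqrt M * N (estimator B h n w - apply_cV h b)].

Lemma measurable_exceedance M Z : measurable (exceedance M Z).
Proof.
apply: (@measurable_exists_nat _ _ [set n : nat | M < n%:R]
  (fun n => [set w | Z <= Num.sqrt M * N (estimator B h n w - apply_cV h b)])) => n.
by apply: measurable_ge; apply: measurable_funM => //; exact: (measurable_error hN Biid hmeas).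
Qed.

(** The inverses of the times [1 + i / q], in increasing order: the point 0 of the
    grid is followed by the inverse of the last time [1 + m / q] and ends with 1. *)
Definition step_grid (q m k : nat) : R :=
  if k is k'.+1 then (1 + (m - k')%:R / q%:R)^-1 else 0.

Lemma step_grid_gt0 q m k : 0 < step_grid q m k.+1.
Proof. by rewrite invr_gt0 ltr_wpDr// divr_ge0. Qed.

Lemma step_grid_le1 q m k : step_grid q m k.+1 <= 1.
Proof. by rewrite invf_le1 ?lerDl ?divr_ge0// ltr_wpDr// divr_ge0. Qed.

Lemma step_grid_mono q m : nondecreasing_seq (step_grid q m).
Proof.
apply/nondecreasing_seqP => -[|k]; first exact/ltW/step_grid_gt0.
rewrite /= lef_pV2 ?posrE ?ltr_wpDr ?divr_ge0// lerD2l ler_wpM2r ?invr_ge0//.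
by rewrite ler_nat leq_sub2l.
Qed.

Lemma grid_index_step q m (M : R) k : (k <= m)%N ->
  grid_index (step_grid q m) M (m - k) = step_index M q k.
Proof. by move=> km; rewrite /grid_index /step_index /= invrK subKn. Qed.

Lemma exists_step (M : R) q m n : (step_index M q 0 <= n)%N -> (n < step_index M q m)%N ->
  exists2 i, (i < m)%N & (step_index M q i <= n < step_index M q i.+1)%N.
Proof.
move=> n0; elim: m => [|m IH] nm; first by move: (leq_ltn_trans n0 nm); rewrite ltnn.
have [nm'|nm'] := ltnP n (step_index M q m).
  by have [i im hi] := IH nm'; exists i => //; exact: ltnW.
by exists m => //; rewrite nm' nm.
Qed.

Lemma psum_split l n0 n w : (n0 <= n)%N ->
  psum B b l n w = psum B b l n0 w + \sum_(n0 <= j < n) centered B b l j w.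
Proof. by move=> n0n; rewrite /psum -big_cat_nat. Qed.

Section cover.
Variables (M K a H dl z Z : R) (q m : nat).
Hypothesis KP : forall x : 'cV[R]_r, N (A *m x) <= K * \sum_l `|x l 0|.
Hypothesis K0 : 0 < K.
Hypothesis M0 : 0 < M.
Hypothesis q0 : (0 < q)%N.
Hypothesis qM : q%:R <= M.
Hypothesis a0 : 0 < a.
Hypothesis Hq : 2 * H / q%:R <= a.
Hypothesis z0 : 0 <= z.
Hypothesis Zle : dl + z + 2 * K * r%:R * a <= Z.

Local Notation m1 := (step_index M q 0).
Local Notation mL := (step_index M q m).

Let sM : 0 < Num.sqrt M. Proof. by rewrite sqrtr_gt0. Qed.

(** Up to the remainder, the error is a linear image of the average. After the last
    step the average is small. During a step it is close to what it was at the
    beginning of the step, unless the sum oscillates, or unless the average is so large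
    that the change of the denominator matters. *)
Lemma exceedance_cover : exceedance M Z `<=`
  remainder_event N B b h m1 dl `|` (oscillation B b M q m a `|`
  (deviation B b m1 (H / Num.sqrt M) `|` (deviation B b mL (a / Num.sqrt M) `|`
   [set w | exists k : 'I_m.+1, z <= scaled_error N B b A (step_grid q m) M k w]))).
Proof.
move=> w [n Mn hn]; apply: contrapT => nU.
have nR : ~ remainder_event N B b h m1 dl w by move=> ?; apply: nU; left.
have nO : ~ oscillation B b M q m a w by move=> ?; apply: nU; right; left.
have nD1 : ~ deviation B b m1 (H / Num.sqrt M) w by move=> ?; apply: nU; right; right; left.
have nD2 : ~ deviation B b mL (a / Num.sqrt M) w by move=> ?; apply: nU; right; right; right; left.
have nE : ~ exists k : 'I_m.+1, z <= scaled_error N B b A (step_grid q m) M k w.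
  by move=> ?; apply: nU; right; right; right; right.
have n_0 : 0 < n%:R :> R by rewrite (lt_trans M0).
have n1 : (0 < n)%N by rewrite -(ltr0n R).
have m1n : (m1 <= n)%N.
  by rewrite /step_index mul0r addr0 mulr1 truncn_lt_nat ?(ltW M0).
have Rn : Num.sqrt M * N (remainder B h b n w) < dl.
  rewrite ltNge; apply/negP => hR; apply: nR; exists n => //.
  apply: (le_trans hR); rewrite ler_wpM2r ?(dist_ge0 hN)// ler_wsqrtr//.
  by have := step_index_gt M q 0; rewrite mul0r addr0 mulr1 => /ltW.
pose x := average B n w - b.
have Ex : Z - dl < Num.sqrt M * N (A *m x).

  have : N (estimator B h n w - apply_cV h b) <= N (remainder B h b n w) + N (A *m x).
    by rewrite (_ : estimator B h n w - _ = remainder B h b n w + A *m x) ?(dist_triangle hN)// subrK.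
  move=> /(ler_wpM2l (ltW sM)); rewrite mulrDr => h2; move: (le_trans hn h2) Rn; lra.
have rKa : 0 <= K * r%:R * a by rewrite !mulr_ge0// ltW.
have bound (y : 'cV[R]_r) (c : R) : (forall l, `|y l 0| <= c / Num.sqrt M) ->
    Num.sqrt M * N (A *m y) <= K * r%:R * c.
  move=> yc; apply: (le_trans (ler_wpM2l (ltW sM) (KP y))).
  apply: (le_trans (ler_wpM2l (ltW sM) (ler_wpM2l (ltW K0) (ler_sum _ (fun l _ => yc l))))).
  rewrite sumr_const card_ord -[_ *+ r]mulr_natr le_eqVlt; apply/orP; left; apply/eqP.
  by field; rewrite gt_eqF.
have [nL|nL] := leqP mL n.
  have : Num.sqrt M * N (A *m x) <= K * r%:R * a.
    apply: bound => l; rewrite /x average_centered// normrM normfV (gtr0_norm n_0).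
    rewrite ler_pdivrMr//; apply/ltW; rewrite ltNge; apply/negP => hd.
    by apply: nD2; exists n => //; exists l.
  move: Ex Zle rKa z0; lra.
have [i im /andP[ni1 ni2]] := exists_step m1n nL.
set ni := step_index M q i in ni1.
have ni0 : (0 < ni)%N by [].
have niR : 0 < ni%:R :> R by rewrite ltr0n.
have niM : M <= ni%:R.
  apply/ltW/(le_lt_trans _ (step_index_gt M q i)).
  by rewrite ler_peMr ?(ltW M0)// lerDl divr_ge0.
(* [y] is the error at the beginning of the step that contains [n]. *)
pose y := average B ni w - b.
have Ey : Num.sqrt M * N (A *m y) < z.
  rewrite ltNge; apply/negP => hz; apply: nE.
  have km : (m - i < m.+1)%N by rewrite ltnS leq_subr.
  exists (Ordinal km); rewrite /scaled_error/= grid_index_step ?(ltnW im)//.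
  by rewrite (distZ hN) ger0_norm// ltW.
(* The averages differ by the oscillation of the sum and by the change of the
   denominator. *)
have dxy l : `|(x - y) l 0| <= (2 * a) / Num.sqrt M.
  have -> : (x - y) l 0 = (\sum_(ni <= j < n) centered B b l j w) / n%:R +
      psum B b l ni w / ni%:R * ((ni%:R - n%:R) / n%:R).
    have -> : (x - y) l 0 = psum B b l n w / n%:R - psum B b l ni w / ni%:R.
      by rewrite -!average_centered// !mxE.
    by rewrite (psum_split l w ni1); field; rewrite !gt_eqF.
  have hO : `|\sum_(ni <= j < n) centered B b l j w| <= a * Num.sqrt M.
    apply/ltW; rewrite ltNge; apply/negP => ho; apply: nO; exists (Ordinal im), l.
    have kn : (n - ni < (step_index M q i.+1 - ni).+1)%N by rewrite ltnS leq_sub2r// ltnW.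
    by exists (Ordinal kn); rewrite /= -/ni subnKC.
  have hD : `|psum B b l ni w / ni%:R| <= H / Num.sqrt M.
    rewrite normrM normfV (gtr0_norm niR) ler_pdivrMr//; apply/ltW; rewrite ltNge; apply/negP => hd.
    apply: nD1; exists ni; last by exists l.
    exact: (step_index_mono q (ltW M0) (leq0n i)).
  have hB : `|(ni%:R - n%:R) / n%:R| <= 2 / q%:R :> R.
    rewrite normrM normfV (gtr0_norm n_0) distrC ger0_norm ?subr_ge0 ?ler_nat//.
    rewrite ler_pdivrMr// -natrB//.
    have h1 : (n - ni)%:R <= 2 * M / q%:R :> R.
      by apply: le_trans (step_indexB i (ltW M0) qM q0); rewrite ler_nat leq_sub2r// ltnW.
    apply: (le_trans h1); rewrite [leLHS]mulrAC ler_wpM2l ?divr_ge0//; exact: ltW.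
  apply: (le_trans (ler_normD _ _)).
  have -> : 2 * a / Num.sqrt M = a / Num.sqrt M + a / Num.sqrt M by ring.
  apply: lerD.
    rewrite normrM normfV (gtr0_norm n_0) ler_pdivrMr//; apply: (le_trans hO).
    rewrite mulrAC ler_pdivlMr// -mulrA -expr2 sqr_sqrtr ?(ltW M0)//.
    by rewrite ler_wpM2l ?(ltW a0)// ltW.
  rewrite normrM; apply: (le_trans (ler_pM _ _ hD hB)) => //.
  rewrite mulrAC ler_wpM2r ?invr_ge0 ?(ltW sM)//.
  by apply: le_trans Hq; rewrite mulrA (mulrC H).
have := bound _ _ dxy.
have : N (A *m x) <= N (A *m (x - y)) + N (A *m y).
  by rewrite -{1}(subrK y x) mulmxDr (dist_triangle hN).
move=> /(ler_wpM2l (ltW sM)); rewrite mulrDr => h1 h2.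
move: Ex Ey Zle h1 h2.
have -> : K * r%:R * (2 * a) = 2 * K * r%:R * a by ring.
lra.
Qed.

End cover.
End exceedance.

(** * Limits of the exceedance probabilities *)

Section exceedance_limits.
Context d (T : measurableType d) (R : realType) (P : probability T R).
Context d' (T' : measurableType d') (P' : probability T' R).
Variables (p r : nat) (N : 'cV[R]_p -> R).
Hypothesis hN : distance_function N.
Variables (B : nat -> T -> 'cV[R]_r) (b : 'cV[R]_r) (S : 'M[R]_r).
Hypothesis Biid : iid_vectors P B.
Hypothesis Bm : forall i, has_mean_cov P (B i) b S.
Variable h : 'I_p -> 'cV[R]_r -> R.
Hypothesis hmeas : forall j, measurable_fun [set: borel_cV R r] (h j : borel_cV R r -> R).
Hypothesis hC1 : forall j, C1_near (h j) b.
Variables (W : 'I_p -> R -> T' -> R) (Q : 'M[R]_p).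
Hypothesis HW : independent_Brownian_motions P' W.
Hypothesis HQ : is_psd_sqrt Q (Jacobi h b *m S *m (Jacobi h b)^T).

Local Notation A := (Jacobi h b).

(** Of the five events that cover an exceedance, four have a small probability and
    the last converges. The event [E] stands for the supremum of the limit exceeding
    [lo]; the parameters are chosen in the order [dl], [a], [H], [L], [q], [M]. *)
Lemma exceedance_limsup (lo Z e : R) (E : set T') : measurable E ->
  (forall s w, 0 <= s <= 1 -> lo <= N (Q *m \col_j W j s w) -> E w) ->
  0 < lo -> lo < Z -> 0 < e ->
  \forall M \near +oo, pr P (exceedance N B b h M Z) <= pr P' E + e.
Proof.
move=> mE EP lo0 loZ e0.
have [K K0 KP] := dist_mulmx hN A.
pose g := (Z - lo) / 2; pose z := lo + g.
have g0 : 0 < g by rewrite divr_gt0// subr_gt0.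
have loz : lo < z by rewrite ltrDl.
have z0 : 0 < z by rewrite (lt_trans lo0).
pose dl := g / 2; have dl0 : 0 < dl by rewrite divr_gt0.
pose a := g / (4 * K * r.+1%:R).
have rR : 0 < r.+1%:R :> R by rewrite ltr0n.
have a0 : 0 < a by rewrite divr_gt0// !mulr_gt0.
have Zle : dl + z + 2 * K * r%:R * a <= Z.
  have : 2 * K * r%:R * a <= g / 2.
    have -> : 2 * K * r%:R * a = g / 2 * (r%:R / r.+1%:R) by rewrite /a; set q : R := r.+1%:R in rR *; field; rewrite !gt_eqF.
    apply: ler_piMr; first by rewrite divr_ge0// ltW.
    by rewrite ler_pdivrMr// mul1r ler_nat.
  rewrite /dl /z /g; lra.
pose e6 := e / 5; have e60 : 0 < e6 by rewrite divr_gt0.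
pose V := total_variance S; have V0 : 0 <= V := total_variance_ge0 Bm.
pose H := 1 + V / e6.
have H1 : 1 <= H by rewrite lerDl divr_ge0// ltW.
have H0 : 0 < H by rewrite (lt_le_trans _ H1).
have HV : V / H ^+ 2 <= e6.
  rewrite ler_pdivrMr ?exprn_gt0// [e6 * _]mulrC -ler_pdivrMr//; apply: (@le_trans _ _ H); first by rewrite lerDr.
  by rewrite ler_eXnr.
pose L := (Num.truncn (V / (a ^+ 2 * e6))).+1.
have LV : V / (a ^+ 2 * L%:R) <= e6.
  have ae : 0 < a ^+ 2 * e6 by rewrite mulr_gt0// exprn_gt0.
  have hV : V <= L%:R * (a ^+ 2 * e6) by rewrite -ler_pdivrMr//; exact: ltW (truncnS_gt _).
  rewrite ler_pdivrMr; last by rewrite mulr_gt0 ?exprn_gt0 ?ltr0n.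
  by apply: (le_trans hV); rewrite le_eqVlt; apply/orP; left; apply/eqP; ring.
have [m0 m00 rem] := remainder_small hN Biid Bm hmeas hC1 dl0 e60.
have [q0 q00 osc] := oscillation_small Biid Bm L a0 e60.
pose q := maxn q0 (Num.truncn (2 * H / a)).+1.
have qq0 : (q0 <= q)%N by rewrite leq_maxl.
have q_0 : (0 < q)%N by exact: leq_trans qq0.
have qR : 0 < q%:R :> R by rewrite ltr0n.
have Hq : 2 * H / q%:R <= a.
  have : 2 * H / a <= q%:R.
    by apply: (le_trans (ltW (truncnS_gt _))); rewrite ler_nat leq_maxr.
  by rewrite !ler_pdivrMr// [a * _]mulrC.
have [M0 M00 {}osc] := osc q qq0.
pose m := (L * q)%N.
have fdd : \forall M \near +oo, pr P [set w | exists k : 'I_m.+1,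
    z <= scaled_error N B b A (step_grid R q m) M k w] <= pr P' E + e6.
  have := cvg_exists_error m.+1 hN Biid Bm (erefl : step_grid R q m 0 = 0) (step_grid_gt0 R q m)
    (@step_grid_mono R q m) HW HQ lo0 loz e60.
  apply: filterS => M [hh _]; apply: (le_trans hh); rewrite lerD2r; apply: le_pr => //.
    apply: measurable_exists => k; apply: measurable_ge.
    exact: (measurable_limit_error hN (erefl : step_grid R q m 0 = 0) (@step_grid_mono R q m) Q HW).
  move=> w [k hk]; apply: EP hk.
  by rewrite (ltW (step_grid_gt0 R q m k)) step_grid_le1.
near=> M.
have MM0 : M0 <= M by near: M; apply: nbhs_pinfty_ge; exact: num_real.
have M_0 : 0 < M by rewrite (lt_le_trans M00).
have sM : 0 < Num.sqrt M by rewrite sqrtr_gt0.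
have Mq : q%:R <= M by near: M; apply: nbhs_pinfty_ge; exact: num_real.
have Mm : m0%:R <= M by near: M; apply: nbhs_pinfty_ge; exact: num_real.
have m1M : M < (step_index M q 0)%:R by have := step_index_gt M q 0; rewrite mul0r addr0 mulr1.
have mLM : M * L%:R <= (step_index M q m)%:R.
  apply: le_trans (ltW (step_index_gt M q m)); rewrite ler_wpM2l ?(ltW M_0)//.
  by rewrite /m natrM mulfK ?gt_eqF// lerDr.
have p1 : pr P (remainder_event N B b h (step_index M q 0) dl) <= e6.
  by apply: rem; rewrite -(ler_nat R) (le_trans Mm)// ltW.
have p2 : pr P (oscillation B b M q m a) <= e6 by exact: osc.
have p3 : pr P (deviation B b (step_index M q 0) (H / Num.sqrt M)) <= e6.
  apply: (le_trans (pr_deviation Biid Bm _ _)); [by rewrite divr_gt0|by []|].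
  apply: le_trans HV; rewrite expr_div_n sqr_sqrtr ?(ltW M_0)// ler_wpM2l//.
  rewrite lef_pV2 ?posrE ?exprn_gt0 ?mulr_gt0 ?divr_gt0 ?invr_gt0 ?exprn_gt0//.
  have -> : H ^+ 2 / M * (step_index M q 0)%:R = H ^+ 2 * ((step_index M q 0)%:R / M) by ring.
  apply: ler_peMr; first exact: sqr_ge0.
  by rewrite ler_pdivlMr// mul1r ltW.
have p4 : pr P (deviation B b (step_index M q m) (a / Num.sqrt M)) <= e6.
  apply: (le_trans (pr_deviation Biid Bm _ _)); [by rewrite divr_gt0|by []|].
  apply: le_trans LV; rewrite expr_div_n sqr_sqrtr ?(ltW M_0)// ler_wpM2l//.
  have a20 : 0 < a ^+ 2 by exact: exprn_gt0.
  rewrite lef_pV2 ?posrE; last 2 first.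
  - by apply: mulr_gt0; [exact: divr_gt0|rewrite ltr0n].
  - by apply: mulr_gt0; rewrite ?ltr0n.
  have -> : a ^+ 2 / M * (step_index M q m)%:R = a ^+ 2 * ((step_index M q m)%:R / M) by ring.
  apply: ler_wpM2l; first exact: sqr_ge0.
  by rewrite ler_pdivlMr// mulrC.
have p5 : pr P [set w | exists k : 'I_m.+1,
    z <= scaled_error N B b A (step_grid R q m) M k w] <= pr P' E + e6 by near: M.
have cov := @exceedance_cover _ _ _ _ _ _ hN B b h _ _ _ _ _ _ _ _ m KP K0 M_0 q_0 Mq a0 Hq (ltW z0) Zle.
have mE1 := measurable_remainder_event hN b Biid hmeas (step_index M q 0) dl.
have mE2 := measurable_oscillation b Biid M q m a.
have mE3 := measurable_deviation b Biid (step_index M q 0) (H / Num.sqrt M).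
have mE4 := measurable_deviation b Biid (step_index M q m) (a / Num.sqrt M).
have mE5 : measurable [set w | exists k : 'I_m.+1,
    z <= scaled_error N B b A (step_grid R q m) M k w].
  apply: measurable_exists => k; apply: measurable_ge.
  exact: (measurable_scaled_error hN b Biid A (step_grid R q m) M).
have mE45 := measurableU _ _ mE4 mE5; have mE345 := measurableU _ _ mE3 mE45.
have mE2345 := measurableU _ _ mE2 mE345.
have h1 := le_prU P (measurable_exceedance hN b Biid hmeas M Z) mE1 mE2345 cov.
have h2 := prU P mE2 mE345; have h3 := prU P mE3 mE45; have h4 := prU P mE4 mE5.
have : e = e6 + e6 + e6 + e6 + e6 by rewrite /e6; field.
move: p1 p2 p3 p4 p5 h1 h2 h3 h4.
set t1 := pr P _; set t2 := pr P _; set t3 := pr P _; set t4 := pr P _; lra.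
Unshelve. all: by end_near. Qed.

Definition uniform_grid (J k : nat) : R := k%:R / J%:R.

Lemma exceedance_liminf (J : nat) (Z hi e : R) : (0 < J)%N ->
  0 < Z -> Z < hi -> 0 < e ->
  \forall M \near +oo,
  pr P' [set w | exists k : 'I_J, hi <= limit_error N (uniform_grid J) W Q k w] <=
  pr P (exceedance N B b h M Z) + e.
Proof.
move=> J0 Z0 Zhi e0.
have JR : 0 < J%:R :> R by rewrite ltr0n.
pose g := (hi - Z) / 2; pose lo := Z + g.
have g0 : 0 < g by rewrite divr_gt0// subr_gt0.
have lo0 : 0 < lo by rewrite addr_gt0.
have lohi : lo < hi by rewrite /lo /g; move: Zhi; lra.
have e20 : 0 < e / 2 by rewrite divr_gt0.
have [m0 m00 rem] := remainder_small hN Biid Bm hmeas hC1 g0 e20.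
have u0 : uniform_grid J 0 = 0 by rewrite /uniform_grid mul0r.
have upos k : 0 < uniform_grid J k.+1 by rewrite divr_gt0.
have nu : nondecreasing_seq (uniform_grid J).
  by move=> k k' kk; rewrite ler_wpM2r ?invr_ge0// ler_nat.
have u1 (k : 'I_J) : uniform_grid J k.+1 <= 1 by rewrite ler_pdivrMr// mul1r ler_nat.
have fdd := cvg_exists_error J hN Biid Bm u0 upos nu HW HQ lo0 lohi e20.
near=> M.
have M0 : 0 < M by near: M; exact: nbhs_pinfty_gt.
have sM : 0 < Num.sqrt M by rewrite sqrtr_gt0.
have Mm : m0%:R <= M by near: M; apply: nbhs_pinfty_ge; exact: num_real.
pose m := (Num.truncn M).+1.
have Mm1 : M < m%:R by exact: truncnS_gt.
have p1 : pr P (remainder_event N B b h m g) <= e / 2.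
  by apply: rem; rewrite -(ler_nat R) (le_trans Mm)// ltW.
have p2 : pr P' [set w | exists k : 'I_J, hi <= limit_error N (uniform_grid J) W Q k w] <=
    pr P [set w | exists k : 'I_J, lo <= scaled_error N B b A (uniform_grid J) M k w] + e / 2.
  by near: M; apply: filterS fdd => M [].
suff sub : [set w | exists k : 'I_J, lo <= scaled_error N B b A (uniform_grid J) M k w] `<=`
    exceedance N B b h M Z `|` remainder_event N B b h m g.
  have mE : measurable [set w | exists k : 'I_J, lo <= scaled_error N B b A (uniform_grid J) M k w].
    apply: measurable_exists => k; apply: measurable_ge.
    exact: (measurable_scaled_error hN b Biid A (uniform_grid J) M).
  have := le_prU P mE (measurable_exceedance hN b Biid hmeas M Z)
    (measurable_remainder_event hN b Biid hmeas m g) sub.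
  move: p1 p2; lra.
move=> w [k]; set n := grid_index (uniform_grid J) M k.
rewrite /scaled_error -/n (distZ hN) (gtr0_norm sM) => hk.
have Mn : M < n%:R.
  apply: le_lt_trans (grid_index_gt (uniform_grid J) M k).
  by rewrite ler_pdivlMr// ler_piMr ?(ltW M0).
have mn : (m <= n)%N by rewrite truncn_lt_nat ?(ltW M0).
have [hr|hr] := leP g (Num.sqrt m%:R * N (remainder B h b n w)); first by right; exists n.
left; exists n => //.
have hr' : Num.sqrt M * N (remainder B h b n w) < g.
  by apply: le_lt_trans hr; rewrite ler_wpM2r ?(dist_ge0 hN)// ler_wsqrtr// ltW.
have : N (A *m (average B n w - b)) <=
    N (estimator B h n w - apply_cV h b) + N (- remainder B h b n w).
  rewrite (_ : A *m _ = (estimator B h n w - apply_cV h b) - remainder B h b n w).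
    exact: (dist_triangle hN).
  by rewrite /remainder opprB [RHS]addrC subrK.
rewrite (distN hN) => /(ler_wpM2l (ltW sM)); rewrite mulrDr => h1.
by move: (le_trans hk h1) hr'; rewrite /lo; lra.
Unshelve. all: by end_near. Qed.

End exceedance_limits.

(** * The supremum of the limit process *)

Section suprema.
Context {R : realType}.

Lemma ereal_sup_leP (S : Type) (D : set S) (f : S -> R) (y : R) :
  (ereal_sup [set (f s)%:E | s in D] <= y%:E)%E <-> (forall s, D s -> f s <= y).
Proof.
split=> [h s Ds|h].
  by rewrite -lee_fin; apply: le_trans h; apply: ereal_sup_ubound; exists s.
by apply: ge_ereal_sup => _ [s Ds <-]; rewrite lee_fin h.
Qed.

Lemma measurable_fun_sublevel d (T : measurableType d) (f : T -> \bar R) :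
  (forall y : R, measurable [set w | (f w <= y%:E)%E]) -> measurable_fun setT f.
Proof.
move=> mf; apply: (measurability _ (ErealGenOInfty.measurableE R)) => //.
move=> _ [_ [y ->] <-]; rewrite setTI.
rewrite (_ : _ @^-1` _ = ~` [set w | (f w <= y%:E)%E]); first exact: measurableC.
by apply/seteqP; split => w /=; rewrite in_itv/= andbT ltNge => /negP.
Qed.

End suprema.

Section brownian_paths.
Context d' (T' : measurableType d') (R : realType) (P' : probability T' R).
Variables (p : nat) (N : 'cV[R]_p -> R).
Hypothesis hN : distance_function N.
Variables (W : 'I_p -> R -> T' -> R) (Q : 'M[R]_p).
Hypothesis HW : independent_Brownian_motions P' W.

Local Notation path s w := (N (Q *m \col_j W j s w)).

Lemma path_continuous w (s e : R) : 0 <= s -> 0 < e ->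
  exists2 dl : R, 0 < dl & forall t, 0 <= t -> `|s - t| < dl -> path s w <= path t w + e.
Proof.
move=> s0 e0; have [K K0 KP] := dist_mulmx hN Q.
pose e1 := e / (K * p.+1%:R).
have e10 : 0 < e1 by rewrite divr_gt0// mulr_gt0.
have : \forall t \near within `[0, +oo[ (nbhs s), forall j, `|W j s w - W j t w| <= e1.
  apply: filter_forall => j; have [/(_ j)[_ _ _ _ cW] _] := HW.
  have /subspace_continuousP/(_ s) := cW w.
  by rewrite /= in_itv/= s0 => /(_ isT) /cvgrPdist_le/(_ e1 e10).
move=> /nbhs_ballP[dl dl0 H]; exists dl => // t t0 st.
have {}H : forall j, `|W j s w - W j t w| <= e1.
  by apply: H => //; rewrite /= in_itv/= t0.
have h : N (Q *m (\col_j W j s w) - Q *m (\col_j W j t w)) <= e.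
  rewrite -mulmxBr; apply: (le_trans (KP _)).
  apply: (@le_trans _ _ (K * \sum_(j < p) e1)).
    by rewrite ler_wpM2l ?(ltW K0)//; apply: ler_sum => j _; rewrite !mxE.
  rewrite sumr_const card_ord -[_ *+ p]mulr_natr.
  have -> : K * (e1 * p%:R) = e * (p%:R / p.+1%:R).
    have : 0 < p.+1%:R :> R by rewrite ltr0n.
    by rewrite /e1; set q : R := p.+1%:R => q0; field; rewrite !gt_eqF.
  by apply: ler_piMr; rewrite ?ltW// ltr_pdivrMr// mul1r ltr_nat.
by have := dist_diff hN (Q *m (\col_j W j s w)) (Q *m (\col_j W j t w));
  rewrite ler_norml => /andP[_]; move: h; lra.
Qed.

(** The point 0 is not in any dyadic grid; it is reached by continuity like the
    others, from the right. *)
Lemma path_dyadic w z :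
  (forall j (k : 'I_(2 ^ j)), path (uniform_grid R (2 ^ j) k.+1) w <= z) <->
  (forall s, s \in `[0, 1] -> path s w <= z).
Proof.
split=> [H s|H j k]; last first.
  apply: H; rewrite in_itv/= /uniform_grid divr_ge0//=.
  by rewrite ler_pdivrMr ?ltr0n ?expn_gt0// mul1r ler_nat.
rewrite in_itv/= => /andP[s0]; rewrite le_eqVlt => /predU1P[->|s1].
  by have := H 0%N ord0; rewrite /uniform_grid /= divr1.
apply/ler_addgt0Pr => e e0; have [dl dl0 dP] := path_continuous w s0 e0.
pose j := (Num.truncn dl^-1).+1.
have J0 : 0 < (2 ^ j)%:R :> R by rewrite ltr0n expn_gt0.
have jd : ((2 ^ j)%:R)^-1 < dl.
  rewrite -[ltRHS]invrK ltf_pV2 ?posrE ?invr_gt0//.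
  apply: (lt_trans (truncnS_gt _)); rewrite ltr_nat; exact: ltn_expl.
(* [k.+1 / 2 ^ j] is the first dyadic point of order [j] after [s]. *)
pose k := Num.truncn (s * (2 ^ j)%:R).
have sJ0 : 0 <= s * (2 ^ j)%:R by rewrite mulr_ge0.
have kJ : (k < 2 ^ j)%N by rewrite truncn_lt_nat// gtr_pMl.
have h1 : s * (2 ^ j)%:R < k.+1%:R by exact: truncnS_gt.
have h2 : k%:R <= s * (2 ^ j)%:R by rewrite -truncn_ge_nat.
pose t := uniform_grid R (2 ^ j) k.+1.
have st : s < t by rewrite /t /uniform_grid ltr_pdivlMr.
have ts : t - s <= ((2 ^ j)%:R)^-1.
  rewrite lerBlDr /t /uniform_grid ler_pdivrMr// mulrDl mulVf ?gt_eqF//.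
  by rewrite -natr1 addrC lerD2l.
have := dP t (le_trans s0 (ltW st)).
rewrite distrC ger0_norm ?subr_ge0 ?(ltW st)// => /(_ (le_lt_trans ts jd)).
move=> /le_trans; apply; rewrite lerD2r; exact: (H j (Ordinal kJ)).
Qed.

Definition path_sup w : \bar R :=
  ereal_sup [set (path s w ^+ 2)%:E | s in `[0, 1]].

Lemma path_sup_leP w z : 0 <= z ->
  (path_sup w <= (z ^+ 2)%:E)%E <-> (forall s, s \in `[0, 1] -> path s w <= z).
Proof.
move=> z0; split=> [/ereal_sup_leP h s s01|h]; last first.
  apply/ereal_sup_leP => s s01; apply: lerXn2r; rewrite ?nnegrE ?(dist_ge0 hN)//.
  exact: h.
have := h s; rewrite /= s01 => /(_ isT).
by rewrite ler_sqr ?nnegrE ?(dist_ge0 hN).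
Qed.

Lemma path_sup_lt0 w y : y < 0 -> ~ (path_sup w <= y%:E)%E.
Proof.
move=> y0 /ereal_sup_leP/(_ 0); rewrite /= in_itv/= lexx ler01 => /(_ isT).
by apply/negP; rewrite -ltNge (lt_le_trans y0)// sqr_ge0.
Qed.

Let measurable_dyadic j (k : 'I_(2 ^ j)) :
  measurable_fun setT (limit_error N (uniform_grid R (2 ^ j)) W Q k).
Proof.
apply: (measurable_limit_error (m := 2 ^ j) hN _ _ Q HW); first by rewrite /uniform_grid mul0r.
by move=> i i' ii; rewrite ler_wpM2r ?invr_ge0// ler_nat.
Qed.

(** The sublevel sets are countable intersections over dyadic times. *)
Lemma measurable_path_sup : measurable_fun setT path_sup.
Proof.
apply: measurable_fun_sublevel => y; have [y0|y0] := ltP y 0.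
  rewrite (_ : [set w | _] = set0)//; apply/seteqP; split => // w; exact: path_sup_lt0.
rewrite (_ : [set w | _] = \bigcap_j \bigcap_(k in [set: 'I_(2 ^ j)])
    [set w | limit_error N (uniform_grid R (2 ^ j)) W Q k w <= Num.sqrt y]).
  apply: bigcapT_measurable => j; apply: fin_bigcap_measurable => // k _.
  rewrite (_ : [set w | _] = ~` [set w | Num.sqrt y <
      limit_error N (uniform_grid R (2 ^ j)) W Q k w]).
    apply: measurableC; rewrite -[X in measurable X]setTI.
    have := measurable_dyadic k => /(_ measurableT `]Num.sqrt y, +oo[%classic).
    rewrite (_ : _ @^-1` _ = [set w | Num.sqrt y <
      limit_error N (uniform_grid R (2 ^ j)) W Q k w]).
      by apply; exact: measurable_itv.
    by apply/seteqP; split => w /=; rewrite in_itv/= andbT.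
  by apply/seteqP; split => w /=; rewrite leNgt => /negP.
have sy : Num.sqrt y ^+ 2 = y by rewrite sqr_sqrtr.
apply/seteqP; split => w /=.
  by rewrite -{1}sy => /path_sup_leP/path_dyadic H j _ k _; exact: H.
by move=> H; rewrite -{1}sy; apply/path_sup_leP => //; apply/path_dyadic => j k; exact: H.
Qed.

(** The events that no dyadic point of order [j] is large decrease with [j] to the
    event that no point at all is large. *)
Lemma exists_dyadic_bound (hi e : R) : 0 < hi -> 0 < e ->
  exists2 J, (0 < J)%N & 1 - pr P' [set w | exists k : 'I_J,
    hi <= limit_error N (uniform_grid R J) W Q k w] <=
  pr P' [set w | (path_sup w <= (hi ^+ 2)%:E)%E] + e.
Proof.
move=> hi0 e0.
pose E j := [set w | exists k : 'I_(2 ^ j), hi <= limit_error N (uniform_grid R (2 ^ j)) W Q k w].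
have mE j : measurable (E j).
  by apply: measurable_exists => k; apply: measurable_ge; exact: measurable_dyadic.
have mC j : measurable (~` E j) by exact: measurableC.
have niC : nonincreasing_seq (fun j => ~` E j).
  apply/nonincreasing_seqP => j; rewrite subsetEset; apply: subsetC => w [k hk].
  have kj : (k.*2.+1 < 2 ^ j.+1)%N by rewrite expnS mul2n -doubleS leq_double ltn_ord.
  exists (Ordinal kj); move: hk; rewrite /limit_error /uniform_grid/=.
  suff -> : k.*2.+2%:R / (2 ^ j.+1)%:R = k.+1%:R / (2 ^ j)%:R :> R by [].
  by rewrite -doubleS -mul2n expnS !natrM; field; rewrite !pnatr_eq0 expn_eq0.
have [j hj] := pr_bigcap_cvg P' mC niC e0.
exists (2 ^ j)%N; first by rewrite expn_gt0.
rewrite -(prC P' (mE j)); apply: (le_trans hj); rewrite lerD2r; apply: le_pr.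
- exact: bigcapT_measurable.
- by have := emeasurable_fun_infty_c measurableT measurable_path_sup (hi ^+ 2)%:E; rewrite setTI.
move=> w Hw; apply/path_sup_leP; first exact: ltW.
apply/path_dyadic => i k; apply/ltW; rewrite ltNge; apply/negP => hk.
by apply: (Hw i Logic.I); exists k.
Qed.

End brownian_paths.

(** * The last exit time *)

Section last_exit_time.
Context d (T : measurableType d) (R : realType) (P : probability T R).
Variables (p r : nat) (N : 'cV[R]_p -> R).
Hypothesis hN : distance_function N.
Variables (B : nat -> T -> 'cV[R]_r) (b : 'cV[R]_r) (S : 'M[R]_r).
Hypothesis Biid : iid_vectors P B.
Hypothesis Bm : forall i, has_mean_cov P (B i) b S.
Variable h : 'I_p -> 'cV[R]_r -> R.
Hypothesis hmeas : forall j, measurable_fun [set: borel_cV R r] (h j : borel_cV R r -> R).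
Hypothesis hC1 : forall j, C1_near (h j) b.

Local Notation exit := (last_exit N (estimator B h) (apply_cV h b)).

Lemma last_exit_leP eps w (y : R) : (exit eps w <= y%:E)%E <->
  0 <= y /\ forall n, (1 <= n)%N -> eps <= N (estimator B h n w - apply_cV h b) -> n%:R <= y.
Proof.
rewrite /last_exit ge_max lee_fin; split.
  by move=> /andP[y0 /ereal_sup_leP H]; split=> // n n1 hn; exact: H.
by move=> [y0 H]; apply/andP; split=> //; apply/ereal_sup_leP => n [n1 hn]; exact: H.
Qed.

Lemma measurable_last_exit eps : measurable_fun setT (exit eps).
Proof.
apply: measurable_fun_sublevel => y; have [y0|y0] := ltP y 0.
  rewrite (_ : [set w | _] = set0)//; apply/seteqP; split => // w /last_exit_leP[].
  by rewrite leNgt y0.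
rewrite (_ : [set w | _] = ~` [set w | exists2 n, (1 <= n)%N /\ y < n%:R &
    eps <= N (estimator B h n w - apply_cV h b)]).
  apply: measurableC.
  apply: (@measurable_exists_nat _ _ [set n | (1 <= n)%N /\ y < n%:R]
    (fun n => [set w | eps <= N (estimator B h n w - apply_cV h b)])) => n.
  by apply: measurable_ge; exact: (measurable_error hN Biid hmeas).
apply/seteqP; split => w.
  by move=> /last_exit_leP[_ H] [n [n1 yn] hn]; move: (H n n1 hn); rewrite leNgt yn.
move=> H; apply/last_exit_leP; split=> // n n1 hn; rewrite leNgt; apply/negP => yn.
by apply: H; exists n.
Qed.

(** Multiplying the condition [eps <= N error] by [sqrt M = sqrt y / eps] frees its
    right-hand side from [eps]. *)
Lemma scaled_exit_le eps (y : R) : 0 < eps -> 0 < y ->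
  [set w | ((eps ^+ 2)%:E * exit eps w <= y%:E)%E] =
  ~` exceedance N B b h (y / eps ^+ 2) (Num.sqrt y).
Proof.
move=> e0 y0; have e20 : 0 < eps ^+ 2 by exact: exprn_gt0.
have sy : 0 < Num.sqrt y by rewrite sqrtr_gt0.
have hs x : (Num.sqrt y <= Num.sqrt (y / eps ^+ 2) * x) = (eps <= x).
  rewrite sqrtrM ?(ltW y0)// sqrtrV ?sqr_ge0// sqrtr_sqr (gtr0_norm e0).
  by rewrite -mulrA ler_pMr// mulrC ler_pdivlMr// mul1r.
rewrite (_ : [set w | _] = [set w | (exit eps w <= (y / eps ^+ 2)%:E)%E]); last first.
  apply/seteqP; split => w /=; rewrite -lee_pdivlMl//.
    by rewrite -EFinM mulrC.
  by rewrite -EFinM [X in (_ <= X%:E)%E]mulrC.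
apply/seteqP; split => w.
  move=> /last_exit_leP[_ H] [n yn]; rewrite hs => hn; move: (H n); rewrite [n%:R <= _]leNgt yn.
  have n0 : (0 < n)%N by rewrite -(ltr0n R) (lt_trans _ yn)// divr_gt0.
  by move=> /(_ n0 hn).
move=> H; apply/last_exit_leP; split; first by rewrite divr_ge0// ltW.
move=> n n1 hn; rewrite leNgt; apply/negP => yn; apply: H; exists n => //.
by rewrite hs.
Qed.

Lemma scaled_exit_lt0 eps (y : R) w : y < 0 ->
  ~ ((eps ^+ 2)%:E * exit eps w <= y%:E)%E.
Proof.
move=> y0; apply/negP; rewrite -ltNge (@lt_le_trans _ _ 0%E) ?lte_fin//.
by rewrite mule_ge0 ?lee_fin ?sqr_ge0// /last_exit le_max lexx.
Qed.

(** A scaled supremum that is at least [dl] need not be attained, but one of its terms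
    is then at least [dl / 2]. *)
Lemma remainder_sup_cvg : cvg_in_probability P
    (fun (m : nat) w => ((Num.sqrt m%:R)%:E *
       ereal_sup [set (N (remainder B h b n w))%:E | n in [set n | (m <= n)%N]])%E) 0.
Proof.
have mX m : measurable_fun setT (fun w => ((Num.sqrt m%:R)%:E *
       ereal_sup [set (N (remainder B h b n w))%:E | n in [set n | (m <= n)%N]])%E).
  apply: measurable_funeM; apply: measurable_fun_sublevel => y.
  rewrite (_ : [set w | _] = ~` [set w | exists2 n, (m <= n)%N & y < N (remainder B h b n w)]).
    apply: measurableC; apply: (@measurable_exists_nat _ _ [set n | (m <= n)%N]
      (fun n => [set w | y < N (remainder B h b n w)])) => n.
    rewrite (_ : [set w | _] = ~` [set w | - y <= - N (remainder B h b n w)]).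
      apply: measurableC; apply: measurable_ge; apply: measurableT_comp => //.
      exact: (measurable_remainder hN b Biid hmeas).
    by apply/seteqP; split => w /=; rewrite lerN2 ltNge => /negP.
  apply/seteqP; split => w.
    by move=> /ereal_sup_leP H [n mn]; rewrite ltNge H.
  move=> H; apply/ereal_sup_leP => n mn; rewrite leNgt; apply/negP => hn.
  by apply: H; exists n.
split=> // dl dl0.
have mE m : measurable [set w | (dl%:E <= `|(Num.sqrt m%:R)%:E *
    ereal_sup [set (N (remainder B h b n w))%:E | n in [set n | (m <= n)%N]] - 0%:E|)%E].
  rewrite -[X in measurable X]setTI; apply: emeasurable_fun_c_infty => //.
  by apply: measurableT_comp => //; apply: emeasurable_funB.
apply: (@cvg_EFin _ _ _ _ _ 0); first by apply: nearW => m; exact: fin_num_measure.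
apply/cvgrPdist_le => e e0; have dl20 : 0 < dl / 2 by rewrite divr_gt0.
have [m0 m00 rem] := remainder_small hN Biid Bm hmeas hC1 dl20 e0.
near=> m; have mm : (m0 <= m)%N by near: m; exact: nbhs_infty_ge.
have m_0 : (0 < m)%N by exact: leq_trans mm.
rewrite sub0r normrN ger0_norm ?fine_ge0 ?measure_ge0//=.
apply: le_trans (rem m mm); apply: le_pr => //.
  exact: (measurable_remainder_event hN b Biid hmeas).
move=> w /=; rewrite sube0 => hw; apply: contrapT => nr; move: hw; apply/negP; rewrite -ltNge.
have sup_ge0 : (0 <= ereal_sup [set (N (remainder B h b n w))%:E | n in [set n | (m <= n)%N]])%E.
  apply: (@le_trans _ _ (N (remainder B h b m w))%:E); first by rewrite lee_fin (dist_ge0 hN).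
  by apply: ereal_sup_ubound; exists m => /=.
rewrite gee0_abs ?mule_ge0//.
apply: (@le_lt_trans _ _ (dl / 2)%:E); last by rewrite lte_fin ltr_pdivrMr// ltr_pMr// ltr1n.
rewrite -lee_pdivlMl ?sqrtr_gt0 ?ltr0n// -EFinM; apply/ereal_sup_leP => n mn.
rewrite ler_pdivlMl ?sqrtr_gt0 ?ltr0n//; apply/ltW; rewrite ltNge; apply/negP => hn.
by apply: nr; exists n.
Unshelve. all: by end_near. Qed.

End last_exit_time.

(** * Convergence of the distribution functions *)

Lemma near_inverse_square (R : realType) (y : R) (A : R -> Prop) : 0 < y ->
  (\forall M \near +oo, A M) -> \forall eps \near 0^'+, A (y / eps ^+ 2).
Proof.
move=> y0 [M0 [_ HM]].
have c0 : 0 < y / (`|M0| + 1) by rewrite divr_gt0// ltr_wpDl.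
near=> eps; apply: HM.
have e0 : 0 < eps by near: eps; exact: nbhs_right_gt.
have e1 : eps < 1 by near: eps; exact: nbhs_right_lt.
have e2 : eps < y / (`|M0| + 1) by near: eps; exact: (nbhs_right_lt c0).
rewrite ltr_pdivlMr ?exprn_gt0//.
rewrite ltr_pdivlMr ?ltr_wpDl// in e2.
have hM := ler_norm M0; have hn := normr_ge0 M0.
have : M0 * eps ^+ 2 <= `|M0| * eps.
  apply: (le_trans (ler_wpM2r (sqr_ge0 _) hM)); rewrite ler_wpM2l// expr2.
  by rewrite ler_piMl ?ltW.
by move: e2 e0; rewrite mulrDr mulr1 (mulrC eps); lra.
Unshelve. all: by end_near. Qed.

Section weak_limit.
Context d (T : measurableType d) (R : realType) (P : probability T R).
Context d' (T' : measurableType d') (P' : probability T' R).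
Variables (p r : nat) (N : 'cV[R]_p -> R).
Hypothesis hN : distance_function N.
Variables (B : nat -> T -> 'cV[R]_r) (b : 'cV[R]_r) (S : 'M[R]_r).
Hypothesis Biid : iid_vectors P B.
Hypothesis Bm : forall i, has_mean_cov P (B i) b S.
Variable h : 'I_p -> 'cV[R]_r -> R.
Hypothesis hmeas : forall j, measurable_fun [set: borel_cV R r] (h j : borel_cV R r -> R).
Hypothesis hC1 : forall j, C1_near (h j) b.
Variables (W : 'I_p -> R -> T' -> R) (Q : 'M[R]_p).
Hypothesis HW : independent_Brownian_motions P' W.
Hypothesis HQ : is_psd_sqrt Q (Jacobi h b *m S *m (Jacobi h b)^T).

Let X (eps : R) w := ((eps ^+ 2)%:E * last_exit N (estimator B h) (apply_cV h b) eps w)%E.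
Let Y := path_sup N W Q.
Let F y := pr P' [set w | (Y w <= y%:E)%E].
Let G eps y := pr P [set w | (X eps w <= y%:E)%E].

Let mY y : measurable [set w | (Y w <= y%:E)%E].
Proof.
by have := emeasurable_fun_infty_c measurableT (measurable_path_sup hN Q HW) y%:E; rewrite setTI.
Qed.

Let mX eps : measurable_fun setT (X eps).
Proof. by apply: measurable_funeM; exact: (measurable_last_exit hN b Biid hmeas). Qed.

Let mXle eps y : measurable [set w | (X eps w <= y%:E)%E].
Proof. by have := emeasurable_fun_infty_c measurableT (mX eps) y%:E; rewrite setTI. Qed.

Let GE eps y : 0 < eps -> 0 < y ->
  G eps y = 1 - pr P (exceedance N B b h (y / eps ^+ 2) (Num.sqrt y)).
Proof.
move=> e0 y0; rewrite /G /X scaled_exit_le// prC//.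
exact: (measurable_exceedance hN b Biid hmeas).
Qed.

Let sqrt_mid (y y' : R) : 0 < y -> y < y' -> exists2 z, Num.sqrt y < z < Num.sqrt y' & y < z ^+ 2 < y'.
Proof.
move=> y0 yy; have y'0 : 0 < y' by rewrite (lt_trans y0).
exists (Num.sqrt ((y + y') / 2)).
  by rewrite !ltr_sqrt//; [apply/andP; split; lra|rewrite divr_gt0// addr_gt0].
by rewrite sqr_sqrtr; [apply/andP; split; lra|rewrite divr_ge0// addr_ge0// ltW].
Qed.

Lemma cdf_limsup y y' e : 0 < y -> y < y' -> 0 < e -> \forall eps \near 0^'+, G eps y <= F y' + e.
Proof.
move=> y0 yy e0; have [z /andP[z1 z2] /andP[z3 z4]] := sqrt_mid y0 yy.
have sy : 0 < Num.sqrt y by rewrite sqrtr_gt0.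
have z0 : 0 < z by rewrite (lt_trans sy).
have e20 : 0 < e / 2 by rewrite divr_gt0.
have [J J0 hJ] := exists_dyadic_bound hN Q HW z0 e20.
have := near_inverse_square y0 (exceedance_liminf hN Biid Bm hmeas hC1 HW HQ J0 sy z1 e20).
move=> H; near=> eps; have eps0 : 0 < eps by near: eps; exact: nbhs_right_gt.
have h1 : pr P' [set w | exists k : 'I_J, z <= limit_error N (uniform_grid R J) W Q k w] <=
  pr P (exceedance N B b h (y / eps ^+ 2) (Num.sqrt y)) + e / 2 by near: eps.
have h2 : pr P' [set w | (path_sup N W Q w <= (z ^+ 2)%:E)%E] <= F y'.
  apply: le_pr; [exact: (mY (z ^+ 2))|exact: mY|].
  by move=> w /= /le_trans; apply; rewrite lee_fin ltW.
rewrite GE//; move: h1 h2 hJ; lra.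
Unshelve. all: by end_near. Qed.

Lemma cdf_liminf y y' e : 0 < y' -> y' < y -> 0 < e -> \forall eps \near 0^'+, F y' <= G eps y + e.
Proof.
move=> y0 yy e0; have [z /andP[z1 z2] /andP[z3 z4]] := sqrt_mid y0 yy.
have sy : 0 < Num.sqrt y' by rewrite sqrtr_gt0.
have z0 : 0 < z by rewrite (lt_trans sy).
have y_0 : 0 < y by rewrite (lt_trans y0).
have EP s w : 0 <= s <= 1 -> z <= N (Q *m \col_j W j s w) -> (~` [set w | (Y w <= y'%:E)%E]) w.
  move=> s01 hz /ereal_sup_leP/(_ s); rewrite /= in_itv/= => /(_ s01).
  by apply/negP; rewrite -ltNge (lt_le_trans z3)// lerXn2r ?nnegrE ?(dist_ge0 hN)// ltW.
have := near_inverse_square y_0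
  (exceedance_limsup hN Biid Bm hmeas hC1 HW HQ (measurableC (mY y')) EP z0 z2 e0).
move=> H; near=> eps; have eps0 : 0 < eps by near: eps; exact: nbhs_right_gt.
have : pr P (exceedance N B b h (y / eps ^+ 2) (Num.sqrt y)) <=
  pr P' (~` [set w | (Y w <= y'%:E)%E]) + e by near: eps.
rewrite GE// prC//; rewrite /F; lra.
Unshelve. all: by end_near. Qed.

(** The two bounds are for [y > 0]. At a continuity point 0 they still give the
    limit, because the limit law gives no mass to the negative numbers; at negative
    points both sides vanish. *)
Lemma scaled_exit_cvg : cvg_in_distribution P P' (0^'+ : set_system R) X Y.
Proof.
split; [by apply: nearW => eps; exact: mX|exact: (measurable_path_sup hN Q HW)|move=> x cx].
have cF (e : R) : 0 < e -> exists2 dl, 0 < dl & forall y, `|x - y| < dl -> `|F x - F y| <= e.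
  move=> e0.
  have /fine_cvg cF : (fun y : R => P' [set w | (Y w <= y%:E)%E]) y @[y --> x] --> (F x)%:E.
    by rewrite /F -(prE P' (mY x)); exact: cx.
  have /cvgrPdist_le/(_ e e0)/nbhs_ballP[dl dl0 H] := cF.
  by exists dl => // y xy; exact: H.
rewrite prE; last exact: mY.
apply: cvg_EFin; first by apply: nearW => eps; exact: fin_num_measure.
apply/cvgrPdist_le => e e0; rewrite -/(F x).
have e20 : 0 < e / 2 by rewrite divr_gt0.
have [dl dl0 H] := cF (e / 2) e20.
have F0 y : y < 0 -> F y = 0.
  move=> y0; rewrite /F (_ : [set w | _] = set0) ?pr0//.
  by apply/seteqP; split => // w; exact: path_sup_lt0.
have [x0|x0] := ltP x 0.
  near=> eps; rewrite F0// sub0r normrN /= (_ : [set w | _] = set0) ?measure0 ?normr0 ?ltW//.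
  by apply/seteqP; split => // w; exact: scaled_exit_lt0.
have up : \forall eps \near 0^'+, G eps x <= F x + e.
  have y'F : F (x + dl / 2) <= F x + e / 2.
    have : `|F x - F (x + dl / 2)| <= e / 2.
      apply: H; rewrite opprD addrA subrr sub0r normrN ger0_norm ?divr_ge0 ?(ltW dl0)//.
      by rewrite ltr_pdivrMr// ltr_pMr// ltr1n.
    by rewrite ler_norml => /andP[]; lra.
  have y0 : 0 < x + dl / 4 by rewrite ltr_wpDl// divr_gt0.
  have yy : x + dl / 4 < x + dl / 2 by lra.
  apply: filterS (cdf_limsup y0 yy e20) => eps h1.
  have : G eps x <= G eps (x + dl / 4).
    apply: le_pr => // w /= /le_trans; apply; rewrite lee_fin lerDl divr_ge0// ltW//.
  by move: h1 y'F; lra.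
have low : \forall eps \near 0^'+, F x <= G eps x + e.
  move: x0; rewrite le_eqVlt => /predU1P[x0|x0].
    near=> eps; have : F x <= e / 2.
      have : `|F x - F (x - dl / 2)| <= e / 2.
        apply: H; rewrite opprB addrCA subrr addr0 ger0_norm ?divr_ge0 ?(ltW dl0)//.
        by rewrite ltr_pdivrMr// ltr_pMr// ltr1n.
      rewrite (F0 (x - dl / 2)); last by rewrite -x0 sub0r oppr_lt0 divr_gt0.
      by rewrite subr0; apply: le_trans; exact: ler_norm.
    by have := pr_ge0 P [set w | (X eps w <= x%:E)%E]; rewrite -/(G eps x); move: e0; lra.
  pose dl' := Num.min dl x / 2.
  have m0 : 0 < Num.min dl x by rewrite lt_min dl0 x0.
  have dl'0 : 0 < dl' by rewrite divr_gt0.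
  have dd : dl' < Num.min dl x by rewrite ltr_pdivrMr// ltr_pMr// ltr1n.
  move: dd; rewrite lt_min => /andP[d1 d2].
  have y'F : F x <= F (x - dl') + e / 2.
    have : `|F x - F (x - dl')| <= e / 2.
      by apply: H; rewrite opprB addrCA subrr addr0 gtr0_norm.
    by rewrite ler_norml => /andP[]; lra.
  have y0 : 0 < x - dl' by rewrite subr_gt0.
  have yy : x - dl' < x by rewrite ltrBlDr ltrDl.
  apply: filterS (cdf_liminf y0 yy e20) => eps; move: y'F; lra.
near=> eps.
have h1 : G eps x <= F x + e by near: eps.
have h2 : F x <= G eps x + e by near: eps.
rewrite /= -/(pr P _) -/(G eps x) ler_norml; apply/andP; split; lra.
Unshelve. all: by end_near. Qed.

End weak_limit.

(** * Asymptotics of the remainder and of the last exit *)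

Theorem mainTheorem4 (R : realType) (p r : nat)
    (N : 'cV[R]_p -> R) (hN : distance_function N)
    (d : measure_display) (Omega : measurableType d) (P : probability Omega R)
    (B : nat -> Omega -> 'cV[R]_r) (b : 'cV[R]_r) (T : 'M[R]_r)
    (Biid : iid_vectors P B)
    (Bmoments : forall i, has_mean_cov P (B i) b T)
    (h : 'I_p -> 'cV[R]_r -> R)
    (hmeas : forall j, measurable_fun [set: borel_cV R r]
                         (h j : borel_cV R r -> R))
    (hC1 : forall j, C1_near (h j) b) :
  let Sigma0 := Jacobi h b *m T *m (Jacobi h b)^T in
  cvg_in_probability P
    (fun (m : nat) w => ((Num.sqrt m%:R)%:E *
       ereal_sup [set (N (remainder B h b n w))%:E | n in [set n | (m <= n)%N]])%E)
    0 /\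
  (forall (d' : measure_display) (Omega' : measurableType d')
     (P' : probability Omega' R) (W : 'I_p -> R -> Omega' -> R)
     (Sigma0_half : 'M[R]_p),
     independent_Brownian_motions P' W ->
     is_psd_sqrt Sigma0_half Sigma0 ->
     cvg_in_distribution P P' (0^'+ : set_system R)
       (fun (eps : R) w =>
          ((eps ^+ 2)%:E *
           last_exit N (estimator B h) (apply_cV h b) eps w)%E)
       (fun w =>
          ereal_sup
            [set (N (Sigma0_half *m (\col_(j < p) W j s w)) ^+ 2)%:E |
               s in `[0, 1]])).
Proof.
split; first exact: (remainder_sup_cvg hN Biid Bmoments hmeas hC1).
move=> d' Omega' P' W Q HW HQ.
exact: (scaled_exit_cvg hN Biid Bmoments hmeas hC1 HW HQ).
Qed.
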